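(* Let $k$ be an algebraically closed field of prime characteristic $p$, and let $\Lambda$ be a finite dimensional weakly symmetric $k$-algebra. Let $C_\Lambda$ be the Cartan matrix of $\Lambda$. (a) If $\Lambda$ is $\tau$-tilting finite, then $C_\Lambda$ is positive definite. (b) If $\Lambda$ is $g$-tame, then $C_\Lambda$ is positive semidefinite.
   Context: Modules are finitely generated left modules. Let $P_1,\ldots,P_t$ be all the indecomposable projective $\Lambda$-modules up to isomorphism, without repetition. Cartan matrix: $C_\Lambda$ is the $t\times t$ matrix whose $(i,j)$-entry is $\dim_k\mathrm{Hom}_\Lambda(P_i,P_j)$. Positive definite (resp. positive semidefinite) means $v^\top C_\Lambda v>0$ for all nonzero $v\in\mathbb{R}^t$ (resp. $v^\top C_\Lambda v\ge 0$ for all $v\in\mathbb{R}^t$); the matrix is not presupposed to be symmetric. Weakly symmetric: $\Lambda$ is selfinjective and the socle of each indecomposable projective module is isomorphic to its top (equivalently, the Nakayama permutation is the identity). $\tau$-tilting finite: for a module $M$ let $|M|$ be the number of pairwise nonisomorphic indecomposable direct summands of $M$, and let $\tau$ be the Auslander-Reiten translate. A module $M$ is support $\tau$-tilting if $\mathrm{Hom}_\Lambda(M,\tau M)=0$ and there is a projective module $P$ with $\mathrm{Hom}_\Lambda(P,M)=0$ and $|P|+|M|=|\Lambda|$. $\Lambda$ is $\tau$-tilting finite if there are only finitely many basic support $\tau$-tilting $\Lambda$-modules up to isomorphism. $g$-tame: let $K^b(\Lambda\text{-proj})$ be the homotopy category of bounded complexes of finitely generated projective $\Lambda$-modules. A complex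 $T$ in it is silting if $\mathrm{Hom}_{K^b(\Lambda\text{-proj})}(T,T[i])=0$ for all $i>0$ and the full subcategory $\mathrm{add}\,T$ (complexes isomorphic to direct sums of direct summands of $T$) generates $K^b(\Lambda\text{-proj})$ as a triangulated category; it is two-term if its terms vanish outside degrees $-1,0$. Let $2\text{-silt}\,\Lambda$ be the set of isomorphism classes of basic two-term silting complexes. The Grothendieck groups of $K^b(\Lambda\text{-proj})$ and of $\Lambda\text{-proj}$ are identified; this group $K_0(\Lambda\text{-proj})$ is free abelian with basis $[P_1],\ldots,[P_t]$. For $T=T_1\oplus\cdots\oplus T_r$ with each $T_i$ indecomposable, the $g$-cone of $T$ is $C(T)=\mathbb{R}_{\ge0}[T_1]+\cdots+\mathbb{R}_{\ge0}[T_r]\subset K_0(\Lambda\text{-proj})\otimes_{\mathbb{Z}}\mathbb{R}$. $\Lambda$ is $g$-tame if $\bigcup_{T\in 2\text{-silt}\,\Lambda}C(T)$ is dense in $K_0(\Lambda\text{-proj})\otimes_{\mathbb{Z}}\mathbb{R}$. *)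

(* Defs.v *)
From HB Require Import structures.
From mathcomp Require Import all_boot all_order all_algebra all_field.
From mathcomp Require Import all_classical all_reals all_analysis.

Set Implicit Arguments.
Unset Strict Implicit.
Unset Printing Implicit Defensive.

Import Order.TTheory GRing.Theory Num.Theory.
Import numFieldNormedType.Exports.

Local Open Scope ring_scope.

(* Operations of a preadditive category whose morphisms are taken up to [meq].
   They are used for the module category, where [meq] is equality, and for
   K^b(proj), where [meq] is homotopy of chain maps. *)
Record catdata := CatData {
  ob : Type;
  mor : ob -> ob -> Type;
  meq : forall X Y, mor X Y -> mor X Y -> Prop;
  idm : forall X, mor X X;
  compm : forall X Y Z, mor Y Z -> mor X Y -> mor X Z;
  zerom : forall X Y, mor X Y;
  addm : forall X Y, mor X Y -> mor X Y -> mor X Y }.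

Arguments meq {c X Y}.
Arguments idm {c} X.
Arguments compm {c X Y Z}.
Arguments zerom {c} X Y.
Arguments addm {c X Y}.

Section Additive.
Variable C : catdata.
Implicit Types X Y Z T : ob C.

Definition is_zero X : Prop := meq (idm X) (zerom X X).

Definition iso X Y : Prop :=
  exists (f : mor X Y) (g : mor Y X),
    meq (compm g f) (idm X) /\ meq (compm f g) (idm Y).

(* X is isomorphic to the direct sum of the finite family Y. *)
Definition is_dsum (I : finType) (Y : I -> ob C) X : Prop :=
  exists (inj : forall i, mor (Y i) X) (prj : forall i, mor X (Y i)),
    [/\ forall i, meq (compm (prj i) (inj i)) (idm (Y i)),
        forall i j, i != j -> meq (compm (prj j) (inj i)) (zerom (Y i) (Y j))
      & meq (\big[addm/zerom X X]_(i : I) compm (inj i) (prj i)) (idm X)].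

Definition is_dsum2 Y Z X : Prop :=
  is_dsum (fun b : bool => if b then Y else Z) X.

Definition indecomposable X : Prop :=
  ~ is_zero X /\ forall Y Z, is_dsum2 Y Z X -> is_zero Y \/ is_zero Z.

Definition summand Y X : Prop := exists Z, is_dsum2 Y Z X.

Definition noniso_family r (Y : 'I_r -> ob C) : Prop :=
  forall i j, iso (Y i) (Y j) -> i = j.

Definition basic X : Prop :=
  exists r (Y : 'I_r -> ob C),
    [/\ forall i, indecomposable (Y i), noniso_family Y & is_dsum Y X].

(* |X| = n *)
Definition num_summands X (n : nat) : Prop :=
  exists Y : 'I_n -> ob C,
    [/\ forall i, indecomposable (Y i) /\ summand (Y i) X,
        noniso_family Y
      & forall Z, indecomposable Z -> summand Z X -> exists i, iso Z (Y i)].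

Definition in_add T X : Prop :=
  exists r (Y : 'I_r -> ob C), (forall i, summand (Y i) T) /\ is_dsum Y X.

End Additive.

(* Over a finite dimensional algebra the finitely generated modules are the
   modules of finite dimension over the base field. *)
Record module (k : fieldType) (A : falgType k) := Module {
  msort :> vectType k;
  mact : A -> msort -> msort;
  mact_linearl : forall c a b x,
    mact (c *: a + b) x = c *: mact a x + mact b x;
  mact_linearr : forall a, linear (mact a);
  mact1 : forall x, mact 1 x = x;
  mactM : forall a b x, mact (a * b) x = mact a (mact b x) }.

Record rmodule (k : fieldType) (A : falgType k) := RModule {
  rmsort :> vectType k;
  ract : rmsort -> A -> rmsort;
  ract_linearl : forall a c x y, ract (c *: x + y) a = c *: ract x a + ract y a;
  ract_linearr : forall x, linear (ract x);
  ract1 : forall x, ract x 1 = x;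
  ractM : forall x a b, ract x (a * b) = ract (ract x a) b }.

Section Modules.
Variables (k : fieldType) (A : falgType k).
Implicit Types M N : module A.

HB.instance Definition _ M (a : A) :=
  GRing.isLinear.Build k M M *:%R (mact a) (@mact_linearr k A M a).

Definition act_defect M N (a : A) (f : 'Hom(M, N)) : 'Hom(M, N) :=
  (f \o linfun (mact a))%VF - (linfun (mact a) \o f)%VF.

Lemma act_defectE M N a (f : 'Hom(M, N)) x :
  act_defect a f x = f (mact a x) - mact a (f x).
Proof. by rewrite /act_defect add_lfunE opp_lfunE !comp_lfunE !lfunE. Qed.

Fact act_defect_linear M N a : linear (@act_defect M N a).
Proof.
move=> c f g; apply/lfunP => x.
rewrite [RHS]add_lfunE [X in _ = X + _]scale_lfunE !act_defectE.
rewrite add_lfunE scale_lfunE [X in _ - mact _ X]add_lfunE scale_lfunE.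
by rewrite mact_linearr scalerBr opprD addrACA.
Qed.

HB.instance Definition _ M N a :=
  GRing.isLinear.Build k 'Hom(M, N) 'Hom(M, N) *:%R (@act_defect M N a)
    (@act_defect_linear M N a).

(* It suffices to test A-linearity on a k-basis of A; see [homvP]. *)
Definition homv M N : {vspace 'Hom(M, N)} :=
  (\bigcap_(i < \dim {:A}) lker (linfun (@act_defect M N (vbasis {:A})`_i)))%VS.

Lemma homvP M N (f : 'Hom(M, N)) :
  reflect (forall a x, f (mact a x) = mact a (f x)) (f \in homv M N).
Proof.
apply: (iffP idP) => [fh a x | fh]; last first.
  apply/subv_bigcapP => i _; rewrite -memvE memv_ker lfunE /=.
  by apply/eqP/lfunP => x; rewrite act_defectE fh subrr lfunE.
have actS (V : module A) (v : V) r (F : 'I_r -> A) (c : 'I_r -> k) :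
    mact (\sum_i c i *: F i) v = \sum_i c i *: mact (F i) v.
  have act0 : mact 0 v = 0.
    have := mact_linearl (-1) 0 0 v.
    by rewrite scaler0 addr0 scaleN1r addNr.
  elim/big_rec2: _ => [|i y z _ <-]; first exact: act0.
  exact: mact_linearl.
rewrite (coord_vbasis (memvf a)) !actS linear_sum.
apply: eq_bigr => i _; rewrite linearZ /=; congr (_ *: _).
move/subv_bigcapP: fh => /(_ i isT); rewrite -memvE memv_ker lfunE /=.
by move=> /eqP/lfunP/(_ x); rewrite act_defectE lfunE /= => /eqP; rewrite subr_eq0 => /eqP.
Qed.

Definition Hom M N : vectType k := subvs_of (homv M N).

Lemma HomE M N (f : Hom M N) a x : vsval f (mact a x) = mact a (vsval f x).
Proof. by move: a x; apply/homvP/subvsP. Qed.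

Lemma Hom_ext M N (f g : Hom M N) :
  (forall x, vsval f x = vsval g x) -> f = g.
Proof. by move=> fg; apply/val_inj/lfunP. Qed.

Lemma Hom_addE M N (f g : Hom M N) x :
  vsval (f + g) x = vsval f x + vsval g x.
Proof. by rewrite linearD add_lfunE. Qed.

Lemma Hom_oppE M N (f : Hom M N) x : vsval (- f) x = - vsval f x.
Proof. by rewrite linearN opp_lfunE. Qed.

Lemma Hom_scaleE M N c (f : Hom M N) x : vsval (c *: f) x = c *: vsval f x.
Proof. by rewrite linearZ scale_lfunE. Qed.

Lemma Hom_zeroE M N x : vsval (0 : Hom M N) x = 0.
Proof. by rewrite linear0 zero_lfunE. Qed.

Section MakeHom.
Variables (M N : module A) (f : M -> N).
Hypotheses (f_lin : linear f) (f_act : forall a x, f (mact a x) = mact a (f x)).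

Let f_linear : {linear M -> N} :=
  HB.pack f (GRing.isLinear.Build k M N *:%R f f_lin).

Fact mkHom_subproof : linfun f_linear \in homv M N.
Proof. by apply/homvP => a x; rewrite !lfunE /=. Qed.

Definition mkHom : Hom M N := Subvs mkHom_subproof.

Lemma mkHomE x : vsval mkHom x = f x.
Proof. exact: lfunE. Qed.
End MakeHom.

Fact hid_lin M : linear (@id M). Proof. by []. Qed.
Definition hid M : Hom M M := mkHom (@hid_lin M) (fun _ _ => erefl).

Fact hcomp_lin M N L (g : Hom N L) (f : Hom M N) :
  linear (fun x => vsval g (vsval f x)).
Proof. by move=> c x y; rewrite !linearP. Qed.
Fact hcomp_act M N L (g : Hom N L) (f : Hom M N) a x :
  vsval g (vsval f (mact a x)) = mact a (vsval g (vsval f x)).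
Proof. by rewrite !HomE. Qed.
Definition hcomp M N L (g : Hom N L) (f : Hom M N) : Hom M L :=
  mkHom (hcomp_lin g f) (hcomp_act g f).

Lemma hcompE M N L (g : Hom N L) (f : Hom M N) x :
  vsval (hcomp g f) x = vsval g (vsval f x).
Proof. exact: mkHomE. Qed.

Lemma Hom_congr M N (f g : Hom M N) x : f = g -> vsval f x = vsval g x.
Proof. by move->. Qed.

Definition modcat : catdata :=
  CatData (fun M N : module A => @eq (Hom M N)) hid hcomp
    (fun M N => 0 : Hom M N) (fun M N => +%R : Hom M N -> Hom M N -> Hom M N).

Definition hom_zero M N : Prop := forall f : Hom M N, f = 0.

Definition hom_inj M N (f : Hom M N) : Prop := lker (vsval f) = 0%VS.
Definition hom_surj M N (f : Hom M N) : Prop := limg (vsval f) = fullv.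

Definition projective M : Prop :=
  forall (X Y : module A) (e : Hom X Y) (f : Hom M Y),
    hom_surj e -> exists g : Hom M X, hcomp e g = f.

Definition injective_module M : Prop :=
  forall (X Y : module A) (m : Hom X Y) (f : Hom X M),
    hom_inj m -> exists g : Hom Y M, hcomp g m = f.

Definition submod M (U : {vspace M}) : Prop :=
  forall a x, x \in U -> mact a x \in U.

Definition simple_submod M (U : {vspace M}) : Prop :=
  [/\ submod U, U <> 0%VS
    & forall W : {vspace M}, submod W -> (W <= U)%VS -> W = 0%VS \/ W = U].

Definition maximal_submod M (U : {vspace M}) : Prop :=
  [/\ submod U, U <> fullv
    & forall W : {vspace M}, submod W -> (U <= W)%VS -> W = U \/ W = fullv].

(* N is isomorphic to soc M, the sum of the simple submodules of M. *)
Definition is_socle M N : Prop :=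
  exists i : Hom N M,
    [/\ hom_inj i,
        forall U : {vspace M}, simple_submod U -> (U <= limg (vsval i))%VS
      & forall W : {vspace M},
          (forall U : {vspace M}, simple_submod U -> (U <= W)%VS) ->
          (limg (vsval i) <= W)%VS].

(* N is isomorphic to top M = M / rad M, where rad M is the intersection of the
   maximal submodules of M. *)
Definition is_top M N : Prop :=
  exists q : Hom M N,
    [/\ hom_surj q,
        forall U : {vspace M}, maximal_submod U -> (lker (vsval q) <= U)%VS
      & forall W : {vspace M},
          (forall U : {vspace M}, maximal_submod U -> (W <= U)%VS) ->
          (W <= lker (vsval q))%VS].

Fact reg_linearl c (a b x : A) : (c *: a + b) * x = c *: (a * x) + b * x.
Proof. by rewrite mulrDl scalerAl. Qed.
Fact reg_linearr (a : A) : linear ( *%R a : A -> A).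
Proof. by move=> c x y; rewrite mulrDr scalerAr. Qed.
Definition reg : module A :=
  Module reg_linearl reg_linearr (@mul1r A) (fun a b x => esym (mulrA a b x)).

Definition selfinjective : Prop := injective_module reg.

Definition weakly_symmetric : Prop :=
  selfinjective /\
  forall P : module A, projective P -> indecomposable (C := modcat) P ->
    exists2 N : module A, is_socle P N & is_top P N.

Definition indec_projectives t (P : 'I_t -> module A) : Prop :=
  [/\ forall i, projective (P i) /\ indecomposable (C := modcat) (P i),
      noniso_family (C := modcat) P
    & forall Q : module A, projective Q -> indecomposable (C := modcat) Q ->
        exists i, iso (C := modcat) Q (P i)].

Section Star.
Variable P : module A.

Fact rmul_lin (a : A) : linear (fun x : reg => (x : A) * a : reg).
Proof. by move=> c x y; rewrite mulrDl scalerAl. Qed.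
Fact rmul_act (a b : A) (x : reg) :
  (mact b x : A) * a = mact b ((x : A) * a : reg).
Proof. exact: esym (mulrA b x a). Qed.
Definition rmul (a : A) : Hom reg reg := mkHom (rmul_lin a) (rmul_act a).

Definition star_act (h : Hom P reg) (a : A) : Hom P reg := hcomp (rmul a) h.

Lemma star_actE h a x : vsval (star_act h a) x = (vsval h x : A) * a.
Proof. by rewrite mkHomE mkHomE. Qed.

Fact star_linearl a c g h :
  star_act (c *: g + h) a = c *: star_act g a + star_act h a.
Proof.
apply: Hom_ext => x.
rewrite star_actE !Hom_addE !Hom_scaleE !star_actE.
by rewrite [LHS]mulrDl scalerAl.
Qed.
Fact star_linearr h : linear (star_act h).
Proof.
move=> c a b; apply: Hom_ext => x.
rewrite star_actE !Hom_addE !Hom_scaleE !star_actE.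
by rewrite mulrDr scalerAr.
Qed.
Fact star_act1 h : star_act h 1 = h.
Proof. by apply: Hom_ext => x; rewrite star_actE mulr1. Qed.
Fact star_actM h a b : star_act h (a * b) = star_act (star_act h a) b.
Proof. by apply: Hom_ext => x; rewrite !star_actE mulrA. Qed.

(* The right module Hom_A(P, A), with (h a)(x) = h(x) a. *)
Definition star : rmodule A :=
  RModule star_linearl star_linearr star_act1 star_actM.
End Star.
End Modules.

Section AuslanderReiten.
Variables (k : fieldType) (A : falgType k).

(* The left module Hom_k(Q, k), with (a phi)(x) = phi(x a). *)
Section Dual.
Variable Q : rmodule A.

Definition ractr (a : A) (x : Q) : Q := ract x a.

HB.instance Definition _ (a : A) :=
  GRing.isLinear.Build k Q Q *:%R (ractr a) (@ract_linearl k A Q a).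

Definition dual_act (a : A) (phi : 'Hom(Q, k^o)) : 'Hom(Q, k^o) :=
  (phi \o linfun (ractr a))%VF.

Lemma dual_actE a phi x : dual_act a phi x = phi (ract x a).
Proof. by rewrite /dual_act comp_lfunE lfunE. Qed.

Fact dual_linearl c a b phi :
  dual_act (c *: a + b) phi = c *: dual_act a phi + dual_act b phi.
Proof.
apply/lfunP => x; rewrite add_lfunE scale_lfunE !dual_actE.
by rewrite ract_linearr linearP.
Qed.
Fact dual_linearr a : linear (dual_act a).
Proof.
move=> c f g; apply/lfunP => x; rewrite dual_actE add_lfunE scale_lfunE.
by rewrite [RHS]add_lfunE [X in _ = X + _]scale_lfunE !dual_actE.
Qed.
Fact dual_act1 phi : dual_act 1 phi = phi.
Proof. by apply/lfunP => x; rewrite dual_actE ract1. Qed.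
Fact dual_actM a b phi : dual_act (a * b) phi = dual_act a (dual_act b phi).
Proof. by apply/lfunP => x; rewrite !dual_actE ractM. Qed.

Definition dual : module A :=
  Module dual_linearl dual_linearr dual_act1 dual_actM.
End Dual.

Definition superfluous (M : module A) (K : {vspace M}) : Prop :=
  forall U : {vspace M}, submod U -> (U + K)%VS = fullv -> U = fullv.

(* P1 --f--> P0 --q--> M --> 0 *)
Definition minimal_presentation (P1 P0 M : module A)
    (f : Hom P1 P0) (q : Hom P0 M) : Prop :=
  [/\ projective P1 /\ projective P0,
      hom_surj q,
      limg (vsval f) = lker (vsval q),
      superfluous (lker (vsval q))
    & superfluous (lker (vsval f))].

(* Q is isomorphic to Tr M, the cokernel of f^* : P0^* -> P1^*. *)
Definition is_transpose (M : module A) (Q : rmodule A) : Prop :=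
  exists (P1 P0 : module A) (f : Hom P1 P0) (q : Hom P0 M)
         (c : 'Hom(star P1, Q)),
    [/\ minimal_presentation f q,
        forall (h : star P1) a, c (ract h a) = ract (c h) a,
        limg c = fullv
      & forall h : Hom P1 (reg A),
          c h = 0 <-> exists h0 : Hom P0 (reg A), h = hcomp h0 f].

(* N is isomorphic to tau M = D Tr M. *)
Definition is_tau (M N : module A) : Prop :=
  exists2 Q : rmodule A,
    is_transpose M Q & iso (C := modcat A) N (dual Q).

Definition support_tau_tilting (M : module A) : Prop :=
  (exists2 N, is_tau M N & hom_zero M N) /\
  exists P : module A,
    [/\ projective P, hom_zero P M
      & exists nP nM nA : nat,
          [/\ num_summands (C := modcat A) P nP,
              num_summands (C := modcat A) M nM,
              num_summands (C := modcat A) (reg A) nA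
            & (nP + nM)%N = nA]].

Definition tau_tilting_finite : Prop :=
  exists n (L : 'I_n -> module A),
    forall M : module A, basic (C := modcat A) M -> support_tau_tilting M ->
      exists i, iso (C := modcat A) M (L i).

End AuslanderReiten.

Section ProductModule.
Variables (k : fieldType) (A : falgType k) (M N : module A).

Definition prod_act (a : A) (x : M * N) : M * N := (mact a x.1, mact a x.2).

Fact prod_linearl c a b x :
  prod_act (c *: a + b) x = c *: prod_act a x + prod_act b x.
Proof. by rewrite /prod_act !mact_linearl. Qed.
Fact prod_linearr a : linear (prod_act a).
Proof. by move=> c x y; rewrite /prod_act !mact_linearr. Qed.
Fact prod_act1 x : prod_act 1 x = x.
Proof. by case: x => x y; rewrite /prod_act !mact1. Qed.
Fact prod_actM a b x : prod_act (a * b) x = prod_act a (prod_act b x).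
Proof. by rewrite /prod_act !mactM. Qed.

Definition prod_module : module A :=
  Module prod_linearl prod_linearr prod_act1 prod_actM.

Fact hfst_lin : linear (fst : prod_module -> M). Proof. by []. Qed.
Definition hfst : Hom prod_module M := mkHom hfst_lin (fun _ _ => erefl).
Fact hsnd_lin : linear (snd : prod_module -> N). Proof. by []. Qed.
Definition hsnd : Hom prod_module N := mkHom hsnd_lin (fun _ _ => erefl).

Section Pair.
Variables (L : module A) (f : Hom L M) (g : Hom L N).
Fact hpair_lin : linear (fun x => (vsval f x, vsval g x) : prod_module).
Proof. by move=> c x y; rewrite !linearP. Qed.
Fact hpair_act a x :
  (vsval f (mact a x), vsval g (mact a x)) =
    mact a ((vsval f x, vsval g x) : prod_module).
Proof. by rewrite !HomE. Qed.
Definition hpair : Hom L prod_module := mkHom hpair_lin hpair_act.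
End Pair.

Lemma projective_prod :
  projective M -> projective N -> projective prod_module.
Proof.
move=> Mp Np X Y e f e_surj.
have inl_lin : linear (fun x => (x, 0) : prod_module).
  by move=> c x y; congr pair; rewrite /= ?scaler0 ?addr0.
have inl_act a x : (mact a x, 0) = mact a ((x, 0) : prod_module).
  by congr pair; rewrite linear0.
have inr_lin : linear (fun y => (0, y) : prod_module).
  by move=> c x y; congr pair; rewrite /= ?scaler0 ?addr0.
have inr_act a y : (0, mact a y) = mact a ((0, y) : prod_module).
  by congr pair; rewrite linear0.
have [g1 g1E] := Mp _ _ e (hcomp f (mkHom inl_lin inl_act)) e_surj.
have [g2 g2E] := Np _ _ e (hcomp f (mkHom inr_lin inr_act)) e_surj.
exists (hcomp g1 hfst + hcomp g2 hsnd); apply: Hom_ext => -[x y].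
rewrite hcompE.
have := Hom_congr x g1E; rewrite !hcompE mkHomE => e1.
have := Hom_congr y g2E; rewrite !hcompE mkHomE => e2.
rewrite Hom_addE linearD !hcompE !mkHomE.
apply: etrans (congr2 +%R e1 e2) _; rewrite -linearD.
by congr (vsval f _); congr pair; rewrite /= ?addr0 ?add0r.
Qed.

End ProductModule.

(* Objects of K^b(proj A). *)
Record cplx (k : fieldType) (A : falgType k) := Cplx {
  term :> int -> module A;
  diff : forall i, Hom (term i) (term (i + 1));
  diffK : forall i, hcomp (diff (i + 1)) (diff i) = 0;
  term_proj : forall i, projective (term i);
  term_bounded : exists n : nat,
    forall i : int, (n < `|i|)%N -> \dim {: term i} = 0%N }.

Section Complexes.
Variables (k : fieldType) (A : falgType k).
Implicit Types X Y Z T : cplx A.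

Record chmap X Y := Chmap {
  chfun :> forall i, Hom (X i) (Y i);
  chmapP : forall i,
    hcomp (chfun (i + 1)) (diff X i) = hcomp (diff Y i) (chfun i) }.

(* Every integer has the form i + 1, so all degrees are covered. *)
Definition homotopic X Y (f g : chmap X Y) : Prop :=
  exists h : forall i, Hom (X (i + 1)) (Y i),
    forall i, f (i + 1) - g (i + 1) =
      hcomp (diff Y i) (h i) + hcomp (h (i + 1)) (diff X (i + 1)).

Fact chid_subproof X i :
  hcomp (hid (X (i + 1))) (diff X i) = hcomp (diff X i) (hid (X i)).
Proof. by apply: Hom_ext => x; rewrite !hcompE !mkHomE. Qed.
Definition chid X : chmap X X := Chmap (@chid_subproof X).

Fact chcomp_subproof X Y Z (g : chmap Y Z) (f : chmap X Y) i :
  hcomp (hcomp (g (i + 1)) (f (i + 1))) (diff X i) =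
  hcomp (diff Z i) (hcomp (g i) (f i)).
Proof.
apply: Hom_ext => x; rewrite !hcompE.
have := Hom_congr x (chmapP f i); rewrite !hcompE => ->.
by have := Hom_congr (vsval (f i) x) (chmapP g i); rewrite !hcompE.
Qed.
Definition chcomp X Y Z (g : chmap Y Z) (f : chmap X Y) : chmap X Z :=
  Chmap (chcomp_subproof g f).

Fact chzero_subproof X Y i :
  hcomp (0 : Hom (X (i + 1)) (Y (i + 1))) (diff X i) =
  hcomp (diff Y i) (0 : Hom (X i) (Y i)).
Proof. by apply: Hom_ext => x; rewrite !hcompE !Hom_zeroE linear0. Qed.
Definition chzero X Y : chmap X Y := Chmap (@chzero_subproof X Y).

Fact chadd_subproof X Y (f g : chmap X Y) i :
  hcomp (f (i + 1) + g (i + 1)) (diff X i) = hcomp (diff Y i) (f i + g i).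
Proof.
apply: Hom_ext => x; rewrite !hcompE !Hom_addE linearD.
have := Hom_congr x (chmapP f i); rewrite !hcompE => ->.
by have := Hom_congr x (chmapP g i); rewrite !hcompE => ->.
Qed.
Definition chadd X Y (f g : chmap X Y) : chmap X Y := Chmap (chadd_subproof f g).

Definition kbproj : catdata :=
  CatData homotopic chid chcomp chzero chadd.

Lemma diff0 X i x : vsval (diff X (i + 1)) (vsval (diff X i) x) = 0.
Proof. by rewrite -hcompE diffK Hom_zeroE. Qed.

Lemma bounded_succ X : exists n : nat,
  forall i : int, (n < `|i|)%N -> \dim {: X (i + 1)} = 0%N.
Proof.
have [n nP] := term_bounded X; exists n.+1 => i ni; apply: nP.
case: i ni => [i | [|i]] //= ni; last by rewrite subn1.
by rewrite ltn_addr // ltnW.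
Qed.

Section Shift.
Variable X : cplx A.
Fact shift_diffK i : hcomp (- diff X (i + 1 + 1)) (- diff X (i + 1)) = 0.
Proof.
apply: Hom_ext => x; rewrite hcompE !Hom_oppE linearN opprK Hom_zeroE.
exact: diff0.
Qed.
(* X[1] *)
Definition shift : cplx A :=
  @Cplx k A (fun i => X (i + 1)) (fun i => - diff X (i + 1)) shift_diffK
    (fun i => @term_proj k A X (i + 1)) (bounded_succ X).
End Shift.

Section Cone.
Variables (X Y : cplx A) (f : chmap X Y).

Definition cone_term (i : int) : module A := prod_module (X (i + 1)) (Y i).

(* (x, y) |-> (- d x, f x + d y) *)
Definition cone_diff (i : int) : Hom (cone_term i) (cone_term (i + 1)) :=
  hpair (- hcomp (diff X (i + 1)) (hfst (X (i + 1)) (Y i)))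
        (hcomp (f (i + 1)) (hfst (X (i + 1)) (Y i)) +
         hcomp (diff Y i) (hsnd (X (i + 1)) (Y i))).

Lemma cone_diffE i x y : vsval (cone_diff i) (x, y) =
  (- vsval (diff X (i + 1)) x, vsval (f (i + 1)) x + vsval (diff Y i) y).
Proof. by rewrite mkHomE Hom_oppE Hom_addE !hcompE !mkHomE. Qed.

Fact cone_diffK i : hcomp (cone_diff (i + 1)) (cone_diff i) = 0.
Proof.
apply: Hom_ext => -[x y]; rewrite hcompE !cone_diffE Hom_zeroE.
congr pair; first by rewrite linearN opprK; exact: diff0.
have := Hom_congr x (chmapP f (i + 1)); rewrite !hcompE => fd.
apply: etrans (congr2 +%R (linearN _ _) (linearD _ _ _)) _.
apply: etrans (congr2 +%R (congr1 -%R fd) (congr2 +%R erefl (diff0 y))) _.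
by rewrite addr0 addNr.
Qed.

Fact cone_proj i : projective (cone_term i).
Proof. exact: projective_prod (@term_proj k A X _) (@term_proj k A Y _). Qed.

Fact cone_bounded : exists n : nat,
  forall i : int, (n < `|i|)%N -> \dim {: cone_term i} = 0%N.
Proof.
have [n nP] := bounded_succ X; have [m mP] := term_bounded Y.
exists (maxn n m) => i; rewrite gtn_max => /andP[/nP Xi /mP Yi].
have -> : \dim {: cone_term i} = (\dim {: X (i + 1)%R} + \dim {: Y i})%N.
  by rewrite !dimvf.
by rewrite Xi Yi.
Qed.

Definition cone : cplx A :=
  Cplx cone_diffK cone_proj cone_bounded.
End Cone.

(* The smallest strictly full triangulated subcategory of K^b(proj A)
   containing S. *)
Inductive generated (S : cplx A -> Prop) : cplx A -> Prop :=
| gen_base X : S X -> generated S X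
| gen_iso X Y : iso (C := kbproj) X Y -> generated S X -> generated S Y
| gen_shift X : generated S X -> generated S (shift X)
| gen_unshift X : generated S (shift X) -> generated S X
| gen_cone X Y (f : chmap X Y) :
    generated S X -> generated S Y -> generated S (cone f).

Definition silting T : Prop :=
  (forall i : nat, (0 < i)%N ->
     forall f : chmap T (iter i shift T), homotopic f (chzero _ _)) /\
  forall X, generated (in_add (C := kbproj) T) X.

Definition two_term T : Prop :=
  forall i : int, i <> -1 -> i <> 0 -> \dim {: T i} = 0%N.

Section GrothendieckGroup.
Variables (t : nat) (P : 'I_t -> module A).

(* [Q] = \sum_j m_j [P_j] for the projective module Q. *)
Definition multiplicities (Q : module A) (m : 'I_t -> nat) : Prop :=
  is_dsum (C := modcat A)
    (fun x : {j : 'I_t & 'I_(m j)} => P (tag x)) Q.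

(* g is the coordinate vector of [X] = \sum_i (-1)^i [X^i] in the basis
   [P_1], ..., [P_t]; the degrees run over -n, ..., n. *)
Definition K0_class X (g : 'cV[int]_t) : Prop :=
  exists (n : nat) (m : int -> 'I_t -> nat),
    [/\ forall i : int, (n < `|i|)%N -> \dim {: X i} = 0%N,
        forall i : int, multiplicities (X i) (m i)
      & forall j, g j 0 =
          \sum_(l < n.*2.+1) let i := l%:Z - n%:Z in
            (-1) ^+ `|i|%N * (m i j)%:Z].

Variable R : realType.

Definition gcone T : set 'cV[R]_t :=
  [set v | exists r (T_ : 'I_r -> cplx A) (g : 'I_r -> 'cV[int]_t)
                  (a : 'I_r -> R),
    [/\ forall s, indecomposable (C := kbproj) (T_ s),
        is_dsum (C := kbproj) T_ T,
        forall s, K0_class (T_ s) (g s),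
        forall s, 0 <= a s
      & v = \sum_s a s *: map_mx intr (g s)]]%classic.

Definition g_tame : Prop :=
  dense [set v : 'cV[R]_t | exists T : cplx A,
    [/\ two_term T, silting T, basic (C := kbproj) T & gcone T v]]%classic.

Definition cartan : 'M[R]_t := \matrix_(i, j) (\dim {: Hom (P i) (P j)})%:R.

End GrothendieckGroup.
End Complexes.

Definition positive_definite (R : realType) t (C : 'M[R]_t) : Prop :=
  forall v : 'cV[R]_t, v != 0 -> 0 < (v^T *m C *m v) 0 0.

Definition positive_semidefinite (R : realType) t (C : 'M[R]_t) : Prop :=
  forall v : 'cV[R]_t, 0 <= (v^T *m C *m v) 0 0.

(* Main.v *)
From HB Require Import structures.
From mathcomp Require Import all_boot all_order all_algebra all_field.
From mathcomp Require Import all_classical all_reals all_analysis.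
From mathcomp Require Import zify ring lra.
Require Import Defs.

Set Implicit Arguments.
Unset Strict Implicit.
Unset Printing Implicit Defensive.

Import Order.TTheory GRing.Theory Num.Theory.
Local Open Scope ring_scope.

(** A two-term complex of projective modules is an arrow f : P1 -> P0 between
    projective modules. Say that f is orthogonal to g : Q1 -> Q0 if each map
    P1 -> Q0 has the form a f + g b; this is Hom(f, g[1]) = 0 in the homotopy
    category. The class of f is [P0] - [P1]. A rigid family consists of
    indecomposable, noncontractible, pairwise nonisomorphic arrows that are
    orthogonal to themselves and to each other.

    On classes, the Cartan matrix is the Euler form: the value at f and g is
    the alternating sum of the dimensions of Hom(f, g[i]) for i = -1, 0, 1. If
    f and g are orthogonal in both directions, the term with i = 1 vanishes.
    The term with i = -1 vanishes by weak symmetry. The equality of tops and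
    socles gives nondegenerate trace forms on the endomorphism rings of
    projective modules ([forms_exist]). They turn g into its Nakayama twist g',
    which has the same terms and is again rigid. Two rigid maps in the same Hom
    space lie in the same orbit under automorphisms of their terms, because both
    orbits are dense ([open_orbit]); so g' and g are isomorphic, and
    Hom(f, g[-1]) is dual to Hom(g, f[1]) = 0 ([rigid_neg_zero]). What remains
    is the dimension of Hom(f, g), which is nonnegative, and positive if f = g
    is not contractible. So the form is nonnegative at every nonnegative
    combination of classes of mutually orthogonal arrows ([cartan_form_cone],
    [cartan_form_ge0]).

    For (a) it remains to cover the space by the cones of rigid families
    ([cones_cover]). The classes in a rigid family are linearly independent,
    again by [open_orbit] ([rigid_independent]). For a vector v, the point
    v + l (1, ..., 1) lies in the cone of the arrows 0 -> P_i when l is large.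
    Let l decrease to 0. Whenever the point is about to leave the cone of a
    family T, keep the members with positive coordinates and complete them by
    summands of co-Bongartz arrows ([completion]); the point can then move on
    in the new cone ([walk_step]). The class of modules generated by the
    cokernels of the family shrinks strictly at each step. These cokernels add
    up to a support tau-tilting module ([rigid_support_tau_tilting]), and there
    are finitely many of these, so the walk ends at v. Positivity on the
    diagonal makes the form positive at v.

    For (b), a two-term silting complex T is an arrow orthogonal to itself. Its
    summands in the homotopy category are arbitrary bounded complexes, but each
    has the class of an arrow that is a retract of T: an endomorphism that is
    idempotent up to homotopy is homotopic to an idempotent endomorphism of the
    arrow ([summand_arrow]), and Euler characteristics of Hom complexes into
    the tops of the projectives compare the classes ([summand_euler]). So the
    form is nonnegative on all g-cones ([gcone_form_ge0]). By density and
    continuity it is nonnegative everywhere. *)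

(** * Linear categories and Fitting's lemma *)

(** One structure serves for modules, for projective modules and for arrows
    between projectives, so that Fitting's lemma and the Krull-Schmidt theorem
    are proved once for all three. *)
Record lincat (k : fieldType) := Lincat {
  lob :> Type;
  lhom : lob -> lob -> vectType k;
  lid : forall X, lhom X X;
  lcomp : forall X Y Z, lhom Y Z -> lhom X Y -> lhom X Z;
  lcompA : forall X Y Z W (h : lhom Z W) (g : lhom Y Z) (f : lhom X Y),
    lcomp h (lcomp g f) = lcomp (lcomp h g) f;
  lcomp1l : forall X Y (f : lhom X Y), lcomp (lid Y) f = f;
  lcomp1r : forall X Y (f : lhom X Y), lcomp f (lid X) = f;
  lcomp_linl : forall X Y Z (f : lhom X Y), linear (fun g : lhom Y Z => lcomp g f);
  lcomp_linr : forall X Y Z (g : lhom Y Z), linear (@lcomp X Y Z g);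
  lsplit : forall X (e : lhom X X), lcomp e e = e ->
    exists Y (i : lhom Y X) (p : lhom X Y), lcomp p i = lid Y /\ lcomp i p = e;
  lzero : exists Z, lid Z = 0;
  lbiprod : forall X Y, exists Z (i1 : lhom X Z) (i2 : lhom Y Z)
      (p1 : lhom Z X) (p2 : lhom Z Y),
    [/\ lcomp p1 i1 = lid X, lcomp p2 i2 = lid Y
      & lcomp i1 p1 + lcomp i2 p2 = lid Z] }.

Arguments lhom {k l}.
Arguments lid {k l}.
Arguments lcomp {k l X Y Z}.

Notation "g ** f" := (lcomp g f) (at level 40, left associativity).

(** For the category of modules this is convertible to [modcat], and direct
    sums and indecomposability need no translation. *)
Definition cat_of (k : fieldType) (L : lincat k) : catdata :=
  CatData (fun X Y : L => @eq (lhom X Y)) (@lid k L) (@lcomp k L)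
    (fun X Y => 0) (fun X Y => +%R).

Section LinearCategory.
Variables (k : fieldType) (L : lincat k).
Implicit Types X Y Z W : L.

HB.instance Definition _ X Y Z (g : lhom Y Z) :=
  GRing.isLinear.Build k (lhom X Y) (lhom X Z) *:%R (@lcomp k L X Y Z g)
    (@lcomp_linr k L X Y Z g).

Definition rcomp X Y Z (f : lhom X Y) (g : lhom Y Z) : lhom X Z := g ** f.

HB.instance Definition _ X Y Z (f : lhom X Y) :=
  GRing.isLinear.Build k (lhom Y Z) (lhom X Z) *:%R (@rcomp X Y Z f)
    (@lcomp_linl k L X Y Z f).

Lemma lcompDl X Y Z (g h : lhom Y Z) (f : lhom X Y) :
  (g + h) ** f = g ** f + h ** f.
Proof. exact: (linearD (rcomp f)). Qed.

Lemma lcompDr X Y Z (g : lhom Y Z) (f h : lhom X Y) :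
  g ** (f + h) = g ** f + g ** h.
Proof. exact: linearD. Qed.

Lemma lcompNl X Y Z (g : lhom Y Z) (f : lhom X Y) : (- g) ** f = - (g ** f).
Proof. exact: (linearN (rcomp f)). Qed.

Lemma lcompNr X Y Z (g : lhom Y Z) (f : lhom X Y) : g ** (- f) = - (g ** f).
Proof. exact: linearN. Qed.

Lemma lcompBl X Y Z (g h : lhom Y Z) (f : lhom X Y) :
  (g - h) ** f = g ** f - h ** f.
Proof. exact: (linearB (rcomp f)). Qed.

Lemma lcompBr X Y Z (g : lhom Y Z) (f h : lhom X Y) :
  g ** (f - h) = g ** f - g ** h.
Proof. exact: linearB. Qed.

Lemma lcomp0l X Y Z (f : lhom X Y) : (0 : lhom Y Z) ** f = 0.
Proof. exact: (linear0 (rcomp f)). Qed.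

Lemma lcomp0r X Y Z (g : lhom Y Z) : g ** (0 : lhom X Y) = 0.
Proof. exact: linear0. Qed.

Lemma lcompZl X Y Z c (g : lhom Y Z) (f : lhom X Y) :
  (c *: g) ** f = c *: (g ** f).
Proof. exact: (linearZ_LR (rcomp f)). Qed.

Lemma lcompZr X Y Z c (g : lhom Y Z) (f : lhom X Y) :
  g ** (c *: f) = c *: (g ** f).
Proof. exact: linearZ_LR. Qed.

Lemma lcomp_suml X Y Z (I : finType) (g : I -> lhom Y Z) (f : lhom X Y) :
  (\sum_i g i) ** f = \sum_i g i ** f.
Proof. exact: (linear_sum (rcomp f)). Qed.

Lemma lcomp_sumr X Y Z (I : finType) (g : lhom Y Z) (f : I -> lhom X Y) :
  g ** (\sum_i f i) = \sum_i g ** f i.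
Proof. exact: linear_sum. Qed.

Definition invertible X Y (f : lhom X Y) : Prop :=
  exists g : lhom Y X, g ** f = lid X /\ f ** g = lid Y.

Definition isom X Y : Prop := exists f : lhom X Y, invertible f.

Definition retract Z X : Prop :=
  exists (i : lhom Z X) (p : lhom X Z), p ** i = lid Z.

Definition dsum (I : finType) (Y : I -> L) X : Prop :=
  exists (inj : forall i, lhom (Y i) X) (prj : forall i, lhom X (Y i)),
    [/\ forall i, prj i ** inj i = lid (Y i),
        forall i j, i != j -> prj j ** inj i = 0
      & \sum_i inj i ** prj i = lid X].

Definition indec X : Prop := indecomposable (C := cat_of L) X.

Lemma dsumE (I : finType) (Y : I -> L) X :
  dsum Y X = is_dsum (C := cat_of L) Y X.
Proof. by []. Qed.

Lemma invertible_id X : invertible (lid X).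
Proof. by exists (lid X); rewrite lcomp1l. Qed.

Lemma invertible_comp X Y Z (g : lhom Y Z) (f : lhom X Y) :
  invertible g -> invertible f -> invertible (g ** f).
Proof.
move=> [g' [g'g gg']] [f' [f'f ff']]; exists (f' ** g'); split.
  by rewrite -lcompA [g' ** _]lcompA g'g lcomp1l.
by rewrite -lcompA [f ** _]lcompA ff' lcomp1l.
Qed.

Lemma isom_refl X : isom X X.
Proof. by exists (lid X); exact: invertible_id. Qed.

Lemma isom_sym X Y : isom X Y -> isom Y X.
Proof. by move=> [f [g [gf fg]]]; exists g, f. Qed.

Lemma isom_retract X Y : isom X Y -> retract X Y.
Proof. by move=> [f [g [gf _]]]; exists f, g. Qed.

Lemma retract_trans X Y Z : retract X Y -> retract Y Z -> retract X Z.
Proof.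
move=> [i [p pi]] [j [q qj]]; exists (j ** i), (p ** q).
by rewrite -lcompA [q ** _]lcompA qj lcomp1l.
Qed.

Lemma dsum_inj_retract (I : finType) (Y : I -> L) X i :
  dsum Y X -> retract (Y i) X.
Proof. by move=> [inj [prj [h _ _]]]; exists (inj i), (prj i). Qed.

Lemma eq_hom0 X Y (f : lhom X Y) : lid X = 0 -> f = 0.
Proof. by move=> X0; rewrite -[f]lcomp1r X0 lcomp0r. Qed.

Lemma dsum2_orth Y Z X (i1 : lhom Y X) (i2 : lhom Z X) (p1 : lhom X Y)
    (p2 : lhom X Z) :
  p1 ** i1 = lid Y -> p2 ** i2 = lid Z -> i1 ** p1 + i2 ** p2 = lid X ->
  p1 ** i2 = 0 /\ p2 ** i1 = 0.
Proof.
move=> pi1 pi2 ip; split.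
  have : p1 ** (i1 ** p1 + i2 ** p2) ** i2 = p1 ** i2 by rewrite ip lcomp1r.
  rewrite lcompDr lcompDl !lcompA pi1 lcomp1l -[X in _ + X]lcompA pi2 lcomp1r.
  by move/eqP; rewrite -subr_eq0 addrK => /eqP.
have : p2 ** (i1 ** p1 + i2 ** p2) ** i1 = p2 ** i1 by rewrite ip lcomp1r.
rewrite lcompDr lcompDl !lcompA pi2 lcomp1l -[X in X + _]lcompA pi1 lcomp1r.
by move/eqP; rewrite -subr_eq0 addrK => /eqP.
Qed.

Lemma dsum2 Y Z X (i1 : lhom Y X) (i2 : lhom Z X) (p1 : lhom X Y)
    (p2 : lhom X Z) :
  p1 ** i1 = lid Y -> p2 ** i2 = lid Z -> i1 ** p1 + i2 ** p2 = lid X ->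
  is_dsum2 (C := cat_of L) Y Z X.
Proof.
move=> pi1 pi2 ip; have [pi12 pi21] := dsum2_orth pi1 pi2 ip.
suff h : dsum (fun b : bool => if b then Y else Z) X by exact: h.
exists (fun b => match b return lhom (if b then Y else Z) X with
                 | true => i1 | false => i2 end).
exists (fun b => match b return lhom X (if b then Y else Z) with
                 | true => p1 | false => p2 end).
split; [by case | by case; case |].
by rewrite big_bool.
Qed.

Lemma dsum2E Y Z X : is_dsum2 (C := cat_of L) Y Z X ->
  exists (i1 : lhom Y X) (i2 : lhom Z X) (p1 : lhom X Y) (p2 : lhom X Z),
  [/\ p1 ** i1 = lid Y, p2 ** i2 = lid Z & i1 ** p1 + i2 ** p2 = lid X].
Proof.
rewrite /is_dsum2 -dsumE => -[inj [prj [h1 _ h3]]].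
exists (inj true), (inj false), (prj true), (prj false); split.
- exact: (h1 true).
- exact: (h1 false).
- by move: h3; rewrite big_bool.
Qed.

Lemma idempotent_dsum2 X (e : lhom X X) : e ** e = e ->
  exists Y Z (i1 : lhom Y X) (i2 : lhom Z X) (p1 : lhom X Y) (p2 : lhom X Z),
  [/\ p1 ** i1 = lid Y, p2 ** i2 = lid Z, i1 ** p1 = e & i2 ** p2 = lid X - e].
Proof.
move=> ee; have [Y [i1 [p1 [pi1 ip1]]]] := lsplit ee.
have ee' : (lid X - e) ** (lid X - e) = lid X - e.
  by rewrite lcompBl lcomp1l lcompBr lcomp1r ee subrr subr0.
by have [Z [i2 [p2 [pi2 ip2]]]] := lsplit ee'; exists Y, Z, i1, i2, p1, p2.
Qed.

Lemma retract_summand Z X :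
  retract Z X -> exists W, is_dsum2 (C := cat_of L) Z W X.
Proof.
move=> [i [p pi]].
have ee : (i ** p) ** (i ** p) = i ** p.
  by rewrite -lcompA [p ** _]lcompA pi lcomp1l.
have [_ [W [_ [i2 [_ [p2 [_ pi2 _ ip2]]]]]]] := idempotent_dsum2 ee.
by exists W; apply: (dsum2 pi pi2); rewrite ip2 addrC subrK.
Qed.

Lemma summandP Z X : summand (C := cat_of L) Z X <-> retract Z X.
Proof.
split; last by move=> /retract_summand.
by move=> [W /dsum2E [i [_ [p [_ [pi _ _]]]]]]; exists i, p.
Qed.

Definition lpow X (x : lhom X X) n : lhom X X := iter n (lcomp x) (lid X).

Lemma lpowD X (x : lhom X X) m n : lpow x (m + n) = lpow x m ** lpow x n.
Proof.
elim: m => [|m IH]; first by rewrite lcomp1l.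
by rewrite addSn /lpow !iterS -!/(lpow x _) IH lcompA.
Qed.

Lemma lpow1 X (x : lhom X X) : lpow x 1 = x.
Proof. by rewrite /lpow /= lcomp1r. Qed.

Lemma lpowS X (x : lhom X X) n : lpow x n.+1 = x ** lpow x n.
Proof. by []. Qed.

Lemma lpowSr X (x : lhom X X) n : lpow x n.+1 = lpow x n ** x.
Proof. by rewrite -[n.+1]addn1 lpowD lpow1. Qed.

Lemma stable_power (n : nat) (d : nat -> nat) :
  (forall m, d m.+1 <= d m)%N -> (d 0 <= n)%N ->
  exists2 m, (0 < m)%N & d (m + m)%N = d m.
Proof.
move=> dS d0.
have dle a b : (d (a + b) <= d a)%N.
  elim: b => [|b IH]; first by rewrite addn0.
  by rewrite addnS (leq_trans (dS _)).
have aux : forall N b, (d b <= N)%N -> exists2 m, (0 < m)%N & d (m + m)%N = d m.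
  elim=> [|N IHN] b db.
    exists b.+1 => //; have := dle b 1%N; have := dle b (b + 2)%N.
    have -> : (b + (b + 2) = b.+1 + b.+1)%N by lia.
    by rewrite addn1; lia.
  case: (eqVneq (d (b.+1 + b.+1)%N) (d b.+1)) => [e|ne]; first by exists b.+1.
  apply: (IHN (b.+1 + b.+1)%N).
  by have := dle b.+1 b.+1; have := dS b; move: ne db; lia.
exact: (aux n 0%N).
Qed.

(** The images of the left and right multiplications by the powers of x
    decrease in a space of finite dimension. Where both are stationary, x^n =
    x^n x^n y = z x^n x^n, and then x^n y is idempotent. *)
Lemma fitting_idempotent X (x : lhom X X) :
  exists n (y z : lhom X X), [/\ (0 < n)%N,
    lpow x n ** lpow x n ** y = lpow x n & z ** lpow x n ** lpow x n = lpow x n].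
Proof.
pose lm n : 'End(lhom X X) := linfun (lcomp (lpow x n)).
pose rm n : 'End(lhom X X) := linfun (rcomp (lpow x n)).
have lmS n : (limg (lm n.+1) <= limg (lm n))%VS.
  apply/subvP => _ /memv_imgP [w _ ->]; apply/memv_imgP.
  by exists (x ** w); rewrite ?memvf // !lfunE -[n.+1]addn1 lpowD lpow1 /= lcompA.
have rmS n : (limg (rm n.+1) <= limg (rm n))%VS.
  apply/subvP => _ /memv_imgP [w _ ->]; apply/memv_imgP.
  exists (w ** x); rewrite ?memvf // !lfunE -[n.+1]add1n lpowD lpow1.
  by rewrite /= /rcomp lcompA.
have lmD n m : (limg (lm (n + m)%N) <= limg (lm n))%VS.
  by elim: m => [|m IH]; rewrite ?addn0 // addnS (subv_trans (lmS _)).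
have rmD n m : (limg (rm (n + m)%N) <= limg (rm n))%VS.
  by elim: m => [|m IH]; rewrite ?addn0 // addnS (subv_trans (rmS _)).
have [n n0 hn] : exists2 n, (0 < n)%N & \dim (limg (lm (n + n)%N)) +
    \dim (limg (rm (n + n)%N)) = (\dim (limg (lm n)) + \dim (limg (rm n)))%N.
  apply: (stable_power (d := fun n => \dim (limg (lm n)) + \dim (limg (rm n)))%N)
    => [m|]; last exact: leqnn.
  by apply: leq_add; apply: dimvS.
have := dimvS (lmD n n); have := dimvS (rmD n n) => hr hl.
have el : limg (lm (n + n)%N) = limg (lm n).
  by apply/eqP; rewrite eqEdim lmD; lia.
have er : limg (rm (n + n)%N) = limg (rm n).
  by apply/eqP; rewrite eqEdim rmD; lia.
have : lpow x n \in limg (lm (n + n)%N).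
  rewrite el; apply/memv_imgP; exists (lid X); first exact: memvf.
  by rewrite lfunE /= lcomp1r.
move=> /memv_imgP [y _ hy].
have : lpow x n \in limg (rm (n + n)%N).
  rewrite er; apply/memv_imgP; exists (lid X); first exact: memvf.
  by rewrite lfunE /= /rcomp lcomp1l.
move=> /memv_imgP [z _ hz].
exists n, y, z; split => //.
  by rewrite -lpowD [RHS]hy lfunE.
by rewrite -lcompA -lpowD [RHS]hz lfunE.
Qed.

Lemma indec_idempotent X (e : lhom X X) :
  indec X -> e ** e = e -> e = 0 \/ e = lid X.
Proof.
move=> [_ Xi] /idempotent_dsum2 [Y [Z [i1 [i2 [p1 [p2 [pi1 pi2 ip1 ip2]]]]]]].
have := Xi Y Z; case.
- by apply: (dsum2 pi1 pi2); rewrite ip1 ip2 addrC subrK.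
- rewrite /is_zero /= => Y0; left; rewrite -ip1.
  by rewrite (eq_hom0 i1 Y0) lcomp0l.
- rewrite /is_zero /= => Z0; right; apply/eqP; rewrite eq_sym -subr_eq0 -ip2.
  by rewrite (eq_hom0 i2 Z0) lcomp0l.
Qed.

Lemma lpow_invertible X (x : lhom X X) n :
  (0 < n)%N -> invertible (lpow x n) -> invertible x.
Proof.
case: n => // n _ [y [yx xy]].
have e1 : (y ** lpow x n) ** x = lid X.
  by rewrite -lcompA -lpowSr.
have e2 : x ** (lpow x n ** y) = lid X by rewrite lcompA.
exists (y ** lpow x n); split=> //.
have -> : y ** lpow x n = lpow x n ** y.
  by rewrite -[LHS]lcomp1r -e2 lcompA e1 lcomp1l.
exact: e2.
Qed.

(** The idempotent x^n y of [fitting_idempotent] is 0 or 1: x is nilpotent in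
    the first case and invertible in the second. *)
Lemma indec_local X (x : lhom X X) :
  indec X -> invertible x \/ exists n, lpow x n = 0.
Proof.
move=> Xi; have [n [y [z [n0 ay za]]]] := fitting_idempotent x.
set a := lpow x n in ay za.
have azay : z ** a = a ** y.
  by rewrite -{1}ay !lcompA za.
have ee : (a ** y) ** (a ** y) = a ** y.
  by rewrite -{1}azay -lcompA [a ** (a ** y)]lcompA ay azay.
case: (indec_idempotent Xi ee) => e.
  by right; exists n; rewrite -/a -ay -lcompA e lcomp0r.
left; apply: (lpow_invertible n0); rewrite -/a.
have zy : z = y by rewrite -[z]lcomp1r -e lcompA azay e lcomp1l.
by exists y; rewrite -{1}zy azay.
Qed.

Lemma geometric X (x : lhom X X) n : lpow x n = 0 -> invertible (lid X - x).
Proof.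
move=> x0; pose s := \sum_(i < n) lpow x i.
have xs : x ** s = s ** x.
  rewrite lcomp_sumr lcomp_suml; apply: eq_bigr => i _.
  by rewrite -lpowSr.
have h : s - x ** s = lid X.
  rewrite lcomp_sumr -sumrB /=.
  have -> : \sum_(i < n) (lpow x i - x ** lpow x i) = lpow x 0 - lpow x n.
    elim: n {x0 s xs} => [|n IH]; first by rewrite big_ord0 subrr.
    rewrite big_ord_recr /= IH; set u := lpow x n; set v := x ** _.
    by rewrite addrA subrK.
  by rewrite x0 subr0.
exists s; rewrite lcompBl lcompBr lcomp1l lcomp1r; split=> //.
by rewrite -xs.
Qed.

(** If z is the inverse of x + y and z x is nilpotent, then y = (x + y) (1 - z
    x) is invertible. *)
Lemma local_sum2 X (x y : lhom X X) :
  indec X -> invertible (x + y) -> invertible x \/ invertible y.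
Proof.
move=> Xi [z [zxy xyz]].
have [|[n zx0]] := indec_local (z ** x) Xi.
  move=> inv; left.
  have -> : x = (x + y) ** (z ** x) by rewrite lcompA xyz lcomp1l.
  by apply: invertible_comp => //; exists z.
right; have -> : y = (x + y) ** (lid X - z ** x).
  rewrite lcompBr lcompA xyz lcomp1l lcomp1r.
  by rewrite addrC addKr.
apply: invertible_comp; first by exists z.
exact: geometric zx0.
Qed.

Lemma indec_neq0 X : indec X -> lid X != 0.
Proof. by move=> [X0 _]; apply/eqP. Qed.

Lemma local_sum X (I : finType) (u : I -> lhom X X) :
  indec X -> invertible (\sum_i u i) -> exists i, invertible (u i).
Proof.
move=> Xi; rewrite -big_enum /=.
elim: (enum I) => [|i s IH].
  rewrite big_nil => -[z [_]]; rewrite lcomp0l => e.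
  by move: (indec_neq0 Xi); rewrite -e eqxx.
rewrite big_cons => /(local_sum2 Xi) [h|]; last exact: IH.
by exists i.
Qed.

(** The identity of Z is a sum of endomorphisms that factor through the Y i,
    and one of them is invertible because the endomorphism ring is local. *)
Lemma retract_exchange (I : finType) (Y : I -> L) X Z :
  indec Z -> retract Z X -> dsum Y X -> exists i, retract Z (Y i).
Proof.
move=> Zi [i [p pi]] [inj [prj [_ _ h]]].
have : invertible (\sum_j (p ** inj j) ** (prj j ** i)).
  have -> : \sum_j (p ** inj j) ** (prj j ** i) = lid Z.
    transitivity (p ** (\sum_j inj j ** prj j) ** i).
      rewrite lcomp_sumr lcomp_suml; apply: eq_bigr => j _.
      by rewrite !lcompA.
    by rewrite h lcomp1r.
  exact: invertible_id.
move/(local_sum Zi) => [j [z [zj _]]]; exists j, (prj j ** i), (z ** (p ** inj j)).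
by rewrite -zj !lcompA.
Qed.

Lemma retract_indec Z Y : lid Z <> 0 -> indec Y -> retract Z Y -> isom Z Y.
Proof.
move=> Z0 Yi [i [p pi]]; exists i, p; split=> //.
have ee : (i ** p) ** (i ** p) = i ** p.
  by rewrite -lcompA [p ** _]lcompA pi lcomp1l.
case: (indec_idempotent Yi ee) => // ip0; case: Z0.
have <- : p ** (i ** p) ** i = lid Z by rewrite lcompA pi lcomp1l.
by rewrite ip0 lcomp0r lcomp0l.
Qed.

Lemma indec_dsum_isom (I : finType) (Y : I -> L) X Z :
  indec Z -> retract Z X -> dsum Y X -> (forall i, indec (Y i)) ->
  exists i, isom Z (Y i).
Proof.
move=> Zi ZX YX Yi; have [i ZY] := retract_exchange Zi ZX YX.
by exists i; apply: retract_indec => //; case: Zi.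
Qed.

End LinearCategory.

(** * Direct sums and the Krull-Schmidt theorem *)
Section DirectSums.
Variables (k : fieldType) (L : lincat k).
Implicit Types X Y Z W : L.

Lemma sum_prj_inj (I : finType) (Y : I -> L) X (inj : forall i, lhom (Y i) X)
    (prj : forall i, lhom X (Y i)) Z (g : forall i, lhom (Y i) Z) i :
  (forall i, prj i ** inj i = lid (Y i)) ->
  (forall i j, i != j -> prj j ** inj i = 0) ->
  (\sum_j g j ** prj j) ** inj i = g i.
Proof.
move=> h1 h2; rewrite lcomp_suml (bigD1 i) //= big1 ?addr0 => [|j ji].
  by rewrite -lcompA h1 lcomp1r.
by rewrite -lcompA h2 1?eq_sym // lcomp0r.
Qed.

Lemma prj_sum_inj (I : finType) (Y : I -> L) X (inj : forall i, lhom (Y i) X)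
    (prj : forall i, lhom X (Y i)) Z (g : forall i, lhom Z (Y i)) i :
  (forall i, prj i ** inj i = lid (Y i)) ->
  (forall i j, i != j -> prj j ** inj i = 0) ->
  prj i ** (\sum_j inj j ** g j) = g i.
Proof.
move=> h1 h2; rewrite lcomp_sumr (bigD1 i) //= big1 ?addr0 => [|j ji].
  by rewrite lcompA h1 lcomp1l.
by rewrite lcompA h2 // lcomp0l.
Qed.

Lemma dsum_reindex (I J : finType) (h : J -> I) (Y : I -> L) (Z : J -> L) X :
  bijective h -> (forall j, Z j = Y (h j)) -> dsum Y X -> dsum Z X.
Proof.
move=> bh ZY; have -> : Z = (fun j => Y (h j)) by apply: funext.
move=> [inj [prj [h1 h2 h3]]].
exists (fun j => inj (h j)), (fun j => prj (h j)); split=> //.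
  by move=> i j ij; apply: h2; rewrite (bij_eq bh).
by rewrite -h3 [RHS](reindex h) //; exact: onW_bij.
Qed.

Lemma dsum_isom (I : finType) (Y Z : I -> L) X :
  (forall i, isom (Y i) (Z i)) -> dsum Y X -> dsum Z X.
Proof.
move=> YZ [inj [prj [h1 h2 h3]]].
pose f i := sval (cid (YZ i)); pose g i := sval (cid (svalP (cid (YZ i)))).
have gf i : g i ** f i = lid _ by case: (svalP (cid (svalP (cid (YZ i))))).
have fg i : f i ** g i = lid _ by case: (svalP (cid (svalP (cid (YZ i))))).
exists (fun i => inj i ** g i), (fun i => f i ** prj i); split.
- by move=> i; rewrite -lcompA [prj i ** _]lcompA h1 lcomp1l.
- by move=> i j ij; rewrite -lcompA [prj j ** _]lcompA h2 // lcomp0l lcomp0r.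
- rewrite -h3; apply: eq_bigr => i _.
  by rewrite -lcompA [g i ** _]lcompA gf lcomp1l.
Qed.

Lemma dsum_unique (I : finType) (Y : I -> L) X X' :
  dsum Y X -> dsum Y X' -> isom X X'.
Proof.
move=> [inj [prj [h1 h2 h3]]] [inj' [prj' [h1' h2' h3']]].
exists (\sum_i inj' i ** prj i), (\sum_i inj i ** prj' i); split.
  rewrite lcomp_sumr -h3; apply: eq_bigr => i _.
  rewrite lcomp_suml (bigD1 i) //= big1 ?addr0 => [|j ji].
    by rewrite -lcompA [prj' i ** _]lcompA h1' lcomp1l.
  by rewrite -lcompA [prj' j ** _]lcompA h2' 1?eq_sym // lcomp0l lcomp0r.
rewrite lcomp_sumr -h3'; apply: eq_bigr => i _.
rewrite lcomp_suml (bigD1 i) //= big1 ?addr0 => [|j ji].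
  by rewrite -lcompA [prj i ** _]lcompA h1 lcomp1l.
by rewrite -lcompA [prj j ** _]lcompA h2 1?eq_sym // lcomp0l lcomp0r.
Qed.

Lemma dsum_transfer (I : finType) (Y : I -> L) X X' :
  isom X X' -> dsum Y X -> dsum Y X'.
Proof.
move=> [f [g [gf fg]]] [inj [prj [h1 h2 h3]]].
exists (fun i => f ** inj i), (fun i => prj i ** g); split.
- by move=> i; rewrite -lcompA [g ** _]lcompA gf lcomp1l.
- by move=> i j ij; rewrite -lcompA [g ** _]lcompA gf lcomp1l h2.
- have -> : lid X' = f ** (\sum_i inj i ** prj i) ** g by rewrite h3 lcomp1r.
  rewrite lcomp_sumr lcomp_suml; apply: eq_bigr => i _.
  by rewrite !lcompA.
Qed.

Lemma dsum_flatten (I : finType) (J : I -> finType) (Y : forall i, J i -> L)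
    (Z : I -> L) X :
  (forall i, dsum (Y i) (Z i)) -> dsum Z X ->
  dsum (fun s : {i & J i} => Y (tag s) (tagged s)) X.
Proof.
move=> YZ [inj [prj [h1 h2 h3]]].
pose ii i := sval (cid (YZ i)); pose pp i := sval (cid (svalP (cid (YZ i)))).
have hh i : [/\ forall j, pp i j ** ii i j = lid (Y i j),
    forall j l, j != l -> pp i l ** ii i j = 0
    & \sum_j ii i j ** pp i j = lid (Z i)].
  exact: (svalP (cid (svalP (cid (YZ i))))).
exists (fun s => inj (tag s) ** ii (tag s) (tagged s)).
exists (fun s => pp (tag s) (tagged s) ** prj (tag s)); split.
- move=> [i j] /=; rewrite -lcompA [prj i ** _]lcompA h1 lcomp1l.
  by case: (hh i).
- move=> [i j] [i' j'] /= ne; rewrite -lcompA [prj i' ** _]lcompA.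
  case: (eqVneq i i') ne => [e|ne _]; last by rewrite h2 // lcomp0l lcomp0r.
  case: i' / e j' => j' ne; rewrite h1 lcomp1l; case: (hh i) => _ -> //.
  by apply: contraNneq ne => ->.
- transitivity (\sum_i \sum_j inj i ** ii i j ** (pp i j ** prj i)).
    by rewrite sig_big_dep.
  rewrite -h3; apply: eq_bigr => i _; rewrite -[inj i in RHS]lcomp1r.
  case: (hh i) => _ _ <-; rewrite lcomp_sumr lcomp_suml; apply: eq_bigr => j _.
  by rewrite !lcompA.
Qed.

Definition sum_family (I J : finType) (Y : I -> L) (Z : J -> L) (s : I + J) : L :=
  match s with inl i => Y i | inr j => Z j end.

Lemma dsum_sum (I J : finType) (Y : I -> L) (Z : J -> L) A B X :
  is_dsum2 (C := cat_of L) A B X -> dsum Y A -> dsum Z B ->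
  dsum (sum_family Y Z) X.
Proof.
move=> /dsum2E [i1 [i2 [p1 [p2 [h1 h2 h3]]]]].
have [h12 h21] := dsum2_orth h1 h2 h3.
move=> [inj [prj [g1 g2 g3]]] [inj' [prj' [g1' g2' g3']]].
exists (fun s => match s return lhom (sum_family Y Z s) X with
  | inl i => i1 ** inj i | inr j => i2 ** inj' j end).
exists (fun s => match s return lhom X (sum_family Y Z s) with
  | inl i => prj i ** p1 | inr j => prj' j ** p2 end).
have simp U V (u : lhom _ U) (v : lhom V _) x y :
  u ** x ** (y ** v) = u ** (x ** y) ** v :> lhom V U by rewrite !lcompA.
split.
- by case=> i; rewrite simp ?h1 ?h2 lcomp1r ?g1 ?g1'.
- move=> [i|i] [j|j] ij; rewrite simp ?h1 ?h2 ?h12 ?h21 ?(lcomp0r, lcomp0l) //.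
    by rewrite lcomp1r g2.
  by rewrite lcomp1r g2'.
- rewrite big_sumType /= -h3; congr (_ + _).
    rewrite -[i1 in RHS]lcomp1r -g3 lcomp_sumr lcomp_suml.
    by apply: eq_bigr => i _; rewrite !lcompA.
  rewrite -[i2 in RHS]lcomp1r -g3' lcomp_sumr lcomp_suml.
  by apply: eq_bigr => i _; rewrite !lcompA.
Qed.

Lemma dsum_unit X : dsum (fun _ : unit => X) X.
Proof.
exists (fun _ => lid _), (fun _ => lid _); split.
- by move=> _; rewrite lcomp1l.
- by case; case.
- by rewrite (bigD1 tt) //= big1 ?addr0 ?lcomp1l // => -[].
Qed.

Lemma dsum_exists (I : finType) (Y : I -> L) : exists X, dsum Y X.
Proof.
suff H : forall n (Z : 'I_n -> L), exists X, dsum Z X.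
  have [X hX] := H _ (fun i : 'I_#|I| => Y (enum_val i)); exists X.
  apply: dsum_reindex hX; first exact: enum_rank_bij.
  by move=> j; rewrite enum_rankK.
elim=> [|n IH] Z.
  have [X X0] := lzero L; exists X.
  have h (i : 'I_0) : False by case: i.
  exists (fun i => False_rect _ (h i)), (fun i => False_rect _ (h i)).
  by split=> [i|i|]; [case: (h i) | case: (h i) | rewrite big_ord0].
have [X' hX'] := IH (fun i => Z (lift ord0 i)).
have [X [i1 [i2 [p1 [p2 [h1 h2 h3]]]]]] := lbiprod (Z ord0) X'.
exists X; have h := dsum2 h1 h2 h3.
have := dsum_sum h (dsum_unit _) hX'.
apply: (dsum_reindex (h := fun j : 'I_n.+1 =>
  if unlift ord0 j is Some i then inr i else inl tt)).
  exists (fun s => match s with inl _ => ord0 | inr i => lift ord0 i end).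
    by move=> j; case: unliftP => [i ->|->].
  by case=> [[]|i]; rewrite ?unlift_none ?liftK.
by move=> j; case: unliftP => [i ->|->].
Qed.

(** The measure for the induction in [krull_schmidt]: the endomorphisms of Y
    embed into those of X as i1 g p1, and i2 p2 is not in the image. *)
Lemma dim_retract_lt X Y Z :
  is_dsum2 (C := cat_of L) Y Z X -> lid Z <> 0 ->
  (\dim {: lhom Y Y} < \dim {: lhom X X})%N.
Proof.
move=> /dsum2E [i1 [i2 [p1 [p2 [h1 h2 h3]]]]] Z0.
pose F : 'Hom(lhom Y Y, lhom X X) := linfun (lcomp i1 \o rcomp p1).
have FE g : F g = i1 ** (g ** p1) by rewrite lfunE.
have F0 : (lker F = 0)%VS.
  apply/eqP/lker0P => g g'; rewrite !FE => e.
  have : p1 ** (i1 ** (g ** p1)) ** i1 = p1 ** (i1 ** (g' ** p1)) ** i1 by rewrite e.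
  by rewrite ![p1 ** (i1 ** _)]lcompA h1 !lcomp1l -!lcompA h1 !lcomp1r.
have <- : \dim (limg F) = \dim {: lhom Y Y}.
  by have := limg_ker_dim F fullv; rewrite F0 capv0 dimv0.
rewrite ltn_neqAle dimvS ?subvf // andbT.
apply/negP => /eqP e.
have : i2 ** p2 \in limg F.
  suff -> : limg F = fullv by exact: memvf.
  by apply/eqP; rewrite eqEdim subvf e leqnn.
move=> /memv_imgP [g _]; rewrite FE => eg.
have [_ h21] := dsum2_orth h1 h2 h3.
apply: Z0; have : p2 ** (i2 ** p2) ** i2 = lid Z.
  by rewrite lcompA h2 lcomp1l h2.
by rewrite eg lcompA h21 !lcomp0l => <-.
Qed.

Lemma indec_dsum X : lid X = 0 \/ indec X \/
  exists Y Z, [/\ is_dsum2 (C := cat_of L) Y Z X, lid Y <> 0 & lid Z <> 0].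
Proof.
case: (pselect (lid X = 0)) => [|X0]; [by left|right].
case: (pselect (exists Y Z,
  [/\ is_dsum2 (C := cat_of L) Y Z X, lid Y <> 0 & lid Z <> 0])) => [|h].
  by right.
left; split=> // Y Z YZ; apply: contrapT => /not_orP [Y0 Z0].
by apply: h; exists Y, Z.
Qed.

Lemma is_dsum2C Y Z X : is_dsum2 (C := cat_of L) Y Z X -> is_dsum2 (C := cat_of L) Z Y X.
Proof.
move=> /dsum2E [i1 [i2 [p1 [p2 [h1 h2 h3]]]]].
by apply: (dsum2 h2 h1); rewrite addrC.
Qed.

Lemma krull_schmidt X :
  exists r (Y : 'I_r -> L), (forall i, indec (Y i)) /\ dsum Y X.
Proof.
suff [I [Y [Yi YX]]] : exists (I : finType) (Y : I -> L),
    (forall i, indec (Y i)) /\ dsum Y X.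
  exists #|I|, (fun i => Y (enum_val i)); split=> //.
  by apply: dsum_reindex YX => //; exact: enum_val_bij.
have [n] := ubnP (\dim {: lhom X X}); elim: n X => // n IH X dX.
case: (indec_dsum X) => [X0 | [Xi | [Y [Z [YZ Y0 Z0]]]]].
- exists void, (fun _ => X); split; first by case.
  exists (fun _ => 0), (fun _ => 0).
  by split; [case|case|rewrite X0 big1 // => -[]].
- by exists unit, (fun _ => X); split=> //; exact: dsum_unit.
have [I [V [Vi VY]]] := IH Y (leq_trans (dim_retract_lt YZ Z0) dX).
have [J [W [Wi WZ]]] := IH Z (leq_trans (dim_retract_lt (is_dsum2C YZ) Y0) dX).
exists (I + J : finType)%type.
exists (sum_family V W).
by split; [case|exact: dsum_sum VY WZ].
Qed.

Lemma dim_dsum_l (I : finType) (Y : I -> L) X Z :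
  dsum Y X -> \dim {: lhom X Z} = (\sum_i \dim {: lhom (Y i) Z})%N.
Proof.
move=> [inj [prj [h1 h2 h3]]].
pose F i : 'Hom(lhom (Y i) Z, lhom X Z) := linfun (rcomp (prj i)).
have FE i g : F i g = g ** prj i by rewrite lfunE.
have Fd i : \dim (limg (F i)) = \dim {: lhom (Y i) Z}.
  have F0 : (lker (F i) = 0)%VS.
    apply/eqP/lker0P => g g'; rewrite !FE => e.
    have : g ** prj i ** inj i = g' ** prj i ** inj i by rewrite e.
    by rewrite -!lcompA h1 !lcomp1r.
  by have := limg_ker_dim (F i) fullv; rewrite F0 capv0 dimv0.
under eq_bigr do rewrite -Fd.
have dx : directv (\sum_i limg (F i)).
  apply/directv_sum_independent => u uF u0 i _.
  have /memv_imgP [g _ eg] := uF i isT.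
  have : (\sum_j u j) ** inj i ** prj i = u i.
    rewrite !lcomp_suml (bigD1 i) //= big1 ?addr0 => [|j ji].
      by rewrite eg FE -[g ** _ ** _]lcompA h1 lcomp1r.
    have /memv_imgP [g' _ ->] := uF j isT.
    by rewrite FE -[g' ** _ ** _]lcompA h2 1?eq_sym // lcomp0r lcomp0l.
  by rewrite u0 !lcomp0l.
rewrite -(directvP dx) /=; congr (\dim _).
apply/eqP; rewrite eqEsubv subvf andbT; apply/subvP => g _.
rewrite -[g]lcomp1r -h3 lcomp_sumr; apply: memv_sumr => i _.
by rewrite lcompA -FE; apply: memv_img (memvf _).
Qed.

Lemma dim_dsum_r (I : finType) (Y : I -> L) X Z :
  dsum Y X -> \dim {: lhom Z X} = (\sum_i \dim {: lhom Z (Y i)})%N.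
Proof.
move=> [inj [prj [h1 h2 h3]]].
pose F i : 'Hom(lhom Z (Y i), lhom Z X) := linfun (lcomp (inj i)).
have FE i g : F i g = inj i ** g by rewrite lfunE.
have Fd i : \dim (limg (F i)) = \dim {: lhom Z (Y i)}.
  have F0 : (lker (F i) = 0)%VS.
    apply/eqP/lker0P => g g'; rewrite !FE => e.
    have : prj i ** (inj i ** g) = prj i ** (inj i ** g') by rewrite e.
    by rewrite !lcompA h1 !lcomp1l.
  by have := limg_ker_dim (F i) fullv; rewrite F0 capv0 dimv0.
under eq_bigr do rewrite -Fd.
have dx : directv (\sum_i limg (F i)).
  apply/directv_sum_independent => u uF u0 i _.
  have /memv_imgP [g _ eg] := uF i isT.
  have : inj i ** (prj i ** (\sum_j u j)) = u i.
    rewrite !lcomp_sumr (bigD1 i) //= big1 ?addr0 => [|j ji].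
      by rewrite eg FE [prj i ** _]lcompA h1 lcomp1l.
    have /memv_imgP [g' _ ->] := uF j isT.
    by rewrite FE [prj i ** _]lcompA h2 // lcomp0l lcomp0r.
  by rewrite u0 !lcomp0r.
rewrite -(directvP dx) /=; congr (\dim _).
apply/eqP; rewrite eqEsubv subvf andbT; apply/subvP => g _.
rewrite -[g]lcomp1l -h3 lcomp_suml; apply: memv_sumr => i _.
by rewrite -lcompA -FE; apply: memv_img (memvf _).
Qed.

End DirectSums.

(** * The category of arrows *)
Section ArrowCategory.
Variables (k : fieldType) (L : lincat k).

Record arrow := Arrow { asrc : L; atgt : L; amap : lhom asrc atgt }.
Implicit Types f g h : arrow.

Definition sq_defect f g (x : lhom (asrc f) (asrc g) * lhom (atgt f) (atgt g)) :
  lhom (asrc f) (atgt g) := x.2 ** amap f - amap g ** x.1.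

Fact sq_defect_linear f g : linear (@sq_defect f g).
Proof.
move=> c x y; rewrite /sq_defect /= lcompDl lcompDr lcompZl lcompZr.
by rewrite scalerBr opprD addrACA.
Qed.

HB.instance Definition _ f g :=
  GRing.isLinear.Build k (lhom (asrc f) (asrc g) * lhom (atgt f) (atgt g))%type
    (lhom (asrc f) (atgt g)) *:%R (@sq_defect f g) (@sq_defect_linear f g).

(** Commutative squares are taken as the kernel of a linear map, which makes
    them a space of finite dimension. *)
Definition sqv f g : {vspace (lhom (asrc f) (asrc g) * lhom (atgt f) (atgt g))} :=
  lker (linfun (@sq_defect f g)).

Definition sqhom f g : vectType k := subvs_of (sqv f g).

Definition am1 f g (x : sqhom f g) : lhom (asrc f) (asrc g) := (vsval x).1.
Definition am0 f g (x : sqhom f g) : lhom (atgt f) (atgt g) := (vsval x).2.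

Lemma amE f g (x : sqhom f g) : am0 x ** amap f = amap g ** am1 x.
Proof.
have := subvsP x; rewrite memv_ker lfunE /= => /eqP/eqP.
by rewrite /sq_defect subr_eq0 => /eqP.
Qed.

Lemma mk_sq_subproof f g (b : lhom (asrc f) (asrc g)) (a : lhom (atgt f) (atgt g)) :
  a ** amap f = amap g ** b -> (b, a) \in sqv f g.
Proof. by move=> e; rewrite memv_ker lfunE /= /sq_defect e subrr. Qed.

Definition mk_sq f g b a e : sqhom f g := Subvs (@mk_sq_subproof f g b a e).

Lemma sq_ext f g (x y : sqhom f g) : am1 x = am1 y -> am0 x = am0 y -> x = y.
Proof.
move=> e1 e0; apply: val_inj; rewrite /= [val x]surjective_pairing.
by rewrite [RHS]surjective_pairing; congr pair.
Qed.

Definition arrow_id f : sqhom f f :=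
  @mk_sq f f (lid _) (lid _) (etrans (lcomp1l _) (esym (lcomp1r _))).

Fact acomp_subproof f g h (y : sqhom g h) (x : sqhom f g) :
  (am0 y ** am0 x) ** amap f = amap h ** (am1 y ** am1 x).
Proof. by rewrite -lcompA amE !lcompA amE. Qed.

Definition arrow_comp f g h (y : sqhom g h) (x : sqhom f g) : sqhom f h :=
  mk_sq (acomp_subproof y x).

Fact acompA f g h j (z : sqhom h j) (y : sqhom g h) (x : sqhom f g) :
  arrow_comp z (arrow_comp y x) = arrow_comp (arrow_comp z y) x.
Proof. by apply: sq_ext; rewrite /am1 /am0 /= lcompA. Qed.

Fact acomp1l f g (x : sqhom f g) : arrow_comp (arrow_id g) x = x.
Proof. by apply: sq_ext; rewrite /am1 /am0 /= lcomp1l. Qed.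

Fact acomp1r f g (x : sqhom f g) : arrow_comp x (arrow_id f) = x.
Proof. by apply: sq_ext; rewrite /am1 /am0 /= lcomp1r. Qed.

Fact acomp_linl f g h (x : sqhom f g) : linear (fun y : sqhom g h => arrow_comp y x).
Proof.
move=> c y z; apply: sq_ext; rewrite /am1 /am0 linearP /=.
  by rewrite lcompDl lcompZl.
by rewrite lcompDl lcompZl.
Qed.

Fact acomp_linr f g h (y : sqhom g h) : linear (@arrow_comp f g h y).
Proof.
move=> c x z; apply: sq_ext; rewrite /am1 /am0 linearP /=.
  by rewrite lcompDr lcompZr.
by rewrite lcompDr lcompZr.
Qed.

Fact arrow_split f (e : sqhom f f) : arrow_comp e e = e ->
  exists g (i : sqhom g f) (p : sqhom f g), arrow_comp p i = arrow_id g /\ arrow_comp i p = e.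
Proof.
move=> ee.
have e1 : am1 e ** am1 e = am1 e by rewrite -[RHS](congr1 (@am1 f f) ee).
have e0 : am0 e ** am0 e = am0 e by rewrite -[RHS](congr1 (@am0 f f) ee).
have [Y1 [i1 [p1 [pi1 ip1]]]] := lsplit e1.
have [Y0 [i0 [p0 [pi0 ip0]]]] := lsplit e0.
pose g := Arrow (p0 ** amap f ** i1).
have hi : i0 ** amap g = amap f ** i1.
  by rewrite /= !lcompA ip0 amE -lcompA -ip1 -lcompA pi1 lcomp1r.
have hp : p0 ** amap f = amap g ** p1.
  by rewrite /= -lcompA ip1 -lcompA -amE -ip0 !lcompA pi0 lcomp1l.
exists g, (@mk_sq g f i1 i0 hi), (@mk_sq f g p1 p0 hp).
by split; apply: sq_ext; rewrite /am1 /am0 /= ?pi1 ?pi0 ?ip1 ?ip0.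
Qed.

Fact arrow_zero : exists f, arrow_id f = 0.
Proof.
have [Z Z0] := lzero L; exists (Arrow (0 : lhom Z Z)).
by apply: sq_ext; rewrite /am1 /am0 linear0 /= Z0.
Qed.

Fact arrow_biprod f g : exists h (i1 : sqhom f h) (i2 : sqhom g h)
      (p1 : sqhom h f) (p2 : sqhom h g),
    [/\ arrow_comp p1 i1 = arrow_id f, arrow_comp p2 i2 = arrow_id g
      & arrow_comp i1 p1 + arrow_comp i2 p2 = arrow_id h].
Proof.
have [S [i1 [i2 [p1 [p2 [h1 h2 h3]]]]]] := lbiprod (asrc f) (asrc g).
have [T [j1 [j2 [q1 [q2 [g1 g2 g3]]]]]] := lbiprod (atgt f) (atgt g).
have [h12 h21] := dsum2_orth h1 h2 h3.
have [g12 g21] := dsum2_orth g1 g2 g3.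
pose m := j1 ** amap f ** p1 + j2 ** amap g ** p2.
pose h := Arrow m.
have e1 : j1 ** amap f = amap h ** i1.
  by rewrite /= /m lcompDl -!lcompA h1 h21 !lcomp0r addr0 lcomp1r.
have e2 : j2 ** amap g = amap h ** i2.
  by rewrite /= /m lcompDl -!lcompA h2 h12 !lcomp0r add0r lcomp1r.
have e3 : q1 ** amap h = amap f ** p1.
  by rewrite /= /m lcompDr !lcompA g1 g12 !lcomp0l addr0 lcomp1l.
have e4 : q2 ** amap h = amap g ** p2.
  by rewrite /= /m lcompDr !lcompA g2 g21 !lcomp0l add0r lcomp1l.
exists h, (@mk_sq f h i1 j1 e1), (@mk_sq g h i2 j2 e2), (@mk_sq h f p1 q1 e3),
  (@mk_sq h g p2 q2 e4).
split; apply: sq_ext; rewrite /am1 /am0 ?linearD /= ?h1 ?h2 ?h3 ?g1 ?g2 ?g3 //.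
Qed.

Definition arrl : lincat k :=
  Lincat acompA acomp1l acomp1r acomp_linl acomp_linr arrow_split arrow_zero
    arrow_biprod.

Lemma am1_0 f g : am1 (0 : sqhom f g) = 0.
Proof. by rewrite /am1 linear0. Qed.

Lemma am0_0 f g : am0 (0 : sqhom f g) = 0.
Proof. by rewrite /am0 linear0. Qed.

Lemma am1_sum (I : finType) f g (x : I -> sqhom f g) :
  am1 (\sum_i x i) = \sum_i am1 (x i).
Proof. by rewrite /am1 linear_sum /= [LHS]raddf_sum. Qed.

Lemma am0_sum (I : finType) f g (x : I -> sqhom f g) :
  am0 (\sum_i x i) = \sum_i am0 (x i).
Proof. by rewrite /am0 linear_sum /= [LHS]raddf_sum. Qed.

End ArrowCategory.

(** * Rigid arrows and the open orbit argument *)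
Section Pencil.
Variable k : fieldType.

Section Matrix.
Variables (n : nat) (M : 'M[k]_n) (u : 'rV[k]_n).

Let C := @polyC k.
Definition pencil : 'M[{poly k}]_n := 1%:M - 'X *: map_mx C M.
Definition pencil_sol : 'rV[{poly k}]_n := map_mx C u *m \adj pencil.
Definition pencil_mod p (a : 'M[k]_(n, p * p)) : 'M[{poly k}]_p :=
  (\det pencil)%:M + 'X *: vec_mx (pencil_sol *m map_mx C a).

Lemma ev_map l m q (A : 'M[k]_(m, q)) : map_mx (horner_eval l) (map_mx C A) = A.
Proof. by apply/matrixP => i j; rewrite !mxE /horner_eval hornerC. Qed.

Lemma ev_pencil l : map_mx (horner_eval l) pencil = 1%:M - l *: M.
Proof.
by rewrite /pencil map_mxB map_mxZ map_mx1 ev_map /= horner_evalE hornerX.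
Qed.

(** By Cramer's rule y is [pencil_sol] divided by the determinant of 1 - l M,
    a polynomial in l. Multiplying the two remaining matrices by this
    determinant makes them polynomial as well, so that all conditions hold
    outside the zeros of a product of determinants, which takes the value 1 at
    l = 0. *)
Lemma pencil_generic p1 p2 (a1 : 'M[k]_(n, p1 * p1)) (a2 : 'M[k]_(n, p2 * p2)) :
  exists2 D : {poly k}, D != 0 & forall l, D.[l] != 0 ->
  exists y : 'rV[k]_n, [/\ y *m (1%:M - l *: M) = u,
    1%:M + l *: vec_mx (y *m a1) \in unitmx
    & 1%:M + l *: vec_mx (y *m a2) \in unitmx].
Proof.
pose d := \det pencil.
have evd l : d.[l] = \det (1%:M - l *: M).
  by rewrite -ev_pencil -[LHS]/(horner_eval l d) -det_map_mx.
have evp l p (a : 'M[k]_(n, p * p)) : d.[l] != 0 ->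
    exists2 y : 'rV[k]_n, y = d.[l]^-1 *: (u *m \adj (1%:M - l *: M)) &
    (\det (pencil_mod a)).[l] =
      \det (d.[l] *: (1%:M + l *: vec_mx (y *m a))).
  move=> dl; eexists; first by [].
  rewrite -[LHS]/(horner_eval l _) -det_map_mx; congr (\det _).
  rewrite /pencil_mod map_mxD map_mxZ map_vec_mx map_mxM ev_map.
  rewrite /pencil_sol map_mxM map_mx_adj ev_map ev_pencil.
  rewrite map_scalar_mx scalerDr scale_scalar_mx mulr1.
  congr (_ + _); rewrite -scalemxAl [vec_mx (_ *: _)]linearZ /= !scalerA mulrAC mulfV // mul1r.
  by rewrite /= horner_evalE hornerX.
have d0 : d.[0] = 1 by rewrite evd scale0r subr0 det1.
exists (d * (\det (pencil_mod a1) * \det (pencil_mod a2))).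
  apply/eqP => /(congr1 (fun q => q.[0])); rewrite !hornerM horner0 d0 mul1r.
  have d00 : d.[0] != 0 by rewrite d0 oner_eq0.
  have [y1 _ ->] := evp 0 _ a1 d00; have [y2 _ ->] := evp 0 _ a2 d00.
  rewrite !scale0r !addr0 d0 !scale1r !det1 mul1r => /eqP.
  by rewrite oner_eq0.
move=> l; rewrite !hornerM !mulf_eq0 !negb_or => /and3P [dl h1 h2].
have [y yE e1] := evp l _ a1 dl; have [y' y'E e2] := evp l _ a2 dl.
have e : y' = y by rewrite yE y'E.
exists y; split.
- rewrite yE -scalemxAl -mulmxA mul_adj_mx -evd scalar_mxC.
  by rewrite mul_scalar_mx scalerA mulVf // scale1r.
- by move: h1; rewrite e1 detZ mulf_eq0 negb_or unitmxE unitfE => /andP [].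
- move: h2; rewrite e2 detZ mulf_eq0 negb_or unitmxE unitfE => /andP [].
  by rewrite e.
Qed.

End Matrix.

Import VectorInternalTheory.

Lemma lfun_mx (V W : vectType k) (f : 'Hom(V, W)) v :
  v2r (f v) = v2r v *m f2mx f.
Proof. by rewrite unlock /= r2vK. Qed.

Fact f2mx_linear (V W : vectType k) : linear (@f2mx k V W).
Proof.
move=> c f g; rewrite -[RHS]/(f2mx (vector.Hom _)); congr f2mx.
apply/lfunP => v; rewrite add_lfunE scale_lfunE.
by apply: (can_inj v2rK); rewrite linearD linearZ /= !lfun_mx /= mulmxDr -scalemxAr.
Qed.

HB.instance Definition _ (V W : vectType k) :=
  GRing.isLinear.Build k 'Hom(V, W) 'M[k]_(dim V, dim W) *:%R (@f2mx k V W)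
    (@f2mx_linear V W).

Lemma lfun_pencil (W V1 V2 : vectType k) (Psi : 'End(W)) (u : W)
    (a1 : 'Hom(W, 'End(V1))) (a2 : 'Hom(W, 'End(V2))) :
  exists2 D : {poly k}, D != 0 & forall l, D.[l] != 0 ->
  exists y : W, [/\ y - l *: Psi y = u,
    forall v, v + l *: a1 y v = 0 -> v = 0
    & forall v, v + l *: a2 y v = 0 -> v = 0].
Proof.
have [D D0 HD] := pencil_generic (f2mx Psi) (v2r u)
  (lin1_mx (mxvec \o f2mx \o a1 \o r2v)) (lin1_mx (mxvec \o f2mx \o a2 \o r2v)).
exists D => // l /HD [y [y1 y2 y3]]; exists (r2v y).
have aux (V : vectType k) (a : 'Hom(W, 'End(V))) :
    1%:M + l *: vec_mx (y *m lin1_mx (mxvec \o f2mx \o a \o r2v)) \in unitmx ->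
    forall v, v + l *: a (r2v y) v = 0 -> v = 0.
  move=> yu v /(congr1 v2r); rewrite linear0 linearD linearZ /= lfun_mx.
  rewrite mul_rV_lin1 /= mxvecK in yu.
  rewrite -{1}[v2r v]mulmx1 scalemxAr -mulmxDr => e.
  by apply: (can_inj v2rK); rewrite linear0 -[v2r v](mulmxK yu) e mul0mx.
split; [|exact: aux y2|exact: aux y3].
apply: (can_inj v2rK); rewrite linearB linearZ /= lfun_mx r2vK -y1.
by rewrite mulmxBr mulmx1 scalemxAr.
Qed.

End Pencil.

Section TwoTerm.
Variables (k : fieldType) (L : lincat k).
Implicit Types (X Y : L) (f g h : arrow L).

(** For two-term complexes of projectives with targets in degree 0, this is
    Hom(f, g[1]) = 0 in the homotopy category. *)
Definition orth f g : Prop := forall w : lhom (asrc f) (atgt g),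
  exists a b, w = a ** amap f + amap g ** b.

Definition contr f : Prop := invertible (amap f).

Section Dsum.
Variables (I : finType) (F : I -> arrow L) (f : arrow L).
Hypothesis Ff : dsum (L := arrl L) F f.

Lemma dsum_src : dsum (fun i => asrc (F i)) (asrc f).
Proof.
have [inj [prj [h1 h2 h3]]] := Ff.
exists (fun i => am1 (inj i)), (fun i => am1 (prj i)); split.
- by move=> i; have := congr1 (@am1 _ _ _ _) (h1 i).
- by move=> i j ij; have := congr1 (@am1 _ _ _ _) (h2 i j ij); rewrite {2}/am1 linear0.
- by have := congr1 (@am1 _ _ _ _) h3; rewrite am1_sum.
Qed.

Lemma dsum_tgt : dsum (fun i => atgt (F i)) (atgt f).
Proof.
have [inj [prj [h1 h2 h3]]] := Ff.
exists (fun i => am0 (inj i)), (fun i => am0 (prj i)); split.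
- by move=> i; have := congr1 (@am0 _ _ _ _) (h1 i).
- by move=> i j ij; have := congr1 (@am0 _ _ _ _) (h2 i j ij); rewrite {2}/am0 linear0.
- by have := congr1 (@am0 _ _ _ _) h3; rewrite am0_sum.
Qed.

Lemma orth_dsum_l g : (forall i, orth (F i) g) -> orth f g.
Proof.
have [inj [prj [h1 h2 h3]]] := Ff => Fg w.
pose a i := sval (cid (Fg i (w ** am1 (inj i)))).
pose b i := sval (cid (svalP (cid (Fg i (w ** am1 (inj i)))))).
have ab i : w ** am1 (inj i) = a i ** amap (F i) + amap g ** b i.
  exact: (svalP (cid (svalP (cid (Fg i (w ** am1 (inj i))))))).
exists (\sum_i a i ** am0 (prj i)), (\sum_i b i ** am1 (prj i)).
rewrite lcomp_suml lcomp_sumr -big_split /= -[LHS]lcomp1r.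
have -> : lid (asrc f) = \sum_i am1 (inj i) ** am1 (prj i).
  by rewrite -[LHS](congr1 (@am1 _ _ _ _) h3) am1_sum.
rewrite lcomp_sumr; apply: eq_bigr => i _.
by rewrite lcompA ab lcompDl -[in RHS]lcompA amE !lcompA.
Qed.

Lemma orth_dsum_r g : (forall i, orth g (F i)) -> orth g f.
Proof.
have [inj [prj [h1 h2 h3]]] := Ff => Fg w.
pose a i := sval (cid (Fg i (am0 (prj i) ** w))).
pose b i := sval (cid (svalP (cid (Fg i (am0 (prj i) ** w))))).
have ab i : am0 (prj i) ** w = a i ** amap g + amap (F i) ** b i.
  exact: (svalP (cid (svalP (cid (Fg i (am0 (prj i) ** w)))))).
exists (\sum_i am0 (inj i) ** a i), (\sum_i am1 (inj i) ** b i).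
rewrite lcomp_suml lcomp_sumr -big_split /= -[LHS]lcomp1l.
have -> : lid (atgt f) = \sum_i am0 (inj i) ** am0 (prj i).
  by rewrite -[LHS](congr1 (@am0 _ _ _ _) h3) am0_sum.
rewrite lcomp_suml; apply: eq_bigr => i _.
by rewrite -lcompA ab lcompDr !lcompA amE.
Qed.

End Dsum.

Lemma retractE f g : retract (L := arrl L) f g ->
  exists (i1 : lhom (asrc f) (asrc g)) (p1 : lhom (asrc g) (asrc f))
         (i0 : lhom (atgt f) (atgt g)) (p0 : lhom (atgt g) (atgt f)),
  [/\ p1 ** i1 = lid _, p0 ** i0 = lid _,
      i0 ** amap f = amap g ** i1 & p0 ** amap g = amap f ** p1].
Proof.
move=> [i [p pi]]; exists (am1 i), (am1 p), (am0 i), (am0 p); split.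
- exact: (congr1 (@am1 _ _ _ _) pi).
- exact: (congr1 (@am0 _ _ _ _) pi).
- exact: amE.
- exact: amE.
Qed.

Lemma orth_retract_l f f' g :
  retract (L := arrl L) f f' -> orth f' g -> orth f g.
Proof.
move=> /retractE [i1 [p1 [i0 [p0 [h1 h0 hi hp]]]]] fg w.
have [a [b e]] := fg (w ** p1); exists (a ** i0), (b ** i1).
by rewrite -[w]lcomp1r -h1 lcompA e lcompDl -!lcompA hi.
Qed.

Lemma orth_retract_r f f' g :
  retract (L := arrl L) f f' -> orth g f' -> orth g f.
Proof.
move=> /retractE [i1 [p1 [i0 [p0 [h1 h0 hi hp]]]]] fg w.
have [a [b e]] := fg (i0 ** w); exists (p0 ** a), (p1 ** b).
by rewrite -[w]lcomp1l -h0 -lcompA e lcompDr !lcompA hp.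
Qed.

Lemma retract_contr f g : retract (L := arrl L) f g -> contr g -> contr f.
Proof.
move=> /retractE [i1 [p1 [i0 [p0 [h1 h0 hi hp]]]]] [v [vg gv]].
exists (p1 ** v ** i0); split.
  by rewrite -lcompA hi -lcompA [v ** _]lcompA vg lcomp1l.
by rewrite !lcompA -hp -[p0 ** _ ** v]lcompA gv lcomp1r.
Qed.

Lemma orth_contr_l f g : contr f -> orth f g.
Proof.
move=> [v [vf fv]] w; exists (w ** v), 0.
by rewrite lcomp0r addr0 -lcompA vf lcomp1r.
Qed.

Lemma orth_contr_r f g : contr f -> orth g f.
Proof.
move=> [v [vf fv]] w; exists 0, (v ** w).
by rewrite lcomp0l add0r lcompA fv lcomp1l.
Qed.

Lemma injective_invertible X (a : lhom X X) :
  (forall b : lhom X X, a ** b = 0 -> b = 0) -> invertible a.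
Proof.
move=> a0; pose F : 'End(lhom X X) := linfun (lcomp a).
have FE b : F b = a ** b by rewrite lfunE.
have ker0 : lker F == 0%VS.
  by apply/lker0P => b c; rewrite !FE => e; apply/eqP; rewrite -subr_eq0;
     apply/eqP; apply: a0; rewrite lcompBr e subrr.
have [b ab] : exists b, a ** b = lid X.
  by exists ((F^-1)%VF (lid X)); rewrite -FE lker0_lfunVK.
exists b; split=> //; apply/eqP; rewrite -subr_eq0; apply/eqP; apply: a0.
by rewrite lcompBr lcompA ab lcomp1l lcomp1r subrr.
Qed.

(** The form in which the infinity of the field is used: a nonzero polynomial
    has a nonzero value. *)
Definition infinite_field : Prop :=
  forall D : {poly k}, D != 0 -> exists l, D.[l] != 0.

Definition left_mul X (a : lhom X X) : 'End(lhom X X) := linfun (lcomp a).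

Fact left_mul_linear X : linear (@left_mul X).
Proof.
move=> c a b; apply/lfunP => x.
by rewrite add_lfunE scale_lfunE !lfunE /= lcompDl lcompZl.
Qed.

HB.instance Definition _ X :=
  GRing.isLinear.Build k (lhom X X) 'End(lhom X X) *:%R (@left_mul X)
    (@left_mul_linear X).

(** Rigidity says that (a, b) |-> a f - f b is onto, so it has a linear
    section s. For (a, b) = s y, the pair (1 + l a, 1 + l b) carries f to f +
    l u as soon as y - l u b = u, because (1 + l a) f - (f + l u) (1 + l b) =
    l (y - u - l u b). This is a linear pencil in y, solvable for generic l.
    *)
Lemma generic_orbit X Y (f u : lhom X Y) : orth (Arrow f) (Arrow f) ->
  exists2 D : {poly k}, D != 0 & forall l, D.[l] != 0 ->
  exists (a : lhom Y Y) (b : lhom X X), [/\ invertible a, invertible b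
    & a ** f = (f + l *: u) ** b].
Proof.
move=> rig.
have rig' w : {ab : lhom Y Y * lhom X X | w = ab.1 ** f + f ** ab.2}.
  by apply: cid; have [a [b ->]] := rig w; exists (a, b).
(* a linear section of (a, b) |-> a f - f b *)
pose V := (lhom Y Y * lhom X X)%type.
pose Phi0 (x : V) : lhom X Y := x.1 ** f - f ** x.2.
have Phi_lin : linear Phi0.
  move=> c x y; rewrite /Phi0 /= lcompDl lcompDr lcompZl lcompZr.
  by rewrite scalerBr opprD addrACA.
pose PhiL : {linear V -> lhom X Y} :=
  HB.pack Phi0 (GRing.isLinear.Build k V (lhom X Y) *:%R Phi0 Phi_lin).
pose Phi : 'Hom(V, lhom X Y) := linfun PhiL.
have PhiE x : Phi x = x.1 ** f - f ** x.2 by rewrite lfunE.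
have secP w : Phi ((Phi^-1)%VF w) = w.
  rewrite limg_lfunVK //; have [[a b] /= e] := rig' w.
  suff -> : w = Phi (a, - b) by apply: memv_img (memvf _).
  by rewrite PhiE /= lcompNr opprK.
pose s := (Phi^-1)%VF.
pose Psi : 'End(lhom X Y) := linfun (lcomp u \o snd \o s).
have PsiE w : Psi w = u ** (s w).2 by rewrite lfunE.
pose a1 : 'Hom(lhom X Y, 'End(lhom Y Y)) := linfun (@left_mul Y \o fst \o s).
pose a2 : 'Hom(lhom X Y, 'End(lhom X X)) := linfun (@left_mul X \o snd \o s).
have [D D0 HD] := lfun_pencil Psi u a1 a2.
exists D => // l /HD [y [y0 y1 y2]].
exists (lid Y + l *: (s y).1), (lid X + l *: (s y).2); split.
- apply: injective_invertible => b e; apply: y1.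
  by rewrite -[RHS]e lcompDl lcomp1l lcompZl lfunE /= lfunE.
- apply: injective_invertible => b e; apply: y2.
  by rewrite -[RHS]e lcompDl lcomp1l lcompZl lfunE /= lfunE.
rewrite lcompDl lcomp1l lcompZl !lcompDr !lcompDl !lcomp1r.
rewrite !lcompZl !lcompZr.
have := secP y; rewrite -/s PhiE => e.
have -> : u ** (s y).2 = Psi y by rewrite PsiE.
rewrite -[in RHS]y0 scalerBr -!addrA; congr (_ + _).
have -> : (s y).1 ** f = y + f ** (s y).2 by apply/eqP; rewrite -subr_eq e.
by rewrite scalerDr; congr (_ + _); rewrite addrC addrK.
Qed.

(** A generic point of the line through f and f' lies in the orbit of f and in
    the orbit of f'. *)
Lemma open_orbit X Y (f f' : lhom X Y) : infinite_field ->
  orth (Arrow f) (Arrow f) -> orth (Arrow f') (Arrow f') ->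
  exists (a : lhom Y Y) (b : lhom X X), [/\ invertible a, invertible b
    & a ** f = f' ** b].
Proof.
move=> kinf rf rf'.
have [D D0 HD] := generic_orbit (f' - f) rf.
have [E E0 HE] := generic_orbit (f - f') rf'.
have [l] : exists l, (D * (E \Po (1 - 'X))).[l] != 0.
  apply: kinf; rewrite mulf_eq0 (negPf D0) /=; apply/negP => /eqP E1.
  case/negP: E0; apply/eqP.
  have -> : E = (E \Po (1 - 'X)) \Po (1 - 'X).
    rewrite -comp_polyA (_ : (1 - 'X) \Po (1 - 'X) = 'X) ?comp_polyXr //.
    by rewrite comp_polyB rmorph1 comp_polyX opprB addrC subrK.
  by rewrite E1 comp_poly0.
rewrite hornerM mulf_eq0 negb_or horner_comp !hornerE => /andP [/HD h /HE h'].
have [a [b [ai bi ab]]] := h; have [a' [b' [[c [ca ac]] [d [db bd]] ab']]] := h'.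
have e : f + l *: (f' - f) = f' + (1 - l) *: (f - f').
  by rewrite scalerBl scale1r -scalerN opprB addrA;
    congr (_ + _); rewrite addrC subrK.
exists (c ** a), (d ** b); split.
- by apply: invertible_comp => //; exists a'.
- by apply: invertible_comp => //; exists b'.
rewrite -lcompA ab e -[X in c ** (X ** _)]lcomp1r -bd.
by rewrite [_ ** (b' ** d)]lcompA -ab' !lcompA ca lcomp1l.
Qed.

End TwoTerm.

(** * Independence of the classes of a rigid family *)
Section ArrowIso.
Variables (k : fieldType) (L : lincat k).
Implicit Types f g h : arrow L.

Lemma isom_arrow f g (u : lhom (asrc f) (asrc g)) (v : lhom (atgt f) (atgt g)) :
  invertible u -> invertible v -> v ** amap f = amap g ** u ->
  isom (L := arrl L) f g.
Proof.
move=> [u' [uu' u'u]] [v' [vv' v'v]] e.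
have e' : v' ** amap g = amap f ** u'.
  rewrite -[amap g]lcomp1r -u'u [amap g ** _]lcompA -e !lcompA vv'.
  by rewrite lcomp1l.
exists (@mk_sq _ _ f g u v e), (@mk_sq _ _ g f u' v' e').
by split; apply: sq_ext; rewrite /am1 /am0.
Qed.

(** After transport along the isomorphisms of the terms, both arrows lie in
    one Hom space, and each has a dense orbit there. *)
Lemma rigid_isom f g : infinite_field k -> orth f f -> orth g g ->
  isom (asrc f) (asrc g) -> isom (atgt f) (atgt g) -> isom (L := arrl L) f g.
Proof.
move=> kinf rf rg [u [u' [uu' u'u]]] [v [v' [vv' v'v]]].
pose g' := v' ** amap g ** u.
have gg' : v ** g' = amap g ** u by rewrite /g' !lcompA v'v lcomp1l.
have rg' : orth (Arrow g') (Arrow g').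
  have hg : isom (L := arrl L) (Arrow g') g.
    apply: (@isom_arrow (Arrow g') g u v) => //; first by exists u'.
    by exists v'.
  apply: (orth_retract_l (isom_retract hg)).
  exact: (orth_retract_r (isom_retract hg)).
have rf' : orth (Arrow (amap f)) (Arrow (amap f)) by case: (f) rf.
have [a [b [ai bi ab]]] := open_orbit kinf rf' rg'.
apply: (@isom_arrow f g (u ** b) (v ** a)).
- by apply: invertible_comp => //; exists u'.
- by apply: invertible_comp => //; exists v'.
by rewrite -lcompA ab lcompA gg' -lcompA.
Qed.

Definition id_arrow (X : L) : arrow L := Arrow (lid X).

Lemma id_arrow_contr X : contr (id_arrow X).
Proof. exact: invertible_id. Qed.

End ArrowIso.

Section Classes.
Variables (k : fieldType) (L : lincat k).
Implicit Types f g h : arrow L.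
Hypothesis kinf : infinite_field k.
Variables (t : nat) (mu : L -> 'I_t -> nat).
Hypothesis mu_dsum : forall (I : finType) (Y : I -> L) X j,
  dsum Y X -> mu X j = (\sum_i mu (Y i) j)%N.
Hypothesis mu_isom : forall X Y : L, (forall j, mu X j = mu Y j) -> isom X Y.

(** The g-vector of f, when mu counts the indecomposable projective summands.
    *)
Definition cls f (j : 'I_t) : int := (mu (atgt f) j)%:Z - (mu (asrc f) j)%:Z.

Lemma cls_dsum (I : finType) (F : I -> arrow L) f j :
  dsum (L := arrl L) F f -> cls f j = \sum_i cls (F i) j.
Proof.
move=> Ff; rewrite /cls (mu_dsum j (dsum_src Ff)) (mu_dsum j (dsum_tgt Ff)).
by rewrite !(big_morph Posz PoszD (erefl 0%:Z)) -sumrB.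
Qed.

Lemma mu_transfer X Y j : isom X Y -> mu X j = mu Y j.
Proof.
move=> XY; rewrite (mu_dsum j (dsum_transfer XY (dsum_unit X))).
by rewrite (bigD1 tt) //= big1 ?addn0 // => -[].
Qed.

Lemma cls_isom f g j : isom (L := arrl L) f g -> cls f j = cls g j.
Proof.
move=> fg; rewrite (cls_dsum j (dsum_transfer fg (dsum_unit (L := arrl L) f))).
by rewrite (bigD1 tt) //= big1 ?addr0 // => -[].
Qed.

Lemma cls_contr f j : contr f -> cls f j = 0.
Proof.
move=> fc; rewrite /cls (@mu_transfer (asrc f) (atgt f)) ?subrr //.
by exists (amap f).
Qed.

Section Family.
Variables (m : nat) (T : 'I_m -> arrow L).

(** The indecomposable summands of a basic two-term presilting complex. *)
Definition rigid_family : Prop :=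
  [/\ forall s s', orth (T s) (T s'),
      forall s, indec (L := arrl L) (T s),
      forall s, ~ contr (T s)
    & forall s s', isom (L := arrl L) (T s) (T s') -> s = s'].

Definition power_family (n : 'I_m -> nat) (s : {s : 'I_m & 'I_(n s)}) : arrow L :=
  T (tag s).

Lemma cls_power (n : 'I_m -> nat) X j :
  dsum (L := arrl L) (@power_family n) X ->
  cls X j = \sum_s (n s)%:Z * cls (T s) j.
Proof.
move=> /(cls_dsum j) ->.
rewrite -(sig_big_dep xpredT (fun s _ => true) (fun s (_ : 'I_(n s)) => cls (T s) j)) /=.
by apply: eq_bigr => s _; rewrite sumr_const card_ord -mulr_natl natz.
Qed.

Hypothesis HT : rigid_family.

(** Adding an identity arrow changes neither the class nor the rigidity, but
    it enlarges both terms: two sums with the same class can be given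
    isomorphic terms in this way. *)
Lemma rigid_stable (n : 'I_m -> nat) (Y : L) :
  exists Z X : arrow L, [/\ dsum (L := arrl L) (@power_family n) X,
    dsum (L := arrl L) (sum_family (L := arrl L) (@power_family n) (fun _ : unit => id_arrow Y)) Z,
    orth Z Z,
    forall j, mu (asrc Z) j = (mu (asrc X) j + mu Y j)%N
    & forall j, mu (atgt Z) j = (mu (atgt X) j + mu Y j)%N].
Proof.
have [T_orth _ _ _] := HT.
have [X hX] := dsum_exists (L := arrl L) (@power_family n).
have [Z [i1 [i2 [p1 [p2 [h1 h2 h3]]]]]] := lbiprod (X : arrl L) (id_arrow Y).
have XZ := dsum2 h1 h2 h3.
have hZ := dsum_sum XZ hX (dsum_unit (L := arrl L) (id_arrow Y)).
exists Z, X; split=> //.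
- apply: (orth_dsum_l hZ) => i; apply: (orth_dsum_r hZ) => j.
  case: i => [i|[]]; last by apply: orth_contr_l; exact: id_arrow_contr.
  case: j => [j|[]]; last by apply: orth_contr_r; exact: id_arrow_contr.
  exact: T_orth.
- move=> j; rewrite (mu_dsum j (dsum_src hZ)) big_sumType /=.
  rewrite (mu_dsum j (dsum_src hX)); congr (_ + _)%N.
  by rewrite (bigD1 tt) //= big1 ?addn0 // => -[].
- move=> j; rewrite (mu_dsum j (dsum_tgt hZ)) big_sumType /=.
  rewrite (mu_dsum j (dsum_tgt hX)); congr (_ + _)%N.
  by rewrite (bigD1 tt) //= big1 ?addn0 // => -[].
Qed.

(** The two sides of the relation are classes of rigid arrows. Once their
    terms are equalised by [rigid_stable], [rigid_isom] makes them isomorphic,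
    and by exchange T s is a summand of the side in which it does not occur.
    *)
Lemma rigid_no_relation (n n' : 'I_m -> nat) s :
  (forall j, \sum_s (n s)%:Z * cls (T s) j = \sum_s (n' s)%:Z * cls (T s) j) ->
  (0 < n s)%N -> n' s = 0%N -> False.
Proof.
have [T_orth T_indec T_contr T_iso] := HT.
move=> rel ns n's.
have [X' hX'] := dsum_exists (L := arrl L) (@power_family n').
have [X hX] := dsum_exists (L := arrl L) (@power_family n).
have [Z [X1 [hX1 hZ rZ srcZ tgtZ]]] := rigid_stable n (asrc X').
have [Z' [X1' [hX1' hZ' rZ' srcZ' tgtZ']]] := rigid_stable n' (asrc X).
have ZZ' : isom (L := arrl L) Z Z'.
  have e1 := dsum_unique (dsum_src hX) (dsum_src hX1).
  have e2 := dsum_unique (dsum_src hX') (dsum_src hX1').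
  apply: rigid_isom => //; apply: mu_isom => j.
    by rewrite srcZ srcZ' (mu_transfer j e1) (mu_transfer j e2) addnC.
  rewrite tgtZ tgtZ' (mu_transfer j e1) (mu_transfer j e2).
  have := rel j; rewrite -(cls_power j hX1) -(cls_power j hX1') /cls.
  lia.
have : retract (L := arrl L) (T s) Z'.
  apply: (retract_trans _ (isom_retract ZZ')).
  have := dsum_inj_retract (inl (existT _ s (Ordinal ns))) hZ.
  by [].
move=> /(retract_exchange (T_indec s)) /(_ hZ') [[[s' i]|[]]] /=; last first.
  by move/retract_contr => /(_ (id_arrow_contr _)); exact: T_contr.
rewrite /power_family /= => /retract_indec h.
have : isom (L := arrl L) (T s) (T s').
  apply: h => //; exact: (proj1 (T_indec s)).
by move/T_iso => e; move: i; rewrite -e n's => -[].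
Qed.

Lemma rigid_independent (z : 'I_m -> int) :
  (forall j, \sum_s z s * cls (T s) j = 0) -> forall s, z s = 0.
Proof.
move=> rel s.
pose n s := if 0 <= z s then `|z s|%N else 0%N.
pose n' s := if z s <= 0 then `|z s|%N else 0%N.
have zn i : z i = (n i)%:Z - (n' i)%:Z by rewrite /n /n'; case: (ltrgtP (z i) 0); lia.
have rel' j : \sum_s (n s)%:Z * cls (T s) j = \sum_s (n' s)%:Z * cls (T s) j.
  apply/eqP; rewrite -subr_eq0 -sumrB -[X in _ == X](rel j); apply/eqP.
  by apply: eq_bigr => i _; rewrite zn mulrBl.
have rel'' j := esym (rel' j).
case: (ltrgtP (z s) 0) => // zs; exfalso.
  by apply: (rigid_no_relation (s := s) rel''); rewrite /n /n' ?(ltW zs) ?lt_geF //; lia.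
by apply: (rigid_no_relation (s := s) rel'); rewrite /n /n' ?(ltW zs) ?lt_geF //; lia.
Qed.

(** A relation over the rationals becomes integral when its denominators are
    cleared, and the rank of a rational matrix does not change in a larger
    field. *)
Lemma rigid_row_free (R : numFieldType) :
  row_free (\matrix_(s < m, j < t) (cls (T s) j)%:~R : 'M[R]_(m, t)).
Proof.
pose G : 'M[rat]_(m, t) := \matrix_(s < m, j < t) (cls (T s) j)%:~R.
have -> : \matrix_(s < m, j < t) (cls (T s) j)%:~R = map_mx (ratr : rat -> R) G.
  by apply/matrixP => s j; rewrite !mxE ratr_int.
suff : row_free G by rewrite /row_free mxrank_map.
rewrite -kermx_eq0; apply/eqP/row_matrixP => i; rewrite row0.
set z := row i _; have zG : z *m G = 0 by rewrite /z -row_mul mulmx_ker row0.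
pose D : int := \prod_s denq (z 0 s).
have D0 : D != 0 by apply/prodf_neq0 => s _; exact: denq_neq0.
have zD s : exists n : int, z 0 s * D%:~R = n%:~R.
  exists (numq (z 0 s) * \prod_(s' | s' != s) denq (z 0 s')).
  rewrite /D (bigD1 s) //= !intrM mulrA; congr (_ * _).
  by rewrite -{1}(divq_num_den (z 0 s)) divfK // intr_eq0 denq_neq0.
pose n s := sval (cid (zD s)).
have nE s : z 0 s * D%:~R = (n s)%:~R := svalP (cid (zD s)).
have n0 : forall s, n s = 0.
  apply: rigid_independent => j.
  have /(congr1 (fun v : 'rV_t => v 0 j * D%:~R)) := zG.
  rewrite !mxE mul0r mulr_suml => e; apply/eqP; rewrite -(intr_eq0 rat) -[X in _ == X]e.
  rewrite raddf_sum; apply/eqP; apply: eq_bigr => s _ /=.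
  by rewrite intrM -nE [G s j]mxE mulrAC.
apply/rowP => s; rewrite [RHS]mxE.
have /eqP := nE s; rewrite n0 mulf_eq0 intr_eq0 (negPf D0) orbF.
by move=> /eqP ->.
Qed.

Lemma rigid_card : (m <= t)%N.
Proof. by have := rigid_row_free rat; rewrite /row_free => /eqP <-; exact: rank_leq_col. Qed.

End Family.

(** * The Euler form of two arrows *)
(** Hom(f, g[-1]) = 0 in the homotopy category. *)
Definition neg_zero f g : Prop := forall u : lhom (atgt f) (asrc g),
  u ** amap f = 0 -> amap g ** u = 0 -> u = 0.

Definition euler_in f g (u : lhom (atgt f) (asrc g)) :
  lhom (atgt f) (atgt g) * lhom (asrc f) (asrc g) :=
  (amap g ** u, u ** amap f).

Definition euler_out f g (x : lhom (atgt f) (atgt g) * lhom (asrc f) (asrc g)) :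
  lhom (asrc f) (atgt g) := x.1 ** amap f - amap g ** x.2.

Fact euler_in_linear f g : linear (@euler_in f g).
Proof. by move=> c x y; congr pair; rewrite ?(lcompDr, lcompDl, lcompZr, lcompZl). Qed.

Fact euler_out_linear f g : linear (@euler_out f g).
Proof.
move=> c x y; rewrite /euler_out /= lcompDl lcompDr lcompZl lcompZr.
by rewrite scalerBr opprD addrACA.
Qed.

HB.instance Definition _ f g := GRing.isLinear.Build k _ _ *:%R
  (@euler_in f g) (@euler_in_linear f g).
HB.instance Definition _ f g := GRing.isLinear.Build k _ _ *:%R
  (@euler_out f g) (@euler_out_linear f g).

(** The groups Hom(f, g[i]), for i = -1, 0, 1, are the homology of the complex
    Hom(f0, g1) -> Hom(f0, g0) x Hom(f1, g1) -> Hom(f1, g0). Here [neg_zero]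
    is injectivity on the left, and [orth] is surjectivity on the right. *)
Lemma euler_aux f g : orth f g -> neg_zero f g ->
  let al := linfun (@euler_in f g) in let be := linfun (@euler_out f g) in
  [/\ \dim (limg al) = \dim {: lhom (atgt f) (asrc g)},
      (\dim (lker be) + \dim {: lhom (asrc f) (atgt g)} =
       \dim {: lhom (atgt f) (atgt g)} + \dim {: lhom (asrc f) (asrc g)})%N
    & (limg al <= lker be)%VS].
Proof.
move=> fg fg' al be.
have alE u : al u = (amap g ** u, u ** amap f) by rewrite lfunE.
have beE x : be x = x.1 ** amap f - amap g ** x.2 by rewrite lfunE.
split.
- have := limg_ker_dim al fullv.
  suff -> : (lker al = 0)%VS by rewrite capv0 dimv0.
  apply/eqP; rewrite -subv0; apply/subvP => u.
  by rewrite memv_ker memv0 alE => /eqP [e1 e2]; apply/eqP; apply: fg'.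
- have -> : (\dim {: lhom (atgt f) (atgt g)} + \dim {: lhom (asrc f) (asrc g)})%N =
      \dim {: (lhom (atgt f) (atgt g) * lhom (asrc f) (asrc g))%type}.
    by rewrite !dimvf.
  rewrite -(limg_ker_dim be fullv) capfv; congr (_ + \dim _)%N.
  apply/eqP; rewrite eqEsubv subvf andbT; apply/subvP => w _.
  have [a [b ->]] := fg w; have -> : a ** amap f + amap g ** b = be (a, - b).
    by rewrite beE /= lcompNr opprK.
  exact: memv_img (memvf _).
- apply/subvP => _ /memv_imgP [u _ ->].
  by rewrite memv_ker alE beE /= lcompA subrr.
Qed.

Lemma euler_dim f g : orth f g -> neg_zero f g ->
  (\dim {: lhom (atgt f) (asrc g)} + \dim {: lhom (asrc f) (atgt g)} <=
   \dim {: lhom (atgt f) (atgt g)} + \dim {: lhom (asrc f) (asrc g)})%N.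
Proof.
move=> fg fg'; have [e1 <- /dimvS] := euler_aux fg fg'; rewrite e1.
by rewrite leq_add2r.
Qed.

(** The identity of f is a cycle in the middle; if it were a boundary, f would
    be contractible. *)
Lemma euler_dim_strict f : orth f f -> neg_zero f f -> ~ contr f ->
  (\dim {: lhom (atgt f) (asrc f)} + \dim {: lhom (asrc f) (atgt f)} <
   \dim {: lhom (atgt f) (atgt f)} + \dim {: lhom (asrc f) (asrc f)})%N.
Proof.
move=> ff nf fc; have [e1 <- le] := euler_aux ff nf.
rewrite ltn_add2r -e1 ltnNge; apply/negP => le'; apply: fc.
have : (lid (atgt f), lid (asrc f)) \in lker (linfun (@euler_out f f)).
  by rewrite memv_ker lfunE /= /euler_out lcomp1l lcomp1r subrr.
have /eqP <- : limg (linfun (@euler_in f f)) == lker (linfun (@euler_out f f)).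
  by rewrite eqEdim le.
by move=> /memv_imgP [u _]; rewrite lfunE /= => -[e0 e0']; exists u.
Qed.

End Classes.

(** * Trace forms and the Nakayama twist *)
Section PerfectPairing.
Variables (k : fieldType) (V W : vectType k).

(** Each of V and W embeds into the dual of the other, so all four dimensions
    agree and the embeddings are onto. *)
Lemma perfect_pairing (B : 'Hom(V, 'Hom(W, k^o))) (B' : 'Hom(W, 'Hom(V, k^o))) :
  (forall v w, B' w v = B v w) ->
  (forall v, (forall w, B v w = 0) -> v = 0) ->
  (forall w, (forall v, B v w = 0) -> w = 0) ->
  forall F : 'Hom(W, k^o), exists v, F = B v.
Proof.
move=> BB' Bl Br.
have dimdual (U : vectType k) : \dim {: 'Hom(U, k^o)} = \dim {: U}.
  by rewrite !dimvf /dim /= muln1.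
have inj (U U' : vectType k) (f : 'Hom(U, 'Hom(U', k^o))) :
    (forall u, f u = 0 -> u = 0) -> \dim (limg f) = \dim {: U}.
  move=> f0; have := limg_ker_dim f fullv.
  suff -> : (lker f = 0)%VS by rewrite capv0 dimv0.
  apply/eqP; rewrite -subv0; apply/subvP => u.
  by rewrite memv_ker memv0 => /eqP /f0 ->.
have dB : \dim (limg B) = \dim {: V}.
  by apply: inj => v Bv; apply: Bl => w; rewrite Bv zero_lfunE.
have dB' : \dim (limg B') = \dim {: W}.
  by apply: inj => w Bw; apply: Br => v; rewrite -BB' Bw zero_lfunE.
have full : limg B = fullv.
  apply/eqP; rewrite eqEdim subvf dimdual dB -dB' -[\dim {: V}]dimdual.
  by rewrite dimvS ?subvf.
move=> F; have : F \in limg B by rewrite full memvf.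
by move=> /memv_imgP [v _ ->]; exists v.
Qed.

End PerfectPairing.

Section TraceForms.
Variables (k : fieldType) (L : lincat k).
Implicit Types X Y : L.

Definition perfect_form X (t : 'Hom(lhom X X, k^o)) : Prop :=
  (forall Y (g : lhom X Y), (forall f : lhom Y X, t (f ** g) = 0) -> g = 0) /\
  (forall Y (f : lhom Y X), (forall g : lhom X Y, t (f ** g) = 0) -> f = 0).

Definition comp_form X Y (t : 'Hom(lhom X X, k^o)) (g : lhom X Y) :
  'Hom(lhom Y X, k^o) := linfun (t \o rcomp g).

Definition comp_form' X Y (t : 'Hom(lhom X X, k^o)) (f : lhom Y X) :
  'Hom(lhom X Y, k^o) := linfun (t \o lcomp f).

Fact comp_form_linear X Y t : linear (@comp_form X Y t).
Proof.
move=> c x y; apply/lfunP => z.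
by rewrite add_lfunE scale_lfunE !lfunE /= /rcomp lcompDr lcompZr linearP.
Qed.

Fact comp_form'_linear X Y t : linear (@comp_form' X Y t).
Proof.
move=> c x y; apply/lfunP => z.
by rewrite add_lfunE scale_lfunE !lfunE /= lcompDl lcompZl linearP.
Qed.

HB.instance Definition _ X Y t := GRing.isLinear.Build k _ _ *:%R
  (@comp_form X Y t) (@comp_form_linear X Y t).
HB.instance Definition _ X Y t := GRing.isLinear.Build k _ _ *:%R
  (@comp_form' X Y t) (@comp_form'_linear X Y t).

Lemma form_repr_r X Y (t : 'Hom(lhom X X, k^o)) (F : 'Hom(lhom X Y, k^o)) :
  perfect_form t -> exists f : lhom Y X, forall g, F g = t (f ** g).
Proof.
move=> [tl tr].
have [|||f Ff] := @perfect_pairing k (lhom Y X) (lhom X Y)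
    (linfun (@comp_form' X Y t)) (linfun (@comp_form X Y t)) _ _ _ F.
- by move=> v w; rewrite !lfunE /= ?lfunE.
- by move=> v h; apply: tr => g; have := h g; rewrite !lfunE /= ?lfunE.
- by move=> w h; apply: tl => f; have := h f; rewrite !lfunE /= ?lfunE.
by exists f => g; rewrite Ff !lfunE.
Qed.

Lemma form_repr_l X Y (t : 'Hom(lhom X X, k^o)) (F : 'Hom(lhom Y X, k^o)) :
  perfect_form t -> exists g : lhom X Y, forall f, F f = t (f ** g).
Proof.
move=> [tl tr].
have [|||f Ff] := @perfect_pairing k (lhom X Y) (lhom Y X)
    (linfun (@comp_form X Y t)) (linfun (@comp_form' X Y t)) _ _ _ F.
- by move=> v w; rewrite !lfunE /= ?lfunE.
- by move=> v h; apply: tl => g; have := h g; rewrite !lfunE /= ?lfunE.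
- by move=> w h; apply: tr => g; have := h g; rewrite !lfunE /= ?lfunE.
by exists f => g; rewrite Ff !lfunE.
Qed.

End TraceForms.

Section Nakayama.
Variables (k : fieldType) (L : lincat k).
Implicit Types (X Y : L) (f g : arrow L).

(** The map y is the image of x under the Nakayama functor, which the trace
    forms identify with the identity on objects. *)
Lemma nakayama_twist X Y (tX : 'Hom(lhom X X, k^o)) (tY : 'Hom(lhom Y Y, k^o))
    (x : lhom X Y) : perfect_form tY ->
  exists y : lhom X Y, forall z : lhom Y X, tX (z ** x) = tY (y ** z).
Proof.
move=> tYn; have [y yP] := form_repr_r (comp_form tX x) tYn.
by exists y => z; rewrite -yP lfunE.
Qed.

Lemma nakayama_untwist X Y (tX : 'Hom(lhom X X, k^o)) (tY : 'Hom(lhom Y Y, k^o))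
    (y : lhom X Y) : perfect_form tX ->
  exists x : lhom X Y, forall z : lhom Y X, tX (z ** x) = tY (y ** z).
Proof.
move=> tXn; have [x xP] := form_repr_l (comp_form' tY y) tXn.
by exists x => z; rewrite -xP lfunE.
Qed.

Hypothesis kinf : infinite_field k.
Hypothesis forms : forall X : L, exists t : 'Hom(lhom X X, k^o), perfect_form t.

(** The Nakayama twist of g is rigid and has the same terms as g, hence
    [open_orbit] puts it in the orbit of g. Therefore Hom(f, g[-1]) is dual to
    Hom(g, f[1]), which vanishes: for h in the former, b h pairs under the
    trace form with maps w = a1 g + f b1, and both terms give zero. *)
Lemma rigid_neg_zero f g : orth g g -> orth g f -> neg_zero f g.
Proof.
move=> gg gf h hf gh.
have [t1 t1n] := forms (asrc g); have [t0 t0n] := forms (atgt g).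
have [ph phP] := nakayama_twist t1 (amap g) t0n.
have ph_rigid : orth (Arrow ph) (Arrow ph).
  move=> /= w; have [x xP] := nakayama_untwist t0 w t1n.
  have [a [b xab]] := gg x.
  have [a' a'P] := nakayama_twist t0 a t0n.
  have [b' b'P] := nakayama_twist t1 b t1n.
  exists a', b'; apply/eqP; rewrite -subr_eq0; apply/eqP; apply: (proj2 t0n) => z.
  have e1 : t0 (a' ** ph ** z) = t1 (z ** (a ** amap g)).
    by rewrite -lcompA -a'P -lcompA -phP lcompA.
  have e2 : t0 (ph ** b' ** z) = t1 (z ** (amap g ** b)).
    by rewrite -lcompA -phP -lcompA -b'P lcompA.
  by rewrite lcompBl lcompDl linearB linearD /= -xP xab lcompDr linearD /= e1 e2 subrr.
have gg' : orth (Arrow (amap g)) (Arrow (amap g)) by case: (g) gg.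
have [a [b [ai [c [cb bc]] ab]]] := open_orbit kinf gg' ph_rigid.
suff bh : b ** h = 0 by rewrite -[h]lcomp1l -cb -lcompA bh lcomp0r.
apply: (proj2 t1n) => w; have [a1 [b1 ->]] := gf w.
have e1 : t1 (b ** h ** (a1 ** amap g)) = 0.
  by rewrite lcompA phP !lcompA -ab -[a ** _ ** h]lcompA gh lcomp0r lcomp0l linear0.
have e2 : b ** h ** (amap f ** b1) = 0.
  by rewrite lcompA -[b ** h ** _]lcompA hf lcomp0r lcomp0l.
by rewrite lcompDr linearD /= e1 e2 linear0 addr0.
Qed.

End Nakayama.

(** * Generation and co-Bongartz completion *)
Section Generation.
Variables (k : fieldType) (L : lincat k).
Implicit Types f g h : arrow L.

(** For arrows between projectives, this says that x is surjective on
    cokernels. The formulation by arbitrary Z makes sense in any linear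
    category. *)
Definition epi_arrow f g (x : sqhom f g) : Prop :=
  forall (Z : L) (w : lhom Z (atgt g)), exists u v, w = am0 x ** u + amap g ** v.

Lemma epi_arrow_comp f g h (y : sqhom g h) (x : sqhom f g) :
  epi_arrow y -> epi_arrow x -> epi_arrow (arrow_comp y x).
Proof.
move=> ye xe Z w; have [u [v ->]] := ye Z w; have [u' [v' ->]] := xe Z u.
exists u', (am1 y ** v' + v).
by rewrite !lcompDr !lcompA amE addrA.
Qed.

Lemma epi_arrow_retract f g (i : sqhom f g) (p : sqhom g f) :
  arrow_comp p i = arrow_id f -> epi_arrow p.
Proof.
move=> pi Z w; exists (am0 i ** w), 0.
by rewrite lcomp0r addr0 lcompA (congr1 (@am0 _ _ _ _) pi : am0 p ** am0 i = lid _) lcomp1l.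
Qed.

(** For arrows between projectives, this says that the cokernel of g is a
    factor module of a sum of cokernels of the T s. *)
Definition generates m (T : 'I_m -> arrow L) g : Prop :=
  exists n (phi : 'I_n -> 'I_m) B (x : sqhom B g),
    dsum (L := arrl L) (fun i => T (phi i)) B /\ epi_arrow x.

Lemma generates_epi m (T : 'I_m -> arrow L) f g (x : sqhom f g) :
  epi_arrow x -> generates T f -> generates T g.
Proof.
move=> xe [n [phi [B [y [hB ye]]]]]; exists n, phi, B, (arrow_comp x y); split=> //.
exact: epi_arrow_comp.
Qed.

Lemma generates_self m (T : 'I_m -> arrow L) s : generates T (T s).
Proof.
exists 1%N, (fun _ => s), (T s), (arrow_id (T s)); split; last first.
  apply: (@epi_arrow_retract _ _ (arrow_id _)); exact: acomp1l.
apply: (dsum_reindex (h := fun _ : 'I_1 => tt)) (dsum_unit (L := arrl L) (T s)) => //.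
by exists (fun _ => ord0); [move=> i; rewrite (ord1 i) (ord1 ord0)|case].
Qed.

Lemma generates_trans m r (T : 'I_m -> arrow L) (V : 'I_r -> arrow L) g :
  (forall s, generates V (T s)) -> generates T g -> generates V g.
Proof.
move=> VT [n [phi [B [x [hB xe]]]]].
apply: (generates_epi xe).
pose q i := sval (cid (VT (phi i))).
pose psi i : 'I_(q i) -> 'I_r := sval (cid (svalP (cid (VT (phi i))))).
pose C i : arrow L := sval (cid (svalP (cid (svalP (cid (VT (phi i))))))).
pose y i : sqhom (C i) (T (phi i)) :=
  sval (cid (svalP (cid (svalP (cid (svalP (cid (VT (phi i))))))))).
have hy i : dsum (L := arrl L) (fun l => V (psi i l)) (C i) /\ epi_arrow (y i).
  exact: (svalP (cid (svalP (cid (svalP (cid (svalP (cid (VT (phi i)))))))))).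
have [D hD] := dsum_exists (L := arrl L) C.
have hDV := dsum_flatten (L := arrl L) (fun i => (hy i).1) hD.
case: hB => inj [prj [h1 h2 h3]]; case: hD => inj' [prj' [g1 g2 g3]].
pose I : finType := {i : 'I_n & 'I_(q i)}.
exists #|I|, (fun j => let s : I := enum_val j in psi (tag s) (tagged s)), D.
pose z : sqhom D B :=
  \sum_i arrow_comp (arrow_comp (inj i) (y i)) (prj' i).
exists z; split.
  by apply: dsum_reindex hDV => //; exact: enum_val_bij.
move=> Z w.
have hu i : {uv | am0 (prj i) ** w = am0 (y i) ** uv.1 + amap (T (phi i)) ** uv.2}.
  apply: cid; have [u [v ->]] := (hy i).2 Z (am0 (prj i) ** w).
  by exists (u, v).
pose u i := (sval (hu i)).1; pose v i := (sval (hu i)).2.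
have uv i : am0 (prj i) ** w = am0 (y i) ** u i + amap (T (phi i)) ** v i := svalP (hu i).
exists (\sum_i am0 (inj' i) ** u i), (\sum_i am1 (inj i) ** v i).
have prj'E i j : am0 (prj' j) ** am0 (inj' i) = am0 (prj' j ** inj' i) by [].
have -> : am0 z ** (\sum_i am0 (inj' i) ** u i) = \sum_i am0 (inj i) ** (am0 (y i) ** u i).
  rewrite /z am0_sum lcomp_suml; apply: eq_bigr => i _.
  rewrite lcomp_sumr (bigD1 i) //= big1 ?addr0 => [|j ji].
    rewrite lcompA -[am0 _]/(am0 (inj i) ** am0 (y i) ** am0 (prj' i)).
    by rewrite -[_ ** am0 (prj' i) ** _]lcompA prj'E g1 lcomp1r lcompA.
  rewrite lcompA -[am0 _]/(am0 (inj i) ** am0 (y i) ** am0 (prj' i)).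
  by rewrite -[_ ** am0 (prj' i) ** _]lcompA prj'E g2 // am0_0 lcomp0r lcomp0l.
rewrite lcomp_sumr -big_split /= -[LHS]lcomp1l.
have -> : lid (atgt B) = \sum_i am0 (inj i) ** am0 (prj i).
  by rewrite -[LHS](congr1 (@am0 _ _ _ _) h3) am0_sum.
rewrite lcomp_suml; apply: eq_bigr => i _.
by rewrite -lcompA uv lcompDr !lcompA amE.
Qed.

(** A map of arrows that is surjective on cokernels induces a surjection on
    Hom(g, -[1]). *)
Lemma orth_generates m (T : 'I_m -> arrow L) g h :
  (forall s, orth g (T s)) -> generates T h -> orth g h.
Proof.
move=> gT [n [phi [B [x [hB xe]]]]] w.
have [u [v ->]] := xe _ w.
have gB : orth g B by apply: (orth_dsum_r hB).
have [a [b ->]] := gB u; exists (am0 x ** a), (am1 x ** b + v).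
by rewrite !lcompDr !lcompA amE addrA.
Qed.

End Generation.

Section CoBongartz.
Variables (k : fieldType) (L : lincat k).
Implicit Types f g h : arrow L.

(** The arrow Y is the cocone of the universal map from P to sums of members
    of V. Every map from P to the target of V s factors through the universal
    one, and this makes Y orthogonal to V s. *)
Lemma co_bongartz r (V : 'I_r -> arrow L) (P : L) :
  (forall s s', orth (V s) (V s')) ->
  exists (n : 'I_r -> nat) (B Y : arrow L),
  [/\ dsum (L := arrl L) (@power_family _ _ _ V n) B,
      forall g, orth g B -> orth g Y,
      forall s, orth Y (V s),
      exists x : sqhom B Y, epi_arrow x
    & atgt Y = atgt B /\ is_dsum2 (C := cat_of L) P (asrc B) (asrc Y)].
Proof.
move=> VV; pose n s := \dim {: lhom P (atgt (V s))}; exists n.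
have [B hB] := dsum_exists (L := arrl L) (@power_family _ _ _ V n).
have [inj [prj [h1 h2 h3]]] := hB.
pose e s (i : 'I_(n s)) : lhom P (atgt (V s)) := (vbasis {: lhom P (atgt (V s))})`_i.
pose beta : lhom P (atgt B) := \sum_j am0 (inj j) ** e (tag j) (tagged j).
have univ s (w : lhom P (atgt (V s))) : exists x : sqhom B (V s), w = am0 x ** beta.
  pose c i := coord (vbasis {: lhom P (atgt (V s))}) i w.
  pose pj (i : 'I_(n s)) : sqhom B (V s) := prj (existT (fun s => 'I_(n s)) s i).
  pose x : sqhom B (V s) := \sum_i c i *: pj i.
  exists x; rewrite {1}(coord_vbasis (memvf w)) /x am0_sum lcomp_suml.
  apply: eq_bigr => i _; rewrite /am0 linearZ /= lcompZl; congr (_ *: _).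
  set j0 : {s : 'I_r & 'I_(n s)} := existT _ s i.
  rewrite /beta lcomp_sumr (bigD1 j0) //= big1 ?addr0 => [|j jj0].
    have := congr1 (@am0 _ _ _ _) (h1 j0); rewrite {1}/am0 /= => ee.
    by rewrite lcompA -[_ ** _ ** _]/(am0 (prj j0 ** inj j0) ** _) h1 lcomp1l.
  by rewrite lcompA -[_ ** _ ** _]/(am0 (prj j0 ** inj j) ** _) h2 // am0_0 lcomp0l.
have [Q [i1 [i2 [p1 [p2 [k1 k2 k3]]]]]] := lbiprod P (asrc B).
have [k12 k21] := dsum2_orth k1 k2 k3.
pose Y := Arrow (beta ** p1 + amap B ** p2).
have Y1 : amap Y ** i1 = beta by rewrite /= lcompDl -!lcompA k1 k21 lcomp0r addr0 lcomp1r.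
have Y2 : amap Y ** i2 = amap B by rewrite /= lcompDl -!lcompA k2 k12 lcomp0r add0r lcomp1r.
exists B, Y; split=> //.
- move=> g gB w; have [a [b ->]] := gB w; exists a, (i2 ** b).
  by rewrite lcompA Y2.
- move=> s w.
  have BV : orth B (V s) by apply: (orth_dsum_l hB) => j; exact: VV.
  have [a [b ab]] := BV (w ** i2).
  have [x xP] := univ s (w ** i1 - a ** beta).
  have [a' [b' [e1 e2]]] : exists a' b', w ** i1 = a' ** beta /\
      w ** i2 = a' ** amap B + amap (V s) ** b'.
    exists (a + am0 x), (b - am1 x); split; first by rewrite lcompDl -xP addrC subrK.
    by rewrite ab lcompDl lcompBr amE -addrA [X in _ = _ + X]addrC subrK.
  exists a', (b' ** p2); rewrite -[LHS]lcomp1r -k3 lcompDr !lcompA e1 e2 /=.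
  by rewrite lcompDl lcompDr !lcompA addrA.
- have e0 : lid (atgt B) ** amap B = amap Y ** i2 by rewrite lcomp1l Y2.
  exists (@mk_sq _ _ B Y i2 (lid _) e0) => Z w.
  by exists w, 0; rewrite lcomp0r addr0 lcomp1l.
- by split=> //; exact: (dsum2 k1 k2 k3).
Qed.

End CoBongartz.

Section Completion.
Variables (k : fieldType) (L : lincat k).
Implicit Types f g h : arrow L.
Hypothesis kinf : infinite_field k.
Variables (t : nat) (mu : L -> 'I_t -> nat).
Hypothesis mu_dsum : forall (I : finType) (Y : I -> L) X j,
  dsum Y X -> mu X j = (\sum_i mu (Y i) j)%N.
Hypothesis mu_isom : forall X Y : L, (forall j, mu X j = mu Y j) -> isom X Y.
Variable P : 'I_t -> L.
Hypothesis mu_P : forall i j, mu (P i) j = (i == j).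

Notation cls := (cls mu).

Lemma rigid_extend m (T : 'I_m -> arrow L) Z : rigid_family T ->
  indec (L := arrl L) Z -> ~ contr Z -> orth Z Z ->
  (forall s, orth Z (T s) /\ orth (T s) Z) ->
  (forall s, ~ isom (L := arrl L) Z (T s)) ->
  rigid_family (fun i : 'I_m.+1 => if unlift ord0 i is Some s then T s else Z).
Proof.
move=> [T1 T2 T3 T4] Zi Zc ZZ ZT ZnT; split.
- move=> i j; case: (unliftP ord0 i) => [i' _|_]; case: (unliftP ord0 j) => [j' _|_] //.
  + by case: (ZT i').
  + by case: (ZT j').
- by move=> i; case: (unliftP ord0 i).
- by move=> i; case: (unliftP ord0 i).
- move=> i j; case: (unliftP ord0 i) => [i' ->|->]; case: (unliftP ord0 j) => [j' ->|->] //.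
  + by move/T4 ->.
  + by move/isom_sym/ZnT.
  + by move/ZnT.
Qed.

(** In the Grothendieck group [Q] = [B] - [Y], where B is a sum of members of
    V and Y a sum of members of T. So a member of T outside V occurs only with
    a negative sign. *)
Lemma coordinates_of_completion r m (V : 'I_r -> arrow L) (T : 'I_m -> arrow L)
    (iota : 'I_r -> 'I_m) (n : 'I_r -> nat) (B Y : arrow L) (Q : L) :
  (forall s, T (iota s) = V s) ->
  dsum (L := arrl L) (@power_family _ _ _ V n) B ->
  atgt Y = atgt B -> is_dsum2 (C := cat_of L) Q (asrc B) (asrc Y) ->
  (forall Z, indec (L := arrl L) Z -> ~ contr Z -> retract (L := arrl L) Z Y ->
     exists s, isom (L := arrl L) Z (T s)) ->
  exists y : 'I_m -> int,
    (forall j, (mu Q j)%:Z = \sum_s y s * cls (T s) j) /\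
    (forall s, (forall s', iota s' != s) -> y s <= 0).
Proof.
move=> Tiota hB YB QBY max.
have [q [W [Wi hW]]] := krull_schmidt (L := arrl L) Y.
have hf l : exists o : option 'I_m,
    forall j, cls (W l) j = \sum_s (o == Some s)%:Z * cls (T s) j.
  case: (pselect (contr (W l))) => [c|nc].
    exists None => j; rewrite (cls_contr mu_dsum j c).
    by rewrite big1 // => s _; rewrite mul0r.
  have [s Ws] := max (W l) (Wi l) nc (dsum_inj_retract l hW).
  exists (Some s) => j; rewrite (cls_isom mu_dsum j Ws).
  rewrite (bigD1 s) //= eqxx mul1r big1 ?addr0 // => s' s's.
  by rewrite (_ : Some s == Some s' = false) ?mul0r //; apply/eqP => -[e]; rewrite e eqxx in s's.
pose o l := sval (cid (hf l)).
have oP l j : cls (W l) j = \sum_s (o l == Some s)%:Z * cls (T s) j := svalP (cid (hf l)) j.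
exists (fun s => \sum_s' (iota s' == s)%:Z * (n s')%:Z - \sum_l (o l == Some s)%:Z).
split; last first.
  move=> s hs; rewrite big1 ?add0r ?oppr_le0 ?sumr_ge0 // => s' _.
  by rewrite (negPf (hs s')) mul0r.
move=> j.
have clsY : cls Y j = \sum_s (\sum_l (o l == Some s)%:Z) * cls (T s) j.
  rewrite (cls_dsum mu_dsum j hW) (eq_bigr _ (fun l _ => oP l j)) exchange_big /=.
  by apply: eq_bigr => s _; rewrite mulr_suml.
have clsB : cls B j = \sum_s (\sum_s' (iota s' == s)%:Z * (n s')%:Z) * cls (T s) j.
  rewrite (cls_power mu_dsum j hB).
  under [RHS]eq_bigr do rewrite mulr_suml.
  rewrite exchange_big /=; apply: eq_bigr => s' _.
  rewrite (bigD1 (iota s')) //= eqxx mul1r Tiota big1 ?addr0 // => s hs.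
  by rewrite eq_sym (negPf hs) !mul0r.
under eq_bigr do rewrite mulrBl.
rewrite sumrB -clsY -clsB /cls YB.
have -> : mu (asrc Y) j = (mu Q j + mu (asrc B) j)%N.
  by rewrite (mu_dsum j QBY) big_bool.
lia.
Qed.

Lemma maximal_nat (Q : nat -> Prop) b m : Q m -> (forall n, Q n -> (n <= b)%N) ->
  exists n, Q n /\ ~ Q n.+1.
Proof.
move=> Qm Qb; have [d] := ubnP (b - m); elim: d m Qm => // d IH m Qm hd.
case: (pselect (Q m.+1)) => [Qm1|]; last by exists m.
by apply: (IH m.+1) => //; have := Qb _ Qm1; lia.
Qed.

Section Subfamily.
Variables (r : nat) (V : 'I_r -> arrow L).
Hypothesis HV : rigid_family V.

Let VV s s' : orth (V s) (V s'). Proof. by case: HV. Qed.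

Let co j := cid (co_bongartz (P j) VV).
Let coB j := cid (svalP (co j)).
Let coY j := cid (svalP (coB j)).
Let Y j : arrow L := sval (coY j).

Lemma co_bongartz_orth j g : (forall s, orth g (V s)) -> orth g (Y j).
Proof.
have [hB h _ _ _] := svalP (coY j).
by move=> gV; apply: h; apply: (orth_dsum_r hB) => i; apply: gV.
Qed.

Lemma co_bongartz_orth_gen j g : generates V g -> orth (Y j) g.
Proof.
by have [_ _ h _ _] := svalP (coY j) => Vg; apply: (orth_generates (T := V)).
Qed.

Lemma co_bongartz_generated j : generates V (Y j).
Proof.
have [hB _ _ [x xe] _] := svalP (coY j).
apply: (generates_epi xe).
set n := sval (co j) in hB.
exists #|{: {s : 'I_r & 'I_(n s)}}|, (fun i => tag (enum_val i)), (sval (coB j)).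
exists (arrow_id _); split; last first.
  by apply: (@epi_arrow_retract _ _ _ _ (arrow_id _)); exact: acomp1l.
by apply: dsum_reindex hB => //; exact: enum_val_bij.
Qed.

Lemma retract_generated f g : retract (L := arrl L) f g -> generates V g -> generates V f.
Proof. by move=> [i [p pi]]; apply: generates_epi; exact: (epi_arrow_retract pi). Qed.

Lemma co_bongartz_coord m (T : 'I_m -> arrow L) (iota : 'I_r -> 'I_m) :
  (forall s, T (iota s) = V s) ->
  (forall j Z, indec (L := arrl L) Z -> ~ contr Z -> retract (L := arrl L) Z (Y j) ->
     exists s, isom (L := arrl L) Z (T s)) ->
  exists y : 'I_t -> 'I_m -> int,
    (forall i j, (i == j)%:Z = \sum_s y i s * cls (T s) j) /\
    (forall i s, (forall s', iota s' != s) -> y i s <= 0).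
Proof.
move=> Tiota max.
have h i : exists y : 'I_m -> int,
    (forall j, (mu (P i) j)%:Z = \sum_s y s * cls (T s) j) /\
    (forall s, (forall s', iota s' != s) -> y s <= 0).
  have [hB _ _ _ [YB QBY]] := svalP (coY i).
  exact: (coordinates_of_completion Tiota hB YB QBY (max i)).
exists (fun i => sval (cid (h i))); split=> i.
  by move=> j; rewrite -(svalP (cid (h i))).1 mu_P.
exact: (svalP (cid (h i))).2.
Qed.

Lemma ones_coord m (T : 'I_m -> arrow L) (iota : 'I_r -> 'I_m)
    (y : 'I_t -> 'I_m -> int) :
  (forall i j, (i == j)%:Z = \sum_s y i s * cls (T s) j) ->
  (forall i s, (forall s', iota s' != s) -> y i s <= 0) ->
  (forall j, \sum_s (\sum_i y i s) * cls (T s) j = 1) /\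
  (forall s, (forall s', iota s' != s) -> \sum_i y i s <= 0).
Proof.
move=> y1 y2; split=> [j|s hs].
  under eq_bigr do rewrite mulr_suml.
  rewrite exchange_big /=; under eq_bigr do rewrite -y1.
  by rewrite (bigD1 j) //= eqxx big1 ?addr0 // => i /negPf ->.
by apply: sumr_le0 => i _; apply: y2.
Qed.

(** A rigid family T generated by V is orthogonal in both directions to the
    co-Bongartz arrows of V. Since T has already the largest possible number t
    of members, the indecomposable summands of these arrows belong to T. *)
Lemma generated_coord (T : 'I_t -> arrow L) (iota : 'I_r -> 'I_t) :
  rigid_family T -> (forall s, T (iota s) = V s) ->
  (forall s, generates V (T s)) ->
  exists y : 'I_t -> int, (forall j, \sum_s y s * cls (T s) j = 1) /\
    (forall s, (forall s', iota s' != s) -> y s <= 0).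
Proof.
move=> HT Tiota VT; have [T1 _ _ _] := HT.
have [j Z Zi Zc ZY|y [y1 y2]] := co_bongartz_coord Tiota.
  apply: contrapT => nZ.
  have TY s : orth (T s) (Y j).
    by apply: co_bongartz_orth => s'; rewrite -Tiota; exact: T1.
  have YT s : orth (Y j) (T s) by apply: co_bongartz_orth_gen.
  have ZZ : orth Z Z.
    apply: (orth_retract_l ZY); apply: (orth_retract_r ZY).
    exact: (co_bongartz_orth_gen (co_bongartz_generated j)).
  have := rigid_extend HT Zi Zc ZZ.
  case=> [s|s e|]; first by split; [apply: (orth_retract_l ZY)|apply: (orth_retract_r ZY)].
    by apply: nZ; exists s.
  move=> a b c d; have := rigid_card kinf mu_dsum mu_isom (And4 a b c d).
  by rewrite ltnn.
by exists (fun s => \sum_i y i s); apply: ones_coord.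
Qed.

(** A maximal rigid family formed by the V s and by summands of their
    co-Bongartz arrows. By [co_bongartz_coord] its classes span, so it has t
    members. *)
Lemma completion : exists (T : 'I_t -> arrow L) (iota : 'I_r -> 'I_t),
  [/\ rigid_family T, forall s, T (iota s) = V s, forall s, generates V (T s)
    & exists y : 'I_t -> int, (forall j, \sum_s y s * cls (T s) j = 1) /\
      (forall s, (forall s', iota s' != s) -> y s <= 0)].
Proof.
pose D f := (exists s, f = V s) \/ (exists j, retract (L := arrl L) f (Y j)).
have DV f : D f -> generates V f.
  case=> [[s ->]|[j fY]]; first exact: generates_self.
  exact: (retract_generated fY (co_bongartz_generated j)).
have VD f s : D f -> orth (V s) f.
  case=> [[s' ->]|[j fY]] //; apply: (orth_retract_r fY).
  by apply: co_bongartz_orth => s'.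
have DD f g : D f -> D g -> orth f g.
  case=> [[s ->]|[j fY]] Dg; first exact: VD.
  by apply: (orth_retract_l fY); apply: co_bongartz_orth_gen; apply: DV.
pose Q m := exists (T : 'I_m -> arrow L) (iota : 'I_r -> 'I_m),
  [/\ rigid_family T, forall s, T (iota s) = V s & forall s, D (T s)].
have Qr : Q r by exists V, id; split=> // s; left; exists s.
have Qt m : Q m -> (m <= t)%N.
  by move=> [T [_ [HT _ _]]]; exact: (rigid_card kinf mu_dsum mu_isom HT).
have [m [[T [iota [HT Tiota DT]]] nQ]] := maximal_nat Qr Qt.
have [j Z Zi Zc ZY|y [y1 y2]] := co_bongartz_coord Tiota.
  apply: contrapT => nZ; apply: nQ.
  have DZ : D Z by right; exists j.
  exists (fun i : 'I_m.+1 => if unlift ord0 i is Some s then T s else Z).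
  exists (fun s => lift ord0 (iota s)); split.
  - apply: rigid_extend => //; first exact: DD.
      by move=> s; split; apply: DD.
    by move=> s e; apply: nZ; exists s.
  - by move=> s; rewrite liftK.
  - by move=> i; case: (unliftP ord0 i).
have tm : (t <= m)%N.
  pose N : 'M[rat]_(t, m) := \matrix_(i, s) (y i s)%:~R.
  pose G : 'M[rat]_(m, t) := \matrix_(s, j) (cls (T s) j)%:~R.
  have NG : N *m G = 1%:M.
    apply/matrixP => i j; rewrite !mxE -[RHS]/(((i == j)%:Z)%:~R) y1.
    by rewrite raddf_sum; apply: eq_bigr => s _ /=; rewrite !mxE intrM.
  have := mulmx_max_rank N G; rewrite NG mxrank1; exact.
have e : m = t by apply/eqP; rewrite eqn_leq tm andbT Qt //; exists T, iota.
subst m; exists T, iota; split=> //; first by move=> s; apply: DV.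
by exists (fun s => \sum_i y i s); apply: ones_coord.
Qed.

End Subfamily.
End Completion.

(** * Walking through the cones of rigid families *)
Section Walk.
Variables (k : fieldType) (L : lincat k).
Implicit Types f g h : arrow L.
Hypothesis kinf : infinite_field k.
Variables (t : nat) (mu : L -> 'I_t -> nat).
Hypothesis mu_dsum : forall (I : finType) (Y : I -> L) X j,
  dsum Y X -> mu X j = (\sum_i mu (Y i) j)%N.
Hypothesis mu_isom : forall X Y : L, (forall j, mu X j = mu Y j) -> isom X Y.
Variable P : 'I_t -> L.
Hypothesis mu_P : forall i j, mu (P i) j = (i == j).

Notation cls := (cls mu).

Lemma rigid_sub m r (T : 'I_m -> arrow L) (iota : 'I_r -> 'I_m) :
  injective iota -> rigid_family T -> rigid_family (fun s => T (iota s)).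
Proof.
move=> ij [h1 h2 h3 h4]; split=> [s s'|s|s|s s' e].
- exact: h1.
- exact: h2.
- exact: h3.
- by apply: ij; apply: h4.
Qed.

(** Finiteness of the number of support tau-tilting modules, in terms of
    presentations R0 i of finitely many modules: the cokernel of some R0 i is
    a factor module of a sum of cokernels of the T s, and has each of these as
    a factor module. *)
Definition finitely_many_factors : Prop :=
  exists n (R0 : 'I_n -> arrow L), forall T : 'I_t -> arrow L, rigid_family T ->
    exists i, generates T (R0 i) /\
      forall s, exists x : sqhom (R0 i) (T s), epi_arrow x.

Variable R : realFieldType.

Definition in_cone (T : 'I_t -> arrow L) (v : 'I_t -> R) : Prop :=
  exists a : 'I_t -> R, (forall s, 0 <= a s) /\
    (forall j, v j = \sum_s a s * (cls (T s) j)%:~R).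

Section Step.
Variable v : 'I_t -> R.

(** The point v + lam (1, ..., 1) lies in the cone of T, with coordinates c,
    and does not leave it at once when lam decreases: y are the coordinates of
    (1, ..., 1), and a coordinate that vanishes must not decrease further. *)
Definition walk_state (T : 'I_t -> arrow L) (lam : R) : Prop :=
  exists (c : 'I_t -> R) (y : 'I_t -> int),
  [/\ forall j, v j + lam = \sum_s c s * (cls (T s) j)%:~R,
      forall j, \sum_s y s * cls (T s) j = 1,
      forall s, 0 <= c s & forall s, c s = 0 -> y s <= 0].

(** Let the point move until a coordinate s0 vanishes, keep the members whose
    coordinates are still positive, and complete them by [completion]. The new
    family generates less than T: otherwise [generated_coord] would give y s0
    <= 0, whereas the coordinate s0 was decreasing. *)
Lemma walk_step (T : 'I_t -> arrow L) lam :
  rigid_family T -> 0 <= lam -> walk_state T lam ->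
  in_cone T v \/
  exists (T' : 'I_t -> arrow L) lam', [/\ rigid_family T', 0 <= lam',
    walk_state T' lam', forall g, generates T' g -> generates T g
    & ~ (forall s, generates T' (T s))].
Proof.
move=> HT lam0 [c [y [cE y1 c0 cy]]].
pose x s := c s - lam * (y s)%:~R.
have y1R j : \sum_s (y s)%:~R * (cls (T s) j)%:~R = 1 :> R.
  rewrite -[RHS]/(1%:~R) -(y1 j) raddf_sum; apply: eq_bigr => s _ /=.
  by rewrite intrM.
have xE l j : v j + l = \sum_s (x s + l * (y s)%:~R) * (cls (T s) j)%:~R.
  have -> : v j + l = v j + lam + (l - lam) * 1 by rewrite mulr1; ring.
  rewrite cE -[X in (l - lam) * X](y1R j) mulr_sumr -big_split /=; apply: eq_bigr => s _.
  by rewrite /x; ring.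
case: (pselect (forall s, 0 <= x s)) => [x0|].
  left; exists x; split=> // j; rewrite -[LHS]addr0 xE.
  by apply: eq_bigr => s _; rewrite mul0r addr0.
move=> nx; right.
have [s1 xs1] : exists s, x s < 0.
  apply: contrapT => h; apply: nx => s; rewrite leNgt; apply/negP => xs.
  by apply: h; exists s.
have ypos s : x s < 0 -> 0 < y s.
  move=> xs; have cs : c s != 0.
    apply/eqP => cs; move: xs; rewrite /x cs sub0r oppr_lt0 ltNge => /negP; apply.
    by rewrite mulr_ge0_le0 // lerz0 cy.
  have cs0 : 0 < c s by rewrite lt_neqAle eq_sym cs c0.
  rewrite ltNge; apply/negP => ys; move: xs; rewrite /x ltNge => /negP; apply.
  rewrite subr_ge0 (le_trans _ (c0 s)) //.
  by rewrite mulr_ge0_le0 // lerz0.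
case: (@Order.TotalTheory.arg_maxP _ R 'I_t s1 (fun s => x s < 0) (fun s => - x s / (y s)%:~R) xs1) => s0 xs0 smax.
(* the value of lam at the first wall that the point meets *)
pose lam' := - x s0 / (y s0)%:~R.
have ys0 : 0 < (y s0)%:~R :> R by rewrite ltr0z ypos.
have lam'0 : 0 <= lam' by rewrite divr_ge0 ?ltW // oppr_gt0.
have lam'le : lam' <= lam.
  rewrite ler_pdivrMr // lerNl -subr_ge0 opprK.
  by have := c0 s0; rewrite /x; lra.
pose c' s := x s + lam' * (y s)%:~R.
have c'0 s : 0 <= c' s.
  case: (ltP (x s) 0) => [xs|xs].
    have ys : 0 < (y s)%:~R :> R by rewrite ltr0z ypos.
    have := smax s xs; rewrite -/lam' => h; rewrite /c' -lerBlDl sub0r.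
    by rewrite -ler_pdivrMr.
  case: (leP 0 (y s)) => ys; rewrite /c'.
    by apply: addr_ge0 => //; apply: mulr_ge0 => //; rewrite ler0z.
  have := c0 s; rewrite /x => cs.
  have : lam * (y s)%:~R <= lam' * (y s)%:~R.
    by apply: ler_wnM2r => //; rewrite lerz0 ltW.
  lra.
have c's0 : c' s0 = 0.
  by rewrite /c' /lam' mulrAC -mulrA mulfV ?gt_eqF // mulr1 subrr.
pose U := [set s | c' s != 0].
pose V (i : 'I_#|U|) := T (enum_val i).
have HV : rigid_family V by apply: rigid_sub HT; exact: enum_val_inj.
have [T' [iota [HT' iotaV VT' [y' [y'1 y'2]]]]] :=
  completion kinf mu_dsum mu_isom mu_P HV.
have VT g : generates V g -> generates T g.
  by apply: generates_trans => s; exact: generates_self.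
have iota_inj : injective iota.
  move=> i i' e; have [_ _ _ V4] := HV; apply: V4.
  by rewrite -!iotaV e; exact: isom_refl.
exists T', lam'; split=> //; last first.
- move=> T'T.
  have [||y2 [y21 y22]] := generated_coord kinf mu_dsum mu_isom mu_P HV
    (T := T) (iota := enum_val) HT.
  + by [].
  + by move=> s; apply: generates_trans (T'T s).
  have yy2 : y s0 = y2 s0.
    apply/eqP; rewrite -subr_eq0; apply/eqP.
    apply: (rigid_independent kinf mu_dsum mu_isom HT (z := fun s => y s - y2 s)) => j.
    by under eq_bigr do rewrite mulrBl; rewrite sumrB y1 y21 subrr.
  have : y2 s0 <= 0.
    apply: y22 => i; apply/eqP => e.
    by have := enum_valP i; rewrite e inE c's0 eqxx.
  by rewrite -yy2 leNgt ypos.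
- by move=> g /(generates_trans VT') /VT.
exists (fun s => \sum_(i | iota i == s) c' (enum_val i)), y'; split=> //.
- move=> j; rewrite xE (bigID (mem U)) /= [X in _ + X]big1 ?addr0; last first.
    by move=> s; rewrite inE negbK -/(c' s) => /eqP ->; rewrite mul0r.
  rewrite big_enum_val /=.
  under [RHS]eq_bigr do rewrite mulr_suml.
  rewrite [RHS](exchange_big_dep xpredT) //=; apply: eq_bigr => i _.
  by rewrite (big_pred1 (iota i)) ?iotaV // => s; rewrite eq_sym.
- by move=> s; apply: sumr_ge0.
move=> s; case: (pselect (exists i, iota i = s)) => [[i <-]|h _].
  rewrite (big_pred1 i) => [e|i']; last by rewrite (inj_eq iota_inj).
  by have := enum_valP i; rewrite inE e eqxx.
by apply: y'2 => i; apply/eqP => e; apply: h; exists i.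
Qed.

(** Each step loses one of the finitely many R0 i among the generated arrows.
    *)
Lemma walk (T : 'I_t -> arrow L) lam : finitely_many_factors ->
  rigid_family T -> 0 <= lam -> walk_state T lam ->
  exists T' : 'I_t -> arrow L, rigid_family T' /\ in_cone T' v.
Proof.
move=> [n [R0 fin]].
pose rank (T : 'I_t -> arrow L) := #|[set i | `[< generates T (R0 i) >]]|.
have [d] := ubnP (rank T); elim: d T lam => // d IH T lam hd HT lam0 st.
have [|[T' [lam' [HT' lam'0 st' sub nsub]]]] := walk_step HT lam0 st.
  by move=> vT; exists T.
apply: (IH T' lam') => //; rewrite ltnS in hd; apply: leq_trans hd.
apply: proper_card; apply/properP; split.
  by apply/fintype.subsetP => i; rewrite !finset.in_set => /asboolP h; apply/asboolP; exact: sub.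
have [i [Ti iT]] := fin T HT; exists i; first by rewrite finset.in_set; apply/asboolP.
apply/negP; rewrite finset.in_set => /asboolP h; apply: nsub => s; have [x xe] := iT s.
exact: (generates_epi xe h).
Qed.

End Step.

Lemma mu_zero Z j : lid Z = 0 -> mu Z j = 0%N.
Proof.
move=> Z0; rewrite (@mu_dsum void (fun _ => Z) Z).
  by rewrite big1 // => -[].
exists (fun _ => 0), (fun _ => 0).
by split=> [[]|[]|]; rewrite Z0 big1 // => -[].
Qed.

Hypothesis P_indec : forall i, indec (P i).

(** The family of the arrows 0 -> P i, whose cone is the positive orthant. *)
Lemma initial_family : exists T : 'I_t -> arrow L, rigid_family T /\
  forall i j, cls (T i) j = (i == j)%:Z.
Proof.
have [Z Z0] := lzero L.
pose T i := Arrow (0 : lhom Z (P i)).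
have clsT i j : cls (T i) j = (i == j)%:Z.
  by rewrite /cls /= mu_P (mu_zero _ Z0) subr0.
exists T; split=> //; split.
- by move=> s s' w; exists 0, 0; rewrite lcomp0l lcomp0r addr0; exact: eq_hom0.
- move=> s; split.
    move=> /= e; have [h _] := P_indec s; apply: h.
    by have := congr1 (@am0 _ _ (T s) (T s)) e; rewrite am0_0.
  move=> A B AB; have [_ h] := P_indec s.
  have AB0 : is_dsum2 (C := cat_of L) (atgt A) (atgt B) (P s).
    suff h' : dsum (fun b : bool => if b then atgt A else atgt B) (P s) by exact: h'.
    apply: (dsum_reindex (h := id)) (dsum_tgt AB); last by case.
    by exists id.
  have zero C : retract (L := arrl L) C (T s) -> lid (atgt C) = 0 ->
      arrow_id C = 0.
    move=> /retractE [i1 [p1 [i0 [p0 [h1 h0 hi hp]]]]] C0.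
    apply: sq_ext; rewrite ?am1_0 ?am0_0 //; rewrite /am1 /=.
    by rewrite -h1 (eq_hom0 i1) ?lcomp0r // -h1 (eq_hom0 p1 Z0) lcomp0l.
  case: (h _ _ AB0) => e; [left|right]; apply: zero => //.
    exact: (dsum_inj_retract true AB).
  exact: (dsum_inj_retract false AB).
- move=> s [f [_ e]]; have [h _] := P_indec s; apply: h.
  by rewrite /is_zero /= -e /= lcomp0l.
- move=> s s' /(cls_isom mu_dsum s); rewrite !clsT eqxx.
  by case: eqP.
Qed.

Lemma cones_cover (v : 'I_t -> R) : finitely_many_factors ->
  exists T : 'I_t -> arrow L, rigid_family T /\ in_cone T v.
Proof.
move=> fin; have [T [HT clsT]] := initial_family.
pose lam := 1 + \sum_i `|v i|.
have lamv s : `|v s| <= \sum_i `|v i|.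
  by rewrite (bigD1 s) //= lerDl sumr_ge0.
have vlam s : 0 < v s + lam.
  by have := lamv s; rewrite /lam ler_norml => /andP []; lra.
apply: (@walk v T lam) => //.
  by rewrite /lam addr_ge0 // sumr_ge0.
exists (fun s => v s + lam), (fun _ => 1); split.
- move=> j; rewrite (bigD1 j) //= clsT eqxx mulr1 big1 ?addr0 // => s /negPf sj.
  by rewrite clsT sj mulr0.
- move=> j; rewrite (bigD1 j) //= clsT eqxx mulr1 big1 ?addr0 // => s /negPf sj.
  by rewrite clsT sj mulr0.
- by move=> s; rewrite ltW.
- by move=> s e; have := vlam s; rewrite e ltxx.
Qed.

(** * The Cartan form on cones *)
Variable C : 'I_t -> 'I_t -> nat.
Hypothesis hom_dim : forall X Y : L,
  \dim {: lhom X Y} = (\sum_i \sum_j mu X i * mu Y j * C i j)%N.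
Hypothesis forms : forall X : L, exists t : 'Hom(lhom X X, k^o), perfect_form t.

Definition cartan_form f g : int :=
  \sum_i \sum_j cls f i * cls g j * (C i j)%:Z.

Lemma cartan_formE f g : cartan_form f g =
  (\dim {: lhom (atgt f) (atgt g)} + \dim {: lhom (asrc f) (asrc g)})%N%:Z -
  (\dim {: lhom (atgt f) (asrc g)} + \dim {: lhom (asrc f) (atgt g)})%N%:Z.
Proof.
rewrite !hom_dim !PoszD !(big_morph Posz PoszD (erefl 0%:Z)) opprD.
rewrite -!sumrN -!big_split /=; apply: eq_bigr => i _.
rewrite !(big_morph Posz PoszD (erefl 0%:Z)) -!sumrN -!big_split /=.
apply: eq_bigr => j _; rewrite /cls !PoszM; ring.
Qed.

(** By [rigid_neg_zero] only Hom(f, g) contributes to the Euler form. *)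
Lemma cartan_form_ge0 f g : orth f g -> orth g f -> orth g g ->
  0 <= cartan_form f g.
Proof.
move=> fg gf gg; rewrite cartan_formE subr_ge0 lez_nat.
by apply: euler_dim => //; exact: rigid_neg_zero.
Qed.

Lemma cartan_form_gt0 f : orth f f -> ~ contr f -> 0 < cartan_form f f.
Proof.
move=> ff fc; rewrite cartan_formE subr_gt0 ltz_nat.
by apply: euler_dim_strict => //; exact: rigid_neg_zero.
Qed.

Lemma cartan_form_cone m (T : 'I_m -> arrow L) (a : 'I_m -> R) (v : 'I_t -> R) :
  (forall j, v j = \sum_s a s * (cls (T s) j)%:~R) ->
  \sum_i \sum_j v i * v j * (C i j)%:R =
    \sum_s \sum_s' a s * a s' * (cartan_form (T s) (T s'))%:~R.
Proof.
move=> vE.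
have e s s' : a s * a s' * (cartan_form (T s) (T s'))%:~R =
    \sum_i \sum_j (a s * (cls (T s) i)%:~R) * (a s' * (cls (T s') j)%:~R) * (C i j)%:R.
  rewrite /cartan_form raddf_sum mulr_sumr; apply: eq_bigr => i _ /=.
  rewrite raddf_sum mulr_sumr; apply: eq_bigr => j _ /=.
  by rewrite !intrM -!pmulrn; ring.
under [RHS]eq_bigr do under eq_bigr do rewrite e.
under [RHS]eq_bigr do rewrite exchange_big /=.
rewrite [RHS]exchange_big /=; apply: eq_bigr => i _.
under [RHS]eq_bigr do rewrite exchange_big /=.
rewrite [RHS]exchange_big /=; apply: eq_bigr => j _.
by rewrite !vE big_distrlr /= mulr_suml; apply: eq_bigr => s _; rewrite mulr_suml.
Qed.

(** By [cones_cover] the vector v is a nonnegative combination of the classes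
    of a rigid family; expand the form. *)
Theorem cartan_positive (v : 'I_t -> R) : finitely_many_factors ->
  (exists j, v j != 0) -> 0 < \sum_i \sum_j v i * v j * (C i j)%:R.
Proof.
move=> fin [j vj]; have [T [[T1 _ T3 _] [a [a0 vE]]]] := cones_cover v fin.
rewrite (cartan_form_cone vE).
have term0 s s' : 0 <= a s * a s' * (cartan_form (T s) (T s'))%:~R.
  by rewrite mulr_ge0 ?mulr_ge0 ?ler0z ?cartan_form_ge0.
have [s as0] : exists s, a s != 0.
  apply: contrapT => h; move: vj; rewrite vE big1 ?eqxx // => s _.
  case: (eqVneq (a s) 0) => [->|as0]; first by rewrite mul0r.
  by case: h; exists s.
rewrite (bigD1 s) //= ltr_pwDl ?sumr_ge0 // => [|s' _]; last by rewrite sumr_ge0.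
rewrite (bigD1 s) //= ltr_pwDl ?sumr_ge0 //.
have as1 : 0 < a s by rewrite lt_neqAle eq_sym as0 a0.
by rewrite !mulr_gt0 // ltr0z cartan_form_gt0.
Qed.

End Walk.

(** * Modules over a finite dimensional algebra *)
Section ModuleCategory.
Variables (k : fieldType) (A : falgType k).
Implicit Types M N : module A.

Section Submodule.
Variables (M : module A) (U : {vspace M}).
Hypothesis Usub : submod U.

Let V : vectType k := subvs_of U.

Definition sub_act (a : A) (x : V) : V := vsproj U (mact a (vsval x)).

Lemma sub_actE a x : vsval (sub_act a x) = mact a (vsval x).
Proof. by rewrite /sub_act vsprojK // Usub // subvsP. Qed.

Fact sub_linearl c a b x : sub_act (c *: a + b) x = c *: sub_act a x + sub_act b x.
Proof. by apply: subvs_inj; rewrite linearP /= !sub_actE mact_linearl. Qed.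

Fact sub_linearr a : linear (sub_act a).
Proof.
move=> c x y; by apply: subvs_inj; rewrite !linearP /= !sub_actE !linearP.
Qed.

Fact sub_act1 x : sub_act 1 x = x.
Proof. by apply: subvs_inj; rewrite sub_actE mact1. Qed.

Fact sub_actM a b x : sub_act (a * b) x = sub_act a (sub_act b x).
Proof. by apply: subvs_inj; rewrite !sub_actE mactM. Qed.

Definition sub_module : module A :=
  Module sub_linearl sub_linearr sub_act1 sub_actM.

Fact sub_incl_lin : linear (vsval : sub_module -> M).
Proof. by move=> c x y; exact: linearP. Qed.

Definition sub_incl : Hom sub_module M := mkHom sub_incl_lin sub_actE.

Lemma sub_inclE x : vsval sub_incl x = vsval (x : V).
Proof. exact: mkHomE. Qed.

Lemma sub_incl_inj : hom_inj sub_incl.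
Proof. by apply/eqP/lker0P => x y; rewrite !sub_inclE; exact: val_inj. Qed.

Section Corestrict.
Variables (N : module A) (f : Hom N M).
Hypothesis fU : (limg (vsval f) <= U)%VS.

Let fxU x : vsval f x \in U.
Proof. by apply: (subvP fU); apply: memv_img (memvf _). Qed.

Fact corestrict_lin : linear (fun x => vsproj U (vsval f x) : sub_module).
Proof. by move=> c x y; rewrite linearP; exact: linearP. Qed.

Fact corestrict_act a x : vsproj U (vsval f (mact a x)) =
  mact a (vsproj U (vsval f x) : sub_module).
Proof.
apply: subvs_inj; rewrite sub_actE !vsprojK ?fxU //; exact: HomE.
Qed.

Definition corestrict : Hom N sub_module := mkHom corestrict_lin corestrict_act.

Lemma corestrictE x : vsval (vsval corestrict x : V) = vsval f x.
Proof. by rewrite mkHomE vsprojK. Qed.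
End Corestrict.
End Submodule.

Section LinearQuotient.
Variables (M : vectType k) (U : {vspace M}).

(** A linear complement of U carries the quotient, so that a subspace type
    serves for it. *)
Definition quo_sort : vectType k := subvs_of (U^C)%VS.
Definition quo_fun (x : M) : quo_sort := vsproj (U^C)%VS (daddv_pi (U^C)%VS U x).

Fact quo_fun_linear : linear quo_fun.
Proof. by move=> c x y; rewrite /quo_fun !linearP. Qed.

HB.instance Definition _ :=
  GRing.isLinear.Build k M quo_sort *:%R quo_fun quo_fun_linear.

Lemma quo_fun_ker x : (quo_fun x == 0) = (x \in U).
Proof.
have VU : (U^C :&: U = 0)%VS by rewrite capvC capv_compl.
have xUC : x \in (U^C + U)%VS by rewrite addvC addv_complf memvf.
apply/eqP/idP => [e|xU].
  have e0 : daddv_pi (U^C)%VS U x = 0.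
    have := congr1 vsval e; rewrite /quo_fun vsprojK ?memv_pi // => ->.
  by rewrite -(daddv_pi_add VU xUC) e0 add0r memv_pi.
have := daddv_pi_add VU xUC; rewrite (daddv_pi_id _ xU) ?capv_compl // => /eqP.
by rewrite -subr_eq0 addrK => /eqP e; rewrite /quo_fun e linear0.
Qed.

Lemma quo_fun_surj (y : quo_sort) : quo_fun (vsval y) = y.
Proof.
apply: subvs_inj; rewrite /quo_fun vsprojK ?memv_pi //.
by rewrite daddv_pi_id ?subvsP // capvC capv_compl.
Qed.

Lemma quo_fun_eq x y : x - y \in U -> quo_fun x = quo_fun y.
Proof. by rewrite -quo_fun_ker linearB subr_eq0 => /eqP. Qed.

Lemma quo_fun_lift x : vsval (quo_fun x) - x \in U.
Proof. by rewrite -quo_fun_ker linearB /= quo_fun_surj subrr. Qed.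

End LinearQuotient.

Section Quotient.
Variables (M : module A) (U : {vspace M}).
Hypothesis Usub : submod U.

Let V : vectType k := quo_sort U.

Definition quo_act (a : A) (x : V) : V := quo_fun U (mact a (vsval x)).

Lemma quo_actE a x : quo_act a (quo_fun U x) = quo_fun U (mact a x).
Proof. by apply: quo_fun_eq; rewrite -linearB /=; apply: Usub; exact: quo_fun_lift. Qed.

Fact quo_linearl c a b x : quo_act (c *: a + b) x = c *: quo_act a x + quo_act b x.
Proof. by rewrite /quo_act mact_linearl quo_fun_linear. Qed.

Fact quo_linearr a : linear (quo_act a).
Proof. by move=> c x y; rewrite /quo_act !linearP. Qed.

Fact quo_act1 x : quo_act 1 x = x.
Proof. by rewrite /quo_act mact1 quo_fun_surj. Qed.

Fact quo_actM a b x : quo_act (a * b) x = quo_act a (quo_act b x).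
Proof. by rewrite {3}/quo_act quo_actE /quo_act mactM. Qed.

Definition quo_module : module A :=
  Module quo_linearl quo_linearr quo_act1 quo_actM.

Fact quo_map_act a x : quo_fun U (mact a x) = mact a (quo_fun U x : quo_module).
Proof. by rewrite /= quo_actE. Qed.

Definition quo_map : Hom M quo_module := @mkHom _ _ M quo_module (quo_fun U) (@quo_fun_linear M U) quo_map_act.

Lemma quo_exists : exists (N : module A) (q : Hom M N),
  hom_surj q /\ lker (vsval q) = U.
Proof.
exists quo_module, quo_map; split.
  apply/eqP; rewrite eqEsubv subvf; apply/subvP => y _.
  apply/memv_imgP; exists (vsval (y : V)); first exact: memvf.
  by rewrite mkHomE quo_fun_surj.
by apply/vspaceP => x; rewrite memv_ker mkHomE quo_fun_ker.
Qed.

End Quotient.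

Lemma hcompA M N K H (h : Hom K H) (g : Hom N K) (f : Hom M N) :
  hcomp h (hcomp g f) = hcomp (hcomp h g) f.
Proof. by apply: Hom_ext => x; rewrite !hcompE. Qed.

Lemma hidE M (x : M) : vsval (hid M) x = x.
Proof. exact: mkHomE. Qed.

Lemma hcomp1l M N (f : Hom M N) : hcomp (hid N) f = f.
Proof. by apply: Hom_ext => x; rewrite hcompE hidE. Qed.

Lemma hcomp1r M N (f : Hom M N) : hcomp f (hid M) = f.
Proof. by apply: Hom_ext => x; rewrite hcompE hidE. Qed.

Lemma hcomp_linl M N K (f : Hom M N) : linear (fun g : Hom N K => hcomp g f).
Proof.
by move=> c g h; apply: Hom_ext => x; rewrite !(hcompE, Hom_addE, Hom_scaleE).
Qed.

Lemma hcomp_linr M N K (g : Hom N K) : linear (@hcomp k A M N K g).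
Proof.
move=> c f h; apply: Hom_ext => x.
by rewrite !(hcompE, Hom_addE, Hom_scaleE) linearP.
Qed.

Lemma submod_limg M N (f : Hom M N) : submod (limg (vsval f)).
Proof.
move=> a _ /memv_imgP [x _ ->]; rewrite -HomE.
by apply: memv_img (memvf _).
Qed.

Lemma submod_lker M N (f : Hom M N) : submod (lker (vsval f)).
Proof. by move=> a x; rewrite !memv_ker HomE => /eqP ->; rewrite linear0. Qed.

Lemma module_split M (e : Hom M M) : hcomp e e = e ->
  exists N (i : Hom N M) (p : Hom M N), hcomp p i = hid N /\ hcomp i p = e.
Proof.
move=> ee; have Us := submod_limg (f := e).
exists (sub_module Us), (sub_incl Us), (corestrict Us (subvv _)).
split; apply: Hom_ext => x; rewrite hcompE.
  apply: subvs_inj; rewrite corestrictE sub_inclE hidE.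
  have /memv_imgP [y _ ->] := subvsP (x : subvs_of (limg (vsval e))).
  by rewrite -hcompE ee.
by rewrite sub_inclE corestrictE.
Qed.

Lemma module_zero : exists Z : module A, hid Z = 0.
Proof.
have Us : submod (0%VS : {vspace reg A}).
  by move=> a x; rewrite !memv0 => /eqP ->; rewrite linear0.
exists (sub_module Us); apply: Hom_ext => x; rewrite hidE Hom_zeroE.
by apply: subvs_inj; rewrite linear0; apply/eqP; rewrite -memv0; exact: subvsP.
Qed.

Section Injections.
Variables M N : module A.
Fact hinl_lin : linear (fun x => (x, 0) : prod_module M N).
Proof. by move=> c x y; congr pair; rewrite /= scaler0 addr0. Qed.
Fact hinl_act a x : (mact a x, 0) = mact a ((x, 0) : prod_module M N).
Proof. by congr pair; rewrite linear0. Qed.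
Definition hinl : Hom M (prod_module M N) := mkHom hinl_lin hinl_act.
Fact hinr_lin : linear (fun y => (0, y) : prod_module M N).
Proof. by move=> c x y; congr pair; rewrite /= scaler0 addr0. Qed.
Fact hinr_act a y : (0, mact a y) = mact a ((0, y) : prod_module M N).
Proof. by congr pair; rewrite linear0. Qed.
Definition hinr : Hom N (prod_module M N) := mkHom hinr_lin hinr_act.
End Injections.

Lemma module_biprod_eqs M N :
  [/\ hcomp (hfst M N) (hinl M N) = hid M, hcomp (hsnd M N) (hinr M N) = hid N
    & hcomp (hinl M N) (hfst M N) + hcomp (hinr M N) (hsnd M N) =
      hid (prod_module M N)].
Proof.
split; apply: Hom_ext => x; rewrite ?Hom_addE !hcompE !mkHomE //.
by case: x => x y; congr pair; rewrite /= ?addr0 ?add0r.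
Qed.

Lemma module_biprod M N : exists Z (i1 : Hom M Z) (i2 : Hom N Z)
    (p1 : Hom Z M) (p2 : Hom Z N),
  [/\ hcomp p1 i1 = hid M, hcomp p2 i2 = hid N & hcomp i1 p1 + hcomp i2 p2 = hid Z].
Proof.
exists (prod_module M N), (hinl M N), (hinr M N), (hfst M N), (hsnd M N).
exact: module_biprod_eqs.
Qed.

Definition modl : lincat k := @Lincat k (module A) (@Hom k A) (@hid k A) (@hcomp k A)
  hcompA hcomp1l hcomp1r hcomp_linl hcomp_linr module_split module_zero module_biprod.

Lemma projective_retract M N : retract (L := modl) M N -> projective N -> projective M.
Proof.
move=> [i [p pi]] Np X Y e f es; have [g eg] := Np X Y e (hcomp f p) es.
exists (hcomp g i); rewrite hcompA eg -hcompA.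
by rewrite [hcomp p i]pi hcomp1r.
Qed.

Lemma projective_zero M : hid M = 0 -> projective M.
Proof.
move=> M0 X Y e f _; exists 0; apply: Hom_ext => x.
by rewrite hcompE Hom_zeroE linear0 -[x]hidE M0 Hom_zeroE linear0.
Qed.

Record pmod := Pmod { pmodule :> module A; pmod_proj : projective pmodule }.

Lemma pmod_split (M : pmod) (e : Hom M M) : hcomp e e = e ->
  exists (N : pmod) (i : Hom N M) (p : Hom M N), hcomp p i = hid N /\ hcomp i p = e.
Proof.
move=> /module_split [N [i [p [pi ip]]]].
have Np : projective N by apply: (projective_retract _ (@pmod_proj M)); exists i, p.
by exists (Pmod Np), i, p.
Qed.

Lemma pmod_zero : exists Z : pmod, hid Z = 0.
Proof.
have [Z Z0] := module_zero.
by exists (Pmod (projective_zero Z0)).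
Qed.

Lemma pmod_biprod (M N : pmod) : exists (Z : pmod) (i1 : Hom M Z) (i2 : Hom N Z)
    (p1 : Hom Z M) (p2 : Hom Z N),
  [/\ hcomp p1 i1 = hid M, hcomp p2 i2 = hid N & hcomp i1 p1 + hcomp i2 p2 = hid Z].
Proof.
exists (Pmod (projective_prod (@pmod_proj M) (@pmod_proj N))).
exists (hinl M N), (hinr M N), (hfst M N), (hsnd M N).
exact: module_biprod_eqs.
Qed.

Definition prjl : lincat k := @Lincat k pmod (fun M N : pmod => Hom M N) (fun M : pmod => hid M)
  (fun M N K : pmod => @hcomp k A M N K)
  (fun M N K H : pmod => @hcompA M N K H) (fun M N : pmod => @hcomp1l M N) (fun M N : pmod => @hcomp1r M N)
  (fun M N K : pmod => @hcomp_linl M N K) (fun M N K : pmod => @hcomp_linr M N K)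
  pmod_split pmod_zero pmod_biprod.

Lemma indec_prjl_modl (X : pmod) :
  indec (L := prjl) X <-> indec (L := modl) (X : module A).
Proof.
split=> -[h1 h2]; split=> // Y Z YZ.
  have [i1 [i2 [p1 [p2 [k1 k2 k3]]]]] := dsum2E YZ.
  have Yp : projective Y by apply: (projective_retract _ (@pmod_proj X)); exists i1, p1.
  have Zp : projective Z by apply: (projective_retract _ (@pmod_proj X)); exists i2, p2.
  apply: (h2 (Pmod Yp) (Pmod Zp)).
  exact: (dsum2 (L := prjl) (X := X) (Y := Pmod Yp) (Z := Pmod Zp) k1 k2 k3).
have [i1 [i2 [p1 [p2 [k1 k2 k3]]]]] := dsum2E YZ.
exact: (h2 _ _ (dsum2 (L := modl) k1 k2 k3)).
Qed.

Lemma lift_exact (P X Y Z : module A) (f : Hom X Y) (g : Hom Y Z) (h : Hom P Y) :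
  projective P -> limg (vsval f) = lker (vsval g) -> hcomp g h = 0 ->
  exists u : Hom P X, h = hcomp f u.
Proof.
move=> Pp fg gh; have Us := submod_limg (f := f).
have hU : (limg (vsval h) <= limg (vsval f))%VS.
  apply/subvP => _ /memv_imgP [x _ ->].
  by rewrite fg memv_ker -hcompE gh Hom_zeroE.
have es : hom_surj (corestrict Us (subvv _)).
  apply/eqP; rewrite eqEsubv subvf; apply/subvP => y _.
  have /memv_imgP [x _ e] := subvsP (y : subvs_of (limg (vsval f))).
  apply/memv_imgP; exists x; first exact: memvf.
  by apply: subvs_inj; rewrite corestrictE.
have [u ue] := Pp _ _ _ (corestrict Us hU) es; exists u.
apply: Hom_ext => x; have := congr1 vsval (Hom_congr x ue).
by rewrite !hcompE !corestrictE.
Qed.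

Lemma surj_exists M N (f : Hom M N) y : hom_surj f -> exists x, y = vsval f x.
Proof.
move=> fs; have : y \in limg (vsval f) by rewrite fs memvf.
by move=> /memv_imgP [x _ ->]; exists x.
Qed.

Lemma surjP M N (f : Hom M N) : (forall y, exists x, y = vsval f x) -> hom_surj f.
Proof.
move=> h; apply/eqP; rewrite eqEsubv subvf; apply/subvP => y _.
by have [x ->] := h y; apply: memv_img (memvf _).
Qed.

Section Element.
Variables (M : module A) (x : M).
Fact elt_lin : linear (fun a : reg A => mact (a : A) x).
Proof. by move=> c a b; rewrite mact_linearl. Qed.
Fact elt_act (a : A) (b : reg A) : mact (mact a b : A) x = mact a (mact (b : A) x).
Proof. exact: mactM. Qed.
Definition elt : Hom (reg A) M := @mkHom _ _ (reg A) M _ elt_lin elt_act.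
Lemma eltE (a : A) : vsval elt a = mact a x.
Proof. exact: mkHomE. Qed.
Lemma elt1 : vsval elt (1 : A) = x.
Proof. by rewrite eltE mact1. Qed.
End Element.

Lemma elt_eq M (h : Hom (reg A) M) : h = elt (vsval h (1 : A)).
Proof.
apply: Hom_ext => a; rewrite eltE -HomE; congr (vsval h _).
by rewrite /= mulr1.
Qed.

Lemma reg_projective : projective (reg A).
Proof.
move=> X Y e f es; have [x ex] := surj_exists (vsval f (1 : A)) es.
exists (elt x); apply: Hom_ext => a; rewrite hcompE eltE HomE -ex.
by rewrite [in RHS](elt_eq f) eltE.
Qed.

Lemma projective_dsum (I : finType) (Y : I -> module A) X :
  dsum (L := modl) Y X -> (forall i, projective (Y i)) -> projective X.
Proof.
move=> [inj [prj [h1 h2 h3]]] Yp U V e f es.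
have hg i : {g : Hom (Y i) U | hcomp e g = hcomp f (inj i)} := cid (Yp i U V e (hcomp f (inj i)) es).
exists (\sum_i (sval (hg i) : lhom (l := modl) _ _) ** prj i).
rewrite -[hcomp e _]/((e : lhom (l := modl) _ _) ** _) lcomp_sumr.
rewrite -[RHS](lcomp1r (l := modl)) -h3 lcomp_sumr; apply: eq_bigr => i _.
rewrite !lcompA.
exact: (congr1 (fun u : lhom (l := modl) _ _ => u ** prj i) (svalP (hg i))).
Qed.

Lemma free_cover M : exists n (F : pmod) (q : Hom F M),
  dsum (L := modl) (fun _ : 'I_n => reg A) F /\ hom_surj q.
Proof.
pose n := \dim {: M}.
have [F hF] := dsum_exists (L := modl) (fun _ : 'I_n => reg A).
have Fp : projective F by apply: (projective_dsum hF) => _; exact: reg_projective.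
have [inj [prj [h1 h2 h3]]] := hF.
pose b (i : 'I_n) : M := (vbasis {: M})`_i.
pose q : lhom (l := modl) F M := \sum_i (elt (b i) : lhom (l := modl) _ _) ** prj i.
exists n, (Pmod Fp), q; split=> //; apply: surjP => y.
have qi i : q ** inj i = elt (b i).
  exact: (sum_prj_inj (L := modl) (fun i => elt (b i)) i h1 h2).
exists (\sum_i coord (vbasis {: M}) i y *: vsval (inj i) (1 : A)).
rewrite {1}(coord_vbasis (memvf y)) linear_sum; apply: eq_bigr => i _.
rewrite linearZ /=; congr (_ *: _).
by have := Hom_congr (M := reg A) (N := M) (1 : A) (qi i); rewrite hcompE elt1.
Qed.

Lemma projective_retract_free (P : module A) : projective P ->
  exists n F, dsum (L := modl) (fun _ : 'I_n => reg A) F /\ retract (L := modl) P F.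
Proof.
move=> Pp; have [n [F [q [hF qs]]]] := free_cover P.
have [s sq] := Pp _ _ q (hid P) qs.
by exists n, (F : module A); split=> //; exists s, q.
Qed.

End ModuleCategory.

(** * Tops of projective modules and multiplicities *)
Section Tops.
Variables (k : fieldType) (A : falgType k).
Implicit Types M N : module A.

Lemma invertible_surj M N (f : Hom M N) : invertible (L := modl A) f -> hom_surj f.
Proof.
move=> [g [_ fg]]; apply: surjP => y; exists (vsval g y).
by rewrite -hcompE [hcomp f g]fg hidE.
Qed.

Lemma module_neq0 M : indec (L := modl A) M -> (fullv : {vspace M}) <> 0%VS.
Proof.
move=> [M0 _] e; apply: M0; apply: Hom_ext => x; rewrite hidE Hom_zeroE.
by apply/eqP; rewrite -memv0 -e memvf.
Qed.

Lemma endo_surj_invertible M (f : Hom M M) :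
  indec (L := modl A) M -> projective M -> hom_surj f -> invertible (L := modl A) f.
Proof.
move=> Mi Mp fs; have [g fg] := Mp _ _ f (hid M) fs.
have ee : (hcomp g f : lhom (l := modl A) M M) ** hcomp g f = hcomp g f.
  by rewrite -[LHS]/(hcomp (hcomp g f) (hcomp g f)) -hcompA [hcomp f (hcomp g f)]hcompA fg hcomp1l.
exists g; split=> //; case: (indec_idempotent Mi ee) => // gf.
have gf0 : hcomp g f = 0 := gf.
have f0 x : vsval f x = 0.
  transitivity (vsval (hcomp f g) (vsval f x)); first by rewrite fg hidE.
  by rewrite hcompE -[vsval g _]hcompE gf0 Hom_zeroE linear0.
have [M0 _] := Mi; case: M0; apply: Hom_ext => x.
transitivity (vsval (hcomp f g) x); first by rewrite fg.
by rewrite hcompE f0 Hom_zeroE.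
Qed.

(** By projectivity the identity of M is a sum of two endomorphisms with
    images in U and in V; one of them is invertible. *)
Lemma proper_sum M (U V : {vspace M}) :
  indec (L := modl A) M -> projective M -> submod U -> submod V ->
  (U + V)%VS = fullv -> U = fullv \/ V = fullv.
Proof.
move=> Mi Mp Us Vs UV.
pose S := prod_module (sub_module Us) (sub_module Vs).
pose e : Hom S M := hcomp (sub_incl Us) (hfst _ _) + hcomp (sub_incl Vs) (hsnd _ _).
have es : hom_surj e.
  apply: surjP => y; have : y \in (U + V)%VS by rewrite UV memvf.
  move=> /memv_addP [u uU [v vV ->]].
  exists ((vsproj U u, vsproj V v) : S).
  by rewrite Hom_addE !hcompE !mkHomE /= ?sub_inclE !vsprojK.
have [g eg] := Mp _ _ e (hid M) es.
pose c := hcomp (sub_incl Us) (hcomp (hfst _ _) g).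
pose d := hcomp (sub_incl Vs) (hcomp (hsnd _ _) g).
have cd : c + d = hid M.
  by rewrite -eg; apply: Hom_ext => x; rewrite Hom_addE !hcompE Hom_addE !hcompE.
have : invertible (L := modl A) (c + d) by rewrite cd; exact: (invertible_id (L := modl A)).
have inU (W : {vspace M}) (Ws : submod W) (h : Hom M (sub_module Ws)) :
    invertible (L := modl A) (hcomp (sub_incl Ws) h) -> W = fullv.
  move=> /invertible_surj hs; apply/eqP; rewrite eqEsubv subvf -hs.
  apply/subvP => _ /memv_imgP [x _ ->]; rewrite hcompE sub_inclE; exact: subvsP.
by move=> /(local_sum2 Mi) [/inU|/inU]; [left|right].
Qed.

Lemma submod_add M (U V : {vspace M}) : submod U -> submod V -> submod (U + V)%VS.
Proof.
move=> Us Vs a _ /memv_addP [u uU [v vV ->]]; rewrite linearD /=.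
by apply: memv_add; [apply: Us|apply: Vs].
Qed.

Lemma maximal_above M (U : {vspace M}) : submod U -> U <> fullv ->
  exists W : {vspace M}, maximal_submod W /\ (U <= W)%VS.
Proof.
have [n] := ubnP (\dim {: M} - \dim U); elim: n U => // n IH U hn Us Un.
case: (pselect (maximal_submod U)) => [mU|nm]; first by exists U.
have [W [Ws UW WU Wn]] : exists W : {vspace M},
    [/\ submod W, (U <= W)%VS, W <> U & W <> fullv].
  apply: contrapT => h; apply: nm; split=> // W Ws UW.
  by apply: contrapT => /not_orP [h1 h2]; apply: h; exists W.
have [|W' [mW' WW']] := IH W _ Ws Wn; last by exists W'; rewrite (subv_trans UW).
have ltUW : (\dim U < \dim W)%N.
  rewrite ltn_neqAle dimvS // andbT; apply/negP => /eqP e.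
  by apply: WU; apply/esym/eqP; rewrite eqEdim UW e leqnn.
by have := dimvS (subvf W); lia.
Qed.

(** By [proper_sum] an indecomposable projective module has a single maximal
    submodule. *)
Lemma top_radical M N (q : Hom M N) :
  indec (L := modl A) M -> projective M -> hom_surj q ->
  (forall U : {vspace M}, maximal_submod U -> (lker (vsval q) <= U)%VS) ->
  (forall W : {vspace M}, (forall U : {vspace M}, maximal_submod U -> (W <= U)%VS) ->
     (W <= lker (vsval q))%VS) ->
  lker (vsval q) <> fullv /\
  (forall U : {vspace M}, submod U -> U <> fullv -> (U <= lker (vsval q))%VS).
Proof.
move=> Mi Mp qs q1 q2.
have uniq (U V : {vspace M}) : maximal_submod U -> maximal_submod V -> (U <= V)%VS.
  move=> [Us Un Um] [Vs Vn Vm].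
  have [e|e] := Vm _ (submod_add Us Vs) (addvSr U V); first by rewrite -e addvSl.
  by case: (proper_sum Mi Mp Us Vs e).
have z_sub : submod (0%VS : {vspace M}).
  by move=> a x; rewrite !memv0 => /eqP ->; rewrite linear0.
have [W [mW _]] := maximal_above z_sub (fun e => module_neq0 Mi (esym e)).
split.
  move=> e; have [_ Wn _] := mW; apply: Wn; apply/eqP.
  by rewrite eqEsubv subvf -e q1.
move=> U Us Un; have [V [mV UV]] := maximal_above Us Un.
by apply: (subv_trans UV); apply: q2 => V' mV'; exact: uniq.
Qed.

End Tops.

Section Eigenvalue.
Variables (k : closedFieldType) (L : lincat k).
Import VectorInternalTheory.

(** An eigenvalue of the left multiplication by x on the endomorphism algebra.
    *)
Lemma endo_eigenvalue (X : L) (x : lhom X X) : lid X <> 0 ->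
  exists c : k, ~ invertible (x - c *: lid X).
Proof.
move=> X0; pose V := lhom X X.
pose M := lin1_mx (v2r \o (lcomp x : V -> V) \o r2v).
have Vpos : (0 < dim V)%N.
  rewrite lt0n; apply/eqP => V0; apply: X0.
  apply: (can_inj v2rK); apply/rowP => i; have := ltn_ord i.
  by rewrite [X in (_ < X)%N]V0.
have [c rc] : exists c, root (char_poly M) c.
  apply/closed_rootP; rewrite size_char_poly; apply/eqP => -[e].
  by rewrite -[dim V]/(dim V) in Vpos; rewrite e in Vpos.
exists c; have : eigenvalue M c by rewrite eigenvalue_root_char.
move=> /eigenvalueP [v vM v0] [y [yx _]].
have xv : x ** r2v v = c *: (r2v v : V).
  by apply: (can_inj v2rK); rewrite linearZ /= r2vK -vM mul_rV_lin1.
have h : (x - c *: lid X) ** r2v v = 0.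
  by rewrite lcompBl xv lcompZl lcomp1l subrr.
have : (r2v v : V) = 0 by rewrite -[LHS]lcomp1l -yx -lcompA h lcomp0r.
by move/(congr1 v2r); rewrite r2vK linear0 => e; rewrite e eqxx in v0.
Qed.

Lemma closed_infinite : infinite_field k.
Proof. by move=> D /closed_nonrootP [l]; rewrite /root; exists l. Qed.

End Eigenvalue.

Section WeaklySymmetric.
Variables (k : closedFieldType) (A : falgType k) (t : nat) (P : 'I_t -> module A).
Hypothesis hP : indec_projectives P.
Hypothesis hA : weakly_symmetric A.

Lemma P_proj i : projective (P i). Proof. by case: hP => /(_ i) []. Qed.
Lemma P_indec i : indec (L := modl A) (P i). Proof. by case: hP => /(_ i) []. Qed.
Lemma P_noniso i j : isom (L := modl A) (P i) (P j) -> i = j.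
Proof. by case: hP => _ h _; exact: h. Qed.
Lemma P_all (Q : module A) : projective Q -> indec (L := modl A) Q ->
  exists i, isom (L := modl A) Q (P i).
Proof. by case: hP => _ _ h; exact: h. Qed.

Definition PP i : pmod A := Pmod (@P_proj i).

Let topsoc i := cid2 (hA.2 (P i) (@P_proj i) (P_indec i)).
Definition top_module i : module A := s2val (topsoc i).
Let soc_ex i := cid (s2valP (topsoc i)).
Let top_ex i := cid (s2valP' (topsoc i)).
Definition top_map i : Hom (P i) (top_module i) := sval (top_ex i).
Definition soc_map i : Hom (top_module i) (P i) := sval (soc_ex i).

Lemma top_map_surj i : hom_surj (top_map i).
Proof. by case: (svalP (top_ex i)). Qed.

Lemma top_map_ker i : lker (vsval (top_map i)) <> fullv /\
  (forall U : {vspace P i}, submod U -> U <> fullv ->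
    (U <= lker (vsval (top_map i)))%VS).
Proof.
have [h1 h2 h3] := svalP (top_ex i).
exact: (top_radical (P_indec i) (@P_proj i) h1 h2 h3).
Qed.

Lemma top_map_neq0 i : top_map i <> 0.
Proof.
move=> e; have [h _] := top_map_ker i; apply: h; apply/vspaceP => x.
by rewrite memvf memv_ker e Hom_zeroE eqxx.
Qed.

Lemma top_map_nonsurj i M (h : Hom M (P i)) : ~ hom_surj h -> hcomp (top_map i) h = 0.
Proof.
move=> hs; have [_ r] := top_map_ker i.
apply: Hom_ext => x; rewrite hcompE Hom_zeroE; apply/eqP; rewrite -memv_ker.
apply: (subvP (r _ (submod_limg (f := h)) hs)).
exact: memv_img (memvf _).
Qed.

Lemma top_hom_off i j : i != j -> \dim {: Hom (P i) (top_module j)} = 0%N.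
Proof.
move=> ij; apply/eqP; rewrite dimv_eq0 -subv0; apply/subvP => h _.
rewrite memv0; apply/eqP.
have [h' <-] := @P_proj i _ _ (top_map j) h (top_map_surj j).
apply: top_map_nonsurj => hs; case/eqP: ij; apply/esym/P_noniso.
have [s hss] := @P_proj j _ _ h' (hid _) hs.
apply: retract_indec; [exact: (proj1 (P_indec j)) | exact: P_indec |].
by exists s, h'.
Qed.

(** A map from P i to its top lifts to an endomorphism x of P i. For an
    eigenvalue c, the map x - c is not surjective, so it vanishes on the top.
    *)
Lemma top_hom_diag i : \dim {: Hom (P i) (top_module i)} = 1%N.
Proof.
have -> : ({: Hom (P i) (top_module i)} = <[top_map i]>)%VS.
  apply/eqP; rewrite eqEsubv subvf andbT; apply/subvP => h _.
  have [x <-] := @P_proj i _ _ (top_map i) h (top_map_surj i).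
  have [c nc] := endo_eigenvalue (L := modl A) (x : lhom (l := modl A) _ _) (proj1 (P_indec i)).
  apply/vlineP; exists c; apply/eqP; rewrite -subr_eq0; apply/eqP.
  have <- : hcomp (top_map i) (x - c *: hid (P i)) = hcomp (top_map i) x - c *: top_map i.
    apply: Hom_ext => z.
    by rewrite !(hcompE, Hom_addE, Hom_oppE, Hom_scaleE, hidE) linearB linearZ.
  apply: top_map_nonsurj => hs; apply: nc.
  exact: (endo_surj_invertible (P_indec i) (@P_proj i) hs).
by rewrite dim_vline; case: eqP => // /top_map_neq0.
Qed.

(** The number of copies of P j in X, by [mult_family]. *)
Definition mult (X : prjl A) (j : 'I_t) : nat := \dim {: Hom X (top_module j)}.

Lemma mult_dsum (I : finType) (Y : I -> prjl A) (X : prjl A) j :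
  dsum (L := prjl A) Y X -> mult X j = (\sum_i mult (Y i) j)%N.
Proof. by move=> h; exact: (dim_dsum_l (L := modl A) (top_module j) h). Qed.

Lemma mult_P i j : mult (PP i) j = (i == j).
Proof.
rewrite /mult; case: eqP => [->|/eqP ij]; first exact: top_hom_diag.
exact: top_hom_off.
Qed.

Lemma mult_family (m : 'I_t -> nat) (X : prjl A) :
  dsum (L := prjl A) (fun x : {j : 'I_t & 'I_(m j)} => PP (tag x)) X -> mult X =1 m.
Proof.
move=> h j; rewrite (mult_dsum j h).
rewrite -(sig_big_dep xpredT (fun i _ => true) (fun i (_ : 'I_(m i)) => mult (PP i) j)) /=.
rewrite (bigD1 j) //= [X in (X + _)%N](eq_bigr (fun=> 1%N)) => [|l _]; last by rewrite mult_P eqxx.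
rewrite sum1_card card_ord big1 ?addn0 // => i ij.
by rewrite big1 // => l _; rewrite mult_P (negPf ij).
Qed.

Lemma family_exists (X : prjl A) :
  dsum (L := prjl A) (fun x : {j : 'I_t & 'I_(mult X j)} => PP (tag x)) X.
Proof.
have [n [Y [Yi YX]]] := krull_schmidt (L := prjl A) X.
have hphi l : {i | isom (L := modl A) (Y l : module A) (P i)}.
  by apply: cid; apply: P_all; [exact: pmod_proj | apply/indec_prjl_modl; exact: Yi].
pose phi l := sval (hphi l).
have PX : dsum (L := prjl A) (fun l => PP (phi l)) X.
  by apply: dsum_isom YX => l; exact: (svalP (hphi l)).
pose S j := [set l | phi l == j].
pose h (x : {j : 'I_t & 'I_#|S j|}) : 'I_n := enum_val (tagged x).
have phih x : phi (h x) = tag x.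
  by have := enum_valP (tagged x); rewrite finset.in_set => /eqP.
have memS l : l \in S (phi l) by rewrite finset.in_set.
have aux l j (e : phi l = j) (i : 'I_#|S j|) : l = enum_val i ->
    existT (fun j => 'I_#|S j|) (phi l) (enum_rank_in (memS l) l) = existT _ j i.
  case: j / e i => i li; congr existT; apply: enum_val_inj.
  by rewrite enum_rankK_in.
have bh : bijective h.
  exists (fun l => existT (fun j => 'I_#|S j|) (phi l) (enum_rank_in (memS l) l)).
    by move=> x; rewrite (aux _ _ (phih x) (tagged x)) //; case: x.
  by move=> l; rewrite /h /= enum_rankK_in.
have hS : dsum (L := prjl A) (fun x : {j : 'I_t & 'I_#|S j|} => PP (tag x)) X.
  by apply: dsum_reindex bh _ PX => x; rewrite phih.
have e : (fun j => #|S j|) = mult X by apply: funext => j; rewrite (mult_family hS).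
by rewrite -e.
Qed.

Lemma mult_isom (X Y : prjl A) : (forall j, mult X j = mult Y j) ->
  isom (L := prjl A) X Y.
Proof.
move=> /funext e; have := family_exists X; rewrite e => h.
exact: dsum_unique h (family_exists Y).
Qed.

Definition cartan_nat (i j : 'I_t) : nat := \dim {: Hom (P i) (P j)}.

Lemma hom_mult (X Y : prjl A) : \dim {: lhom X Y} =
  (\sum_i \sum_j mult X i * mult Y j * cartan_nat i j)%N.
Proof.
have hX := family_exists X; have hY := family_exists Y.
rewrite (dim_dsum_l (L := prjl A) Y hX).
rewrite -(sig_big_dep xpredT (fun i _ => true)
  (fun i (_ : 'I_(mult X i)) => \dim {: lhom (l := prjl A) (PP i) Y})) /=.
apply: eq_bigr => i _; rewrite sum_nat_const card_ord.
rewrite (dim_dsum_r (L := prjl A) (PP i) hY).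
rewrite -(sig_big_dep xpredT (fun j _ => true)
  (fun j (_ : 'I_(mult Y j)) => \dim {: lhom (l := prjl A) (PP i) (PP j)})) /=.
rewrite big_distrr /=; apply: eq_bigr => j _.
by rewrite sum_nat_const card_ord mulnA.
Qed.

Lemma inj_retract M N : retract (L := modl A) M N -> injective_module N ->
  injective_module M.
Proof.
move=> [i [p pi]] Ni X Y m f mi; have [g eg] := Ni X Y m (hcomp i f) mi.
exists (hcomp p g); rewrite -hcompA eg hcompA.
by rewrite [hcomp p i]pi hcomp1l.
Qed.

Lemma inj_dsum (I : finType) (Y : I -> module A) X :
  dsum (L := modl A) Y X -> (forall i, injective_module (Y i)) -> injective_module X.
Proof.
move=> [inj [prj [h1 h2 h3]]] Yp U V e f es.
have hg i : {g : Hom V (Y i) | hcomp g e = hcomp (prj i) f} :=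
  cid (Yp i U V e (hcomp (prj i) f) es).
exists (\sum_i inj i ** (sval (hg i) : lhom (l := modl A) _ _)).
rewrite -[hcomp _ e]/(_ ** (e : lhom (l := modl A) _ _)) lcomp_suml.
rewrite -[RHS](lcomp1l (l := modl A)) -h3 lcomp_suml; apply: eq_bigr => i _.
rewrite -!lcompA.
exact: (congr1 (fun u : lhom (l := modl A) _ _ => inj i ** u) (svalP (hg i))).
Qed.

Lemma P_inj i : injective_module (P i).
Proof.
have [n [F [hF PF]]] := projective_retract_free (@P_proj i).
apply: (inj_retract PF); apply: (inj_dsum hF) => _; exact: hA.1.
Qed.

(** The composite P i -> top = socle -> P i. Its existence is where the weak
    symmetry enters; a functional that does not vanish on it is nondegenerate.
    *)
Definition soc_endo i : Hom (P i) (P i) := hcomp (soc_map i) (top_map i).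

Lemma soc_endo_ker i : lker (vsval (soc_endo i)) = lker (vsval (top_map i)).
Proof.
have [h1 _ _] := svalP (soc_ex i).
apply/vspaceP => x; rewrite !memv_ker hcompE.
apply/eqP/eqP => [e|->]; last by rewrite linear0.
have /lker0P inj : lker (vsval (soc_map i)) == 0%VS by apply/eqP.
by apply: inj; rewrite e linear0.
Qed.

Lemma soc_endo_neq0 i : soc_endo i <> 0.
Proof.
move=> e; have [h _] := top_map_ker i; apply: h; apply/vspaceP => x.
by rewrite -soc_endo_ker memvf memv_ker e Hom_zeroE eqxx.
Qed.

(** The kernel of g is a proper submodule, hence contained in the kernel of
    [soc_endo i], which therefore factors through the image of g; this map
    extends to X because P i is injective. *)
Lemma soc_endo_extend i X (g : Hom (P i) X) : g <> 0 ->
  exists f : Hom X (P i), hcomp f g = soc_endo i.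
Proof.
move=> g0; have Us := submod_limg (f := g).
have kerg : (lker (vsval g) <= lker (vsval (soc_endo i)))%VS.
  rewrite soc_endo_ker; apply: (top_map_ker i).2; first exact: submod_lker.
  move=> e; apply: g0; apply: Hom_ext => x; rewrite Hom_zeroE; apply/eqP.
  by rewrite -memv_ker e memvf.
pose s x := vsval (soc_endo i) ((vsval g)^-1%VF x).
have sg x : s (vsval g x) = vsval (soc_endo i) x.
  apply/eqP; rewrite -subr_eq0 -linearB /= -memv_ker; apply: (subvP kerg).
  rewrite memv_ker linearB /= limg_lfunVK ?subrr //.
  exact: memv_img (memvf _).
have s_lin : linear (fun y : sub_module Us => s (vsval (y : subvs_of _))).
  by move=> c x y; rewrite linearP /s !linearP.
have s_act a (y : sub_module Us) : s (vsval (mact a y : subvs_of _)) =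
    mact a (s (vsval (y : subvs_of _))).
  rewrite [vsval (mact a y : subvs_of _)](sub_actE Us).
  have /memv_imgP [x _ ->] := subvsP (y : subvs_of (limg (vsval g))).
  by rewrite -HomE !sg HomE.
pose sH : Hom (sub_module Us) (P i) :=
  @mkHom _ _ (sub_module Us) (P i) (fun y => s (vsval (y : subvs_of _))) s_lin s_act.
have [f ef] := @P_inj i _ _ (sub_incl Us) sH (@sub_incl_inj _ _ _ _ Us).
exists f; apply: Hom_ext => x; rewrite hcompE -sg.
have := Hom_congr (vsproj _ (vsval g x) : sub_module Us) ef.
rewrite hcompE sub_inclE mkHomE vsprojK //.
exact: memv_img (memvf _).
Qed.

Lemma simple_below (M : module A) (U : {vspace M}) : submod U -> U <> 0%VS ->
  exists W : {vspace M}, simple_submod W /\ (W <= U)%VS.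
Proof.
have [n] := ubnP (\dim U); elim: n U => // n IH U hn Us Un.
case: (pselect (simple_submod U)) => [mU|nm]; first by exists U.
have [W [Ws WU WnU Wn]] : exists W : {vspace M},
    [/\ submod W, (W <= U)%VS, W <> U & W <> 0%VS].
  apply: contrapT => h; apply: nm; split=> // W Ws WU.
  by apply: contrapT => /not_orP [h1 h2]; apply: h; exists W.
have [|W' [mW' WW']] := IH W _ Ws Wn; last by exists W'; rewrite (subv_trans WW').
have : (\dim W < \dim U)%N.
  rewrite ltn_neqAle dimvS // andbT; apply/negP => /eqP e.
  by apply: WnU; apply/eqP; rewrite eqEdim WU e leqnn.
by move=> h; rewrite (leq_trans h).
Qed.

(** The image of f contains a simple submodule. It lies in the socle, which is
    simple, so that the image of f contains the image of [soc_endo i]. *)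
Lemma soc_endo_lift i X (f : Hom X (P i)) : f <> 0 ->
  exists g : Hom (P i) X, hcomp f g = soc_endo i.
Proof.
move=> f0; have Us := submod_limg (f := f).
have [||W [[Ws Wn Wm] WU]] := @simple_below _ (limg (vsval f)).
- exact: Us.
- move=> e; apply: f0; apply: Hom_ext => x; rewrite Hom_zeroE; apply/eqP.
  by rewrite -memv0 -e; apply: memv_img (memvf _).
have [_ socW _] := svalP (soc_ex i).
have Wsoc := socW W (And3 Ws Wn Wm).
have sW : (limg (vsval (soc_endo i)) <= W)%VS.
  pose V : {vspace P i} := (vsval (soc_endo i) @^-1: W)%VS.
  have Vs : submod V.
    by move=> a x; rewrite -!memv_preim HomE; apply: Ws.
  suff Vfull : V = fullv.
    apply/subvP => _ /memv_imgP [x _ ->]; rewrite memv_preim.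
    by rewrite -/V Vfull memvf.
  apply: contrapT => Vn; have Vrad := (top_map_ker i).2 V Vs Vn.
  apply: Wn; apply/eqP; rewrite -subv0; apply/subvP => w wW.
  have /memv_imgP [n _ wn] := subvP Wsoc _ wW.
  have [x nx] := surj_exists n (top_map_surj i).
  have wx : w = vsval (soc_endo i) x by rewrite hcompE -nx.
  have xV : x \in V by rewrite -memv_preim -wx.
  have := subvP Vrad _ xV; rewrite -soc_endo_ker memv_ker -wx => /eqP ->.
  exact: mem0v.
have sf : (limg (vsval (soc_endo i)) <= limg (vsval f))%VS by apply: subv_trans WU.
have es : hom_surj (corestrict Us (subvv _)).
  apply: surjP => y; have /memv_imgP [x _ e] := subvsP (y : subvs_of (limg (vsval f))).
  by exists x; apply: subvs_inj; rewrite corestrictE.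
have [g eg] := @P_proj i _ _ _ (corestrict Us sf) es; exists g.
apply: Hom_ext => x; have e := congr1 vsval (Hom_congr x eg).
by rewrite [in LHS]hcompE [LHS]corestrictE [RHS]corestrictE in e; rewrite hcompE.
Qed.

Lemma functional_exists (V : vectType k) (v : V) : v <> 0 ->
  exists F : 'Hom(V, k^o), F v <> 0.
Proof.
move=> v0; pose b := vbasis {: V}.
have [i ci] : exists i, coord b i v != 0.
  apply: contrapT => h; apply: v0; rewrite (coord_vbasis (memvf v)).
  apply: big1 => i _; case: (eqVneq (coord b i v) 0) => [->|c]; first exact: scale0r.
  by case: h; exists i.
pose c : V -> k^o := coord b i.
have c_lin : linear c by move=> a x y; rewrite /c linearP.
pose cL : {linear V -> k^o} := HB.pack c (GRing.isLinear.Build k V k^o *:%R c c_lin).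
by exists (linfun cL); rewrite lfunE; apply/eqP.
Qed.

(** Decompose X into copies of the P i and add up functionals that do not
    vanish on the [soc_endo i]. A nonzero map out of X or into X can be
    composed to yield [soc_endo i] on one summand. *)
Lemma forms_exist (X : prjl A) : exists f : 'Hom(lhom X X, k^o), perfect_form f.
Proof.
have [inj [prj [h1 h2 h3]]] := family_exists X.
have tau_ex i := cid (functional_exists (@soc_endo_neq0 i)).
pose tau i : 'Hom(Hom (P i) (P i), k^o) := sval (tau_ex i).
have tau0 i : tau i (soc_endo i) <> 0 := svalP (tau_ex i).
pose I : finType := {j : 'I_t & 'I_(mult X j)}.
pose f : lhom X X -> k^o := fun x => \sum_(i : I) tau (tag i) (prj i ** x ** inj i).
have f_lin : linear f.
  move=> c x y; rewrite /f scaler_sumr -big_split; apply: eq_bigr => i _.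
  by rewrite lcompDr lcompDl lcompZr lcompZl linearP.
pose fL : {linear lhom X X -> k^o} :=
  HB.pack f (GRing.isLinear.Build k (lhom X X) k^o *:%R f f_lin).
have fE x : linfun fL x = f x by rewrite lfunE.
exists (linfun fL); split=> Y.
  move=> g hg; apply: contrapT => g0.
  have [i gi] : exists i, g ** inj i <> 0.
    apply: contrapT => h; apply: g0.
    rewrite -[g]lcomp1r -h3 lcomp_sumr big1 // => i _.
    rewrite lcompA; suff -> : g ** inj i = 0 by rewrite lcomp0l.
    by apply: contrapT => gi; apply: h; exists i.
  have [u ug] := soc_endo_extend gi.
  have := hg (inj i ** (u : lhom (l := prjl A) Y (PP (tag i)))).
  rewrite fE /f (bigD1 i) // big1 => [|j /andP [_ ji]].
    rewrite [Algebra.Algebra_add__canonical__SemiGroup_ComLaw _ _ _]addr0 !lcompA h1.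
    have -> : lid (l := prjl A) (PP (tag i)) ** (u : lhom (l := prjl A) Y (PP (tag i))) ** g ** inj i
      = soc_endo (tag i) by rewrite lcomp1l -lcompA; exact: ug.
    exact: tau0.
  by rewrite !lcompA h2 1?eq_sym // !lcomp0l linear0.
move=> h hh; apply: contrapT => h0.
have [i hi] : exists i, prj i ** h <> 0.
  apply: contrapT => hn; apply: h0.
  rewrite -[h]lcomp1l -h3 lcomp_suml big1 // => i _.
  rewrite -lcompA; suff -> : prj i ** h = 0 by rewrite lcomp0r.
  by apply: contrapT => hi; apply: hn; exists i.
have [u ug] := soc_endo_lift hi.
have := hh ((u : lhom (l := prjl A) (PP (tag i)) Y) ** prj i).
rewrite fE /f (bigD1 i) // big1 => [|j /andP [_ ji]].
  rewrite [Algebra.Algebra_add__canonical__SemiGroup_ComLaw _ _ _]addr0.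
  have -> : prj i ** (h ** ((u : lhom (l := prjl A) (PP (tag i)) Y) ** prj i)) ** inj i
    = soc_endo (tag i).
    by rewrite !lcompA -[LHS]lcompA h1 lcomp1r; exact: ug.
  exact: tau0.
by rewrite -!lcompA h2 // !lcomp0r linear0.
Qed.


End WeaklySymmetric.

(** * Cokernels of arrows between projective modules *)
Section IdempotentIndec.
Variables (k : fieldType) (L : lincat k).

Lemma idempotents_indec (X : L) : lid X <> 0 ->
  (forall e : lhom X X, e ** e = e -> e = 0 \/ e = lid X) -> indec X.
Proof.
move=> X0 h; split=> // Y Z /dsum2E [i1 [i2 [p1 [p2 [k1 k2 k3]]]]].
have ee : (i1 ** p1) ** (i1 ** p1) = i1 ** p1.
  by rewrite -lcompA [p1 ** _]lcompA k1 lcomp1l.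
case: (h _ ee) => e; [left|right]; rewrite /is_zero /=.
  by rewrite -[lid Y]lcomp1l -k1 lcompA -[p1 ** i1 ** p1]lcompA e lcomp0r lcomp0l.
have ip2 : i2 ** p2 = 0 by apply: (addrI (i1 ** p1)); rewrite k3 addr0 e.
by rewrite -[lid Z]lcomp1l -k2 lcompA -[p2 ** i2 ** p2]lcompA ip2 lcomp0r lcomp0l.
Qed.

Lemma lpow_idempotent (X : L) (e : lhom X X) n : e ** e = e -> lpow e n.+1 = e.
Proof.
by move=> ee; elim: n => [|n IH]; rewrite ?lpow1 // lpowS IH.
Qed.

Lemma am1_pow (f : arrow L) (x : sqhom f f) n :
  am1 (lpow (L := arrl L) x n) = lpow (am1 x) n.
Proof. by elim: n => // n IH; rewrite !lpowS -IH. Qed.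

Lemma am0_pow (f : arrow L) (x : sqhom f f) n :
  am0 (lpow (L := arrl L) x n) = lpow (am0 x) n.
Proof. by elim: n => // n IH; rewrite !lpowS -IH. Qed.

Lemma invertible_am (f g : arrow L) (x : sqhom f g) : invertible (L := arrl L) x ->
  invertible (am1 x) /\ invertible (am0 x).
Proof.
move=> [y [yx xy]]; split.
  by exists (am1 y); split; [exact: (congr1 (@am1 _ _ _ _) yx)|exact: (congr1 (@am1 _ _ _ _) xy)].
by exists (am0 y); split; [exact: (congr1 (@am0 _ _ _ _) yx)|exact: (congr1 (@am0 _ _ _ _) xy)].
Qed.

End IdempotentIndec.

Section Cokernel.
Variables (k : fieldType) (A : falgType k).
Implicit Types (M N : module A) (f g : arrow (prjl A)).

Lemma factor_surj M N K (q : Hom M N) (h : Hom M K) : hom_surj q ->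
  (lker (vsval q) <= lker (vsval h))%VS -> exists u : Hom N K, hcomp u q = h.
Proof.
move=> qs qh.
pose s x := vsval h ((vsval q)^-1%VF x).
have sq x : s (vsval q x) = vsval h x.
  apply/eqP; rewrite -subr_eq0 -linearB /= -memv_ker; apply: (subvP qh).
  rewrite memv_ker linearB /= limg_lfunVK ?subrr //.
  exact: memv_img (memvf _).
have s_lin : linear s by move=> c x y; rewrite /s !linearP.
have s_act a y : s (mact a y) = mact a (s y).
  by have [x ->] := surj_exists y qs; rewrite -HomE !sq HomE.
exists (@mkHom _ _ N K s s_lin s_act); apply: Hom_ext => x.
by rewrite hcompE mkHomE sq.
Qed.

Definition coker f M (q : Hom (atgt f) M) : Prop :=
  hom_surj q /\ limg (vsval (amap f)) = lker (vsval q).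

Lemma coker_exists f : exists M (q : Hom (atgt f) M), coker q.
Proof.
have [M [q [qs e]]] := quo_exists (submod_limg (f := amap f)).
by exists M, q.
Qed.

Lemma coker0 f M (q : Hom (atgt f) M) : coker q -> hcomp q (amap f) = 0.
Proof.
move=> [_ e]; apply: Hom_ext => x; rewrite hcompE Hom_zeroE; apply/eqP.
by rewrite -memv_ker -e; apply: memv_img (memvf _).
Qed.

Lemma coker_presentation M : exists f (q : Hom (atgt f) M), coker q.
Proof.
have [n [F [q [_ qs]]]] := free_cover M.
have Ks := submod_lker (f := q).
have [n' [F' [q' [_ qs']]]] := free_cover (sub_module Ks).
pose m : Hom F' F := hcomp (sub_incl Ks) q'.
have mE y : vsval m y = vsval (vsval q' y : subvs_of _) by rewrite hcompE sub_inclE.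
suff e : limg (vsval m) = lker (vsval q) by exists (@Arrow _ (prjl A) F' F m), q.
apply/vspaceP => x; apply/idP/idP => [/memv_imgP [y _ ->]|xK].
  by rewrite mE; exact: subvsP.
have [y ey] := surj_exists (vsproj _ x : sub_module Ks) qs'.
apply/memv_imgP; exists y; first exact: memvf.
by rewrite mE -ey vsprojK.
Qed.

Lemma coker_lift f g M N (q : Hom (atgt f) M) (r : Hom (atgt g) N) (u : Hom M N) :
  coker q -> coker r -> exists x : sqhom f g, hcomp r (am0 x) = hcomp u q.
Proof.
move=> qc [rs rk].
have [a ra] := @pmod_proj _ _ (atgt f) _ _ r (hcomp u q) rs.
have h0 : hcomp r (hcomp a (amap f)) = 0.
  rewrite hcompA ra -hcompA (coker0 qc); apply: Hom_ext => x.
  by rewrite hcompE !Hom_zeroE linear0.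
have [b ab] := lift_exact (@pmod_proj _ _ (asrc f)) rk h0.
by exists (@mk_sq _ (prjl A) f g b a ab).
Qed.

Lemma coker_map f g M N (q : Hom (atgt f) M) (r : Hom (atgt g) N) (x : sqhom f g) :
  coker q -> coker r -> exists u : Hom M N, hcomp r (am0 x) = hcomp u q.
Proof.
move=> [qs qk] rc; have [|u <-] := @factor_surj _ _ _ q (hcomp r (am0 x)) qs; last by exists u.
rewrite -qk; apply/subvP => _ /memv_imgP [y _ ->].
rewrite memv_ker -hcompE -hcompA.
have -> : hcomp (am0 x) (amap f) = hcomp (amap g) (am1 x) := amE x.
by rewrite hcompA (coker0 rc) hcompE Hom_zeroE eqxx.
Qed.

Lemma surj_cancel M N K (q : Hom M N) (u v : Hom N K) :
  hom_surj q -> hcomp u q = hcomp v q -> u = v.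
Proof.
move=> qs e; apply: Hom_ext => y; have [x ->] := surj_exists y qs.
by rewrite -!hcompE e.
Qed.

Lemma coker_epi f g M N (q : Hom (atgt f) M) (r : Hom (atgt g) N) (u : Hom M N)
    (x : sqhom f g) :
  coker q -> coker r -> hom_surj u -> hcomp r (am0 x) = hcomp u q -> epi_arrow x.
Proof.
move=> [qs qk] [rs rk] us e Z w.
have uqs : hom_surj (hcomp u q).
  apply: surjP => y; have [z ->] := surj_exists y us.
  by have [z' ->] := surj_exists z qs; exists z'; rewrite hcompE.
have [v uv] := @pmod_proj _ _ Z _ _ (hcomp u q) (hcomp r w) uqs.
have h0 : hcomp r (w - hcomp (am0 x) v) = 0.
  apply: Hom_ext => z; rewrite hcompE Hom_addE Hom_oppE hcompE linearB /=.
  by rewrite -[vsval r (vsval w z)]hcompE -uv -e !hcompE Hom_zeroE subrr.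
have [b wb] := lift_exact (@pmod_proj _ _ Z) rk h0.
exists v, b; rewrite -[X in _ = _ + X]wb addrC.
by rewrite -[am0 x ** v]/(hcomp (am0 x) v) subrK.
Qed.

Lemma coker_pow f M (q : Hom (atgt f) M) (x : sqhom f f) (u : Hom M M) n :
  hcomp q (am0 x) = hcomp u q ->
  hcomp q (am0 (lpow (L := arrl (prjl A)) x n)) = hcomp (lpow (L := modl A) u n) q.
Proof.
move=> e; elim: n => [|n IH]; first by rewrite [LHS]hcomp1r [RHS]hcomp1l.
have -> : am0 (lpow (L := arrl (prjl A)) x n.+1) =
    hcomp (am0 x) (am0 (lpow (L := arrl (prjl A)) x n)) by [].
have -> : lpow (L := modl A) u n.+1 = hcomp u (lpow (L := modl A) u n) by [].
by rewrite hcompA e -hcompA IH hcompA.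
Qed.

Lemma coker_nilpotent f M (q : Hom (atgt f) M) (x : sqhom f f) n :
  hom_surj q -> hcomp q (am0 x) = q -> lpow (L := arrl (prjl A)) x n = 0 -> hid M = 0.
Proof.
move=> qs e xn; have e' : hcomp q (am0 x) = hcomp (hid M) q by rewrite hcomp1l.
have := coker_pow n e'; rewrite xn am0_0.
have -> : lpow (L := modl A) (hid M) n = hid M.
  by case: n {xn} => // n; apply: lpow_idempotent; exact: hcomp1l.
move=> h; apply: (surj_cancel qs); rewrite -h.
by apply: Hom_ext => y; rewrite !hcompE !Hom_zeroE linear0.
Qed.

Lemma zero_module_hom M N (u : Hom M N) : hid N = 0 -> u = 0.
Proof. by move=> N0; rewrite -[u]hcomp1l N0; apply: Hom_ext => x; rewrite hcompE !Hom_zeroE. Qed.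

(** An idempotent of the cokernel lifts to an endomorphism of f, which is
    invertible or nilpotent; so the idempotent is 1 or 0. *)
Lemma coker_indec f M (q : Hom (atgt f) M) :
  indec (L := arrl (prjl A)) f -> coker q -> hid M <> 0 -> indec (L := modl A) M.
Proof.
move=> fi qc M0; apply: idempotents_indec => //= u uu.
have [x xu] := coker_lift u qc qc.
case: (indec_local (L := arrl (prjl A)) x fi) => [[y [_ xy]]|[n xn]].
  right; have [v yv] := coker_map y qc qc.
  have uv : hcomp u v = hid M.
    apply: (surj_cancel qc.1); rewrite -hcompA -yv hcompA -xu -hcompA hcomp1l.
    have -> : hcomp (am0 x) (am0 y) = hid _ := congr1 (@am0 _ _ _ _) xy.
    by rewrite hcomp1r.
  by rewrite -[u]hcomp1r -uv hcompA [hcomp u u]uu.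
left; have := coker_pow n xu; rewrite xn am0_0 => h.
have un : lpow (L := modl A) u n = 0.
  apply: (surj_cancel qc.1); rewrite -h.
  by apply: Hom_ext => y; rewrite !hcompE !Hom_zeroE linear0.
case: n un {xn h} => [|n]; first by move/M0.
by rewrite (lpow_idempotent (L := modl A) n uu).
Qed.

(** Lift both directions of an isomorphism. The composite y x acts as the
    identity on the nonzero cokernel, so it is not nilpotent, hence
    invertible. *)
Lemma coker_noniso f g M N (q : Hom (atgt f) M) (r : Hom (atgt g) N) :
  indec (L := arrl (prjl A)) f -> indec (L := arrl (prjl A)) g ->
  coker q -> coker r -> hid M <> 0 -> isom (L := modl A) M N ->
  isom (L := arrl (prjl A)) f g.
Proof.
move=> fi gi qc rc M0 [u [v [vu uv]]].
have [x xu] := coker_lift u qc rc; have [y yv] := coker_lift v rc qc.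
apply: retract_indec => //; first by case: fi.
have qyx : hcomp q (am0 (arrow_comp y x)) = q.
  rewrite -[am0 _]/(hcomp (am0 y) (am0 x)) hcompA yv -hcompA xu hcompA.
  by rewrite [hcomp v u]vu hcomp1l.
case: (indec_local (L := arrl (prjl A)) (arrow_comp y x) fi) => [[z [zyx _]]|[n xn]].
  by exists x, (arrow_comp z y); rewrite -zyx; exact: (esym (acompA z y x)).
by case: M0; exact: coker_nilpotent qc.1 qyx xn.
Qed.

(** An arrow with zero cokernel is a split surjection, and the splitting c
    gives the idempotent (c f, 1) of the arrow; it is not 1, as f is not
    contractible, so it is 0. *)
Lemma coker_zero_tgt f M (q : Hom (atgt f) M) :
  indec (L := arrl (prjl A)) f -> ~ contr f -> coker q -> hid M = 0 ->
  hid (atgt f) = 0.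
Proof.
move=> fi fc [qs qk] M0.
have fs : hom_surj (amap f).
  rewrite /hom_surj qk; apply/vspaceP => x; rewrite memvf memv_ker.
  by rewrite (zero_module_hom q M0) Hom_zeroE eqxx.
have [c fcid] := @pmod_proj _ _ (atgt f) _ _ (amap f) (hid _) fs.
have e : hcomp (hid (atgt f)) (amap f) = hcomp (amap f) (hcomp c (amap f)).
  by rewrite hcompA fcid.
pose x := @mk_sq _ (prjl A) f f (hcomp c (amap f)) (hid _) e.
have xx : arrow_comp x x = x.
  apply: sq_ext; last exact: hcomp1l.
  by rewrite -[LHS]/(hcomp (hcomp c (amap f)) (hcomp c (amap f))) -hcompA -e hcomp1l.
case: (indec_idempotent (L := arrl (prjl A)) fi xx) => x0.
  exact: (etrans (congr1 (@am0 _ _ _ _) x0) (am0_0 _ _)).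
case: fc; exists c; split; last exact: fcid.
exact: (congr1 (@am1 _ _ _ _) x0).
Qed.

Lemma zero_tgt_indec f : indec (L := arrl (prjl A)) f -> hid (atgt f) = 0 ->
  indec (L := modl A) (asrc f).
Proof.
move=> fi f0.
have z0 N (u : Hom N (atgt f)) : u = 0 := zero_module_hom u f0.
apply: idempotents_indec => [s0|u uu].
  case: fi => h _; apply: h; apply: sq_ext.
    by rewrite am1_0; exact: s0.
  by rewrite am0_0; exact: f0.
have e : hcomp (0 : Hom (atgt f) (atgt f)) (amap f) = hcomp (amap f) u.
  by rewrite [LHS]z0 [RHS]z0.
pose x := @mk_sq _ (prjl A) f f u 0 e.
have xx : arrow_comp x x = x.
  by apply: sq_ext; [exact: uu | rewrite [LHS]z0 [RHS]z0].
case: (indec_idempotent (L := arrl (prjl A)) fi xx) => x0; [left|right].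
  exact: (etrans (congr1 (@am1 _ _ _ _) x0) (am1_0 _ _)).
exact: (congr1 (@am1 _ _ _ _) x0).
Qed.

Lemma zero_tgt_isom f g : hid (atgt f) = 0 -> hid (atgt g) = 0 ->
  isom (L := modl A) (asrc f) (asrc g) -> isom (L := arrl (prjl A)) f g.
Proof.
move=> f0 g0 [u [v [vu uv]]].
apply: (@isom_arrow _ (prjl A) f g u 0).
- by exists v.
- exists 0; split.
    by rewrite [LHS](zero_module_hom _ f0) [RHS](zero_module_hom _ f0).
  by rewrite [LHS](zero_module_hom _ g0) [RHS](zero_module_hom _ g0).
by rewrite [LHS](zero_module_hom _ g0) [RHS](zero_module_hom _ g0).
Qed.

Lemma superfluous_sub M (K K' : {vspace M}) :
  (K <= K')%VS -> superfluous K' -> superfluous K.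
Proof.
move=> KK h U Us UK; apply: h => //; apply/eqP; rewrite eqEsubv subvf -UK.
exact: addvS.
Qed.

Lemma superfluous_image M N (i : Hom M N) (K : {vspace M}) :
  superfluous K -> superfluous (vsval i @: K)%VS.
Proof.
move=> Ks U Us UK.
pose V : {vspace M} := (vsval i @^-1: U)%VS.
have Vs : submod V by move=> a x; rewrite -!memv_preim HomE; apply: Us.
have Vf : V = fullv.
  apply: Ks => //; apply/eqP; rewrite eqEsubv subvf; apply/subvP => x _.
  have : vsval i x \in (U + vsval i @: K)%VS by rewrite UK memvf.
  move=> /memv_addP [u uU [_ /memv_imgP [y yK ->] e]].
  rewrite -[x](subrK y); apply: memv_add => //.
  by rewrite -memv_preim linearB /= e addrK.
have iU : (vsval i @: K <= U)%VS.
  by apply/subvP => _ /memv_imgP [y _ ->]; rewrite memv_preim -/V Vf memvf.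
by rewrite -UK; apply/esym/addv_idPl.
Qed.

Lemma superfluous_add M (K K' : {vspace M}) : submod K' ->
  superfluous K -> superfluous K' -> superfluous (K + K')%VS.
Proof.
move=> K's h h' U Us e; apply: h' => //; apply: h; first exact: submod_add.
by rewrite -addvA [(K' + K)%VS]addvC.
Qed.

Lemma superfluous_sum (I : finType) M (K : I -> {vspace M}) :
  (forall i, submod (K i)) -> (forall i, superfluous (K i)) ->
  superfluous (\sum_i K i)%VS.
Proof.
move=> Ks h.
have [] // : submod (\sum_i K i)%VS /\ superfluous (\sum_i K i)%VS.
apply: (big_rec (fun V => submod V /\ superfluous V)).
  split; first by move=> a x; rewrite !memv0 => /eqP ->; rewrite linear0.
  by move=> U _; rewrite addv0.
move=> i V _ [Vs Vh]; split; first exact: submod_add.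
exact: superfluous_add.
Qed.

Section Minimal.
Variables (f : arrow (prjl A)).
Hypotheses (fi : indec (L := arrl (prjl A)) f) (fc : ~ contr f).

Lemma invertible_proper M (U : {vspace M}) (u : Hom M M) :
  invertible (L := modl A) u -> (limg (vsval u) <= U)%VS -> U = fullv.
Proof.
by move=> /invertible_surj us uU; apply/eqP; rewrite eqEsubv subvf -us.
Qed.

(** Let U + im f be everything, with r the projection modulo U. Then r = r f c
    for some c, and (c f, f c) is an endomorphism of f. It is not invertible,
    as f is not, hence it is nilpotent; so 1 - f c is invertible, with image
    in U. *)
Lemma limg_superfluous : superfluous (limg (vsval (amap f))).
Proof.
move=> U Us Uf.
have [N [r [rs rk]]] := quo_exists Us.
have rfs : hom_surj (hcomp r (amap f)).
  apply: surjP => y; have [z ->] := surj_exists y rs.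
  have : z \in (U + limg (vsval (amap f)))%VS by rewrite Uf memvf.
  move=> /memv_addP [u uU [_ /memv_imgP [v _ ->] ->]]; exists v.
  rewrite linearD hcompE /=; move: uU; rewrite -rk memv_ker => /eqP ->.
  by rewrite add0r.
have [c rfc] := @pmod_proj _ _ (atgt f) _ _ (hcomp r (amap f)) r rfs.
have e : hcomp (hcomp (amap f) c) (amap f) = hcomp (amap f) (hcomp c (amap f)).
  by rewrite hcompA.
pose x := @mk_sq _ (prjl A) f f (hcomp c (amap f)) (hcomp (amap f) c) e.
case: (indec_local (L := arrl (prjl A)) x fi) => [/invertible_am [[v [v1 v2]] [w [w1 w2]]]|[n xn]].
  case: fc.
  have vcf : hcomp (hcomp v c) (amap f) = hid _ by rewrite -hcompA; exact: v1.
  have fcw : hcomp (amap f) (hcomp c w) = hid _ by rewrite hcompA; exact: w2.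
  exists (hcomp v c); split; first exact: vcf.
  suff -> : hcomp v c = hcomp c w by exact: fcw.
  by rewrite -[hcomp v c]hcomp1r -fcw hcompA vcf hcomp1l.
have yn : lpow (L := modl A) (hcomp (amap f) c) n = 0.
  by have h := am0_pow (f := f) x n; rewrite xn am0_0 in h; exact: (esym h).
have inv : invertible (L := modl A) (hid _ - hcomp (amap f) c) := geometric yn.
apply: (invertible_proper inv); apply/subvP => _ /memv_imgP [z _ ->].
rewrite -rk memv_ker.
by rewrite Hom_addE Hom_oppE hidE linearB /= subr_eq0 -{1}rfc !hcompE.
Qed.

(** Let U + ker f be everything. Then f = f c for some c with values in U, and
    (1 - c, 0) is an endomorphism of f. It is not invertible, hence it is
    nilpotent; so c is invertible. *)
Lemma lker_superfluous : hid (atgt f) <> 0 -> superfluous (lker (vsval (amap f))).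
Proof.
move=> f0 U Us Uf.
pose i := sub_incl Us.
have hU : (limg (vsval (amap f)) <= limg (vsval (hcomp (amap f) i)))%VS.
  apply/subvP => _ /memv_imgP [y _ ->].
  have : y \in (U + lker (vsval (amap f)))%VS by rewrite Uf memvf.
  move=> /memv_addP [u uU [v]]; rewrite memv_ker => /eqP fv ->.
  have -> : vsval (amap f) (u + v) = vsval (amap f) u by rewrite linearD /= fv addr0.
  apply/memv_imgP.
  exists (vsproj U u : sub_module Us); first exact: memvf.
  by rewrite [RHS]hcompE sub_inclE vsprojK.
have Ks := submod_limg (f := hcomp (amap f) i).
have es : hom_surj (corestrict Ks (subvv _)).
  apply: surjP => y; have /memv_imgP [z _ e] := subvsP (y : subvs_of (limg (vsval (hcomp (amap f) i)))).
  by exists z; apply: subvs_inj; rewrite corestrictE.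
have [c' ec] := @pmod_proj _ _ (asrc f) _ _ _ (corestrict Ks hU) es.
pose c : Hom (asrc f) (asrc f) := hcomp i c'.
have fc' z : vsval (amap f) (vsval c z) = vsval (amap f) z.
  have e := congr1 vsval (Hom_congr z ec).
  by rewrite hcompE !corestrictE hcompE in e; rewrite hcompE.
have e : hcomp (0 : Hom (atgt f) (atgt f)) (amap f) = hcomp (amap f) (hid _ - c).
  apply: Hom_ext => z; rewrite !hcompE Hom_zeroE Hom_addE Hom_oppE hidE linearB /=.
  by rewrite fc' subrr.
pose x := @mk_sq _ (prjl A) f f (hid _ - c) 0 e.
case: (indec_local (L := arrl (prjl A)) x fi) => [/invertible_am [_ [w [w1 _]]]|[n xn]].
  case: f0; rewrite -[LHS]w1.
  by apply: Hom_ext => z; rewrite [LHS]hcompE !Hom_zeroE linear0.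
have yn : lpow (L := modl A) (hid _ - c) n = 0.
  by have h := am1_pow (f := f) x n; rewrite xn am1_0 in h; exact: (esym h).
have inv : invertible (L := modl A) (hid _ - (hid _ - c)) := geometric yn.
apply: (invertible_proper inv); apply/subvP => _ /memv_imgP [z _ ->].
rewrite opprB addrC subrK hcompE sub_inclE; exact: subvsP.
Qed.

End Minimal.

End Cokernel.

(** * The transpose and the Auslander-Reiten translate *)
Section RightQuotient.
Variables (k : fieldType) (A : falgType k) (Q : rmodule A) (U : {vspace Q}).
Hypothesis Us : forall a x, x \in U -> ract x a \in U.

Definition rquo_act (x : quo_sort U) (a : A) : quo_sort U := quo_fun U (ract (vsval x) a).

Lemma ractB (x y : Q) a : ract x a - ract y a = ract (x - y) a.
Proof.
by rewrite -[- ract y a]scaleN1r addrC -ract_linearl scaleN1r addrC.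
Qed.

Lemma rquo_actE x a : rquo_act (quo_fun U x) a = quo_fun U (ract x a).
Proof. by apply: quo_fun_eq; rewrite ractB; apply: Us; exact: quo_fun_lift. Qed.

Fact rquo_linearl a c x y : rquo_act (c *: x + y) a = c *: rquo_act x a + rquo_act y a.
Proof. by rewrite /rquo_act linearP ract_linearl linearP. Qed.

Fact rquo_linearr x : linear (rquo_act x).
Proof. by move=> c a b; rewrite /rquo_act ract_linearr linearP. Qed.

Fact rquo_act1 x : rquo_act x 1 = x.
Proof. by rewrite /rquo_act ract1 quo_fun_surj. Qed.

Fact rquo_actM x a b : rquo_act x (a * b) = rquo_act (rquo_act x a) b.
Proof. by rewrite -[rquo_act x a]/(quo_fun U _) rquo_actE /rquo_act ractM. Qed.

Definition rquo : rmodule A := RModule rquo_linearl rquo_linearr rquo_act1 rquo_actM.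

Definition rquo_map : 'Hom(Q, rquo) := linfun (quo_fun U).

Lemma rquo_mapE x : rquo_map x = quo_fun U x. Proof. exact: lfunE. Qed.

Lemma rquo_map_act x a : rquo_map (ract x a) = ract (rquo_map x) a.
Proof. by rewrite !rquo_mapE [RHS]rquo_actE. Qed.

Lemma rquo_map_surj (y : rquo) : exists x, y = rquo_map x.
Proof. by exists (vsval (y : quo_sort U)); rewrite rquo_mapE quo_fun_surj. Qed.

Lemma rquo_map_ker x : rquo_map x = 0 <-> x \in U.
Proof. by rewrite rquo_mapE -quo_fun_ker; split=> /eqP. Qed.

End RightQuotient.

Section Transpose.
Variables (k : fieldType) (A : falgType k).
Implicit Types M N : module A.

Lemma dual_basis (P : module A) : projective P ->
  exists n (y : 'I_n -> P) (h : 'I_n -> Hom P (reg A)),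
    forall x, x = \sum_i mact (vsval (h i) x : A) (y i).
Proof.
move=> Pp; have [n [F [[inj [prj [h1 h2 h3]]] [i [p pi]]]]] := projective_retract_free Pp.
exists n, (fun j => vsval (hcomp p (inj j)) (1 : A)), (fun j => hcomp (prj j) i) => x.
have e : p ** (\sum_j inj j ** prj j) ** i = lid (l := modl A) P.
  by rewrite h3 lcomp1r; exact: pi.
rewrite lcomp_sumr lcomp_suml in e.
transitivity (vsval (hid P) x); first by rewrite hidE.
rewrite -[hid P]e linear_sum sum_lfunE; apply: eq_bigr => j _.
rewrite -[LHS]/(vsval (hcomp (hcomp p (hcomp (inj j) (prj j))) i) x).
rewrite !hcompE -HomE -HomE; congr (vsval p (vsval (inj j) _)).
by rewrite /= mulr1.
Qed.

Variables (P1 P0 M : module A) (f : Hom P1 P0) (q : Hom P0 M).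
Hypotheses (P1p : projective P1) (P0p : projective P0).
Hypothesis (qf : hcomp q f = 0).

Definition pullbacks : {vspace (star P1)} :=
  limg (linfun (rcomp (L := modl A) (Z := reg A) f)).

Lemma pullbacksP (h : Hom P1 (reg A)) :
  h \in pullbacks <-> exists h0 : Hom P0 (reg A), h = hcomp h0 f.
Proof.
split=> [/memv_imgP [h0 _ ->]|[h0 ->]]; first by exists h0; rewrite lfunE.
by apply/memv_imgP; exists h0; rewrite ?memvf // lfunE.
Qed.

Lemma pullbacks_act a (h : star P1) : h \in pullbacks -> ract h a \in pullbacks.
Proof.
move=> /pullbacksP [h0 ->]; apply/pullbacksP; exists (star_act h0 a).
apply: Hom_ext => x; rewrite -[ract _ a]/(star_act (hcomp h0 f) a).
by rewrite [LHS]star_actE [RHS]hcompE [RHS]star_actE hcompE.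
Qed.

Definition transpose : rmodule A := rquo pullbacks_act.
Definition transpose_map : 'Hom(star P1, transpose) := rquo_map pullbacks_act.

Lemma transposeP : minimal_presentation f q -> is_transpose M transpose.
Proof.
move=> mp; exists P1, P0, f, q, transpose_map; split=> //.
- by move=> h a; exact: rquo_map_act.
- apply/vspaceP => y; rewrite memvf; have [x ->] := rquo_map_surj y.
  exact: memv_img (memvf _).
- by move=> h; apply: (iff_trans (rquo_map_ker _ _)); exact: pullbacksP.
Qed.

Hypothesis rig : forall x : Hom P1 P0,
  exists a b, x = hcomp a f + hcomp f b.

(** A map from M to D(Tr M) gives a functional phi on P0 x Hom(P1, A) that is
    balanced over A, that is, a functional on Hom(P1, P0). It kills the maps a
    f because they vanish in Tr M, and the maps f b because it comes from M;
    by assumption these span. Dual bases take the place of the tensor product.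
    *)
Lemma hom_tau_zero : hom_surj q -> hom_zero M (dual transpose).
Proof.
move=> qs u.
have [n [y [h hy]]] := dual_basis P0p.
have [m [z [l lz]]] := dual_basis P1p.
pose phi (x : P0) (g : Hom P1 (reg A)) : k :=
  (vsval (hcomp u q) x : 'Hom(transpose, k^o)) (transpose_map g).
have phi_suml (I : finType) (x : I -> P0) g : phi (\sum_i x i) g = \sum_i phi (x i) g.
  by rewrite /phi linear_sum sum_lfunE.
have phi_sumr (I : finType) x (g : I -> Hom P1 (reg A)) :
    phi x (\sum_i g i) = \sum_i phi x (g i).
  by rewrite /phi !linear_sum.
have phi_act x a g : phi (mact a x) g = phi x (star_act g a).
  rewrite /phi HomE -[LHS]/(dual_act a _ _) dual_actE; congr (_ _).
  by rewrite -[star_act g a]/(ract (g : star P1) a) rquo_map_act.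
have phi_pull x g0 : phi x (hcomp g0 f) = 0.
  rewrite /phi; have -> : transpose_map (hcomp g0 f) = 0.
    by apply/rquo_map_ker/pullbacksP; exists g0.
  by rewrite linear0.
have phi_f x g : phi (vsval f x) g = 0.
  rewrite /phi -hcompE -hcompA qf hcompE Hom_zeroE linear0; exact: (zero_lfunE k^o _).
suff phi0 x g : phi x g = 0.
  apply: (surj_cancel qs); apply: Hom_ext => x.
  apply/lfunP => v; have [g ->] := rquo_map_surj v.
  rewrite -[LHS]/(phi x g) phi0 hcompE Hom_zeroE; exact: (esym (zero_lfunE k^o _)).
have [a [b ab]] := rig (hcomp (elt x) g).
have e1 : phi x g = \sum_i phi (y i) (hcomp (h i) (hcomp (elt x) g)).
  rewrite {1}(hy x) phi_suml; apply: eq_bigr => i _; rewrite phi_act; congr phi.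
  apply: Hom_ext => c; rewrite star_actE !hcompE eltE HomE //.
rewrite e1 ab.
have e2 i : hcomp (h i) (hcomp a f + hcomp f b) =
    hcomp (hcomp (h i) a) f + \sum_j star_act (hcomp (l j) b) (vsval (h i) (vsval f (z j)) : A).
  have -> : hcomp (h i) (hcomp a f + hcomp f b) =
      hcomp (h i) (hcomp a f) + hcomp (h i) (hcomp f b).
    exact: (lcompDr (L := modl A)).
  rewrite hcompA; congr (_ + _); apply: Hom_ext => c.
  rewrite linear_sum sum_lfunE !hcompE {1}(lz (vsval b c)) !linear_sum.
  apply: eq_bigr => j _; rewrite star_actE hcompE.
  by rewrite -[LHS]/(vsval (h i) (vsval f (mact _ _))) !HomE.
transitivity (\sum_i \sum_j phi (mact (vsval (h i) (vsval f (z j)) : A) (y i)) (hcomp (l j) b)).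
  apply: eq_bigr => i _; rewrite e2.
  have -> : phi (y i) (hcomp (hcomp (h i) a) f + \sum_j star_act (hcomp (l j) b)
      (vsval (h i) (vsval f (z j)) : A)) = phi (y i) (hcomp (hcomp (h i) a) f) +
      phi (y i) (\sum_j star_act (hcomp (l j) b) (vsval (h i) (vsval f (z j)) : A)).
    by rewrite /phi !linearD.
  by rewrite phi_pull add0r phi_sumr; apply: eq_bigr => j _; rewrite phi_act.
rewrite exchange_big big1 // => j _ /=.
by rewrite -phi_suml -hy phi_f.
Qed.

Lemma tau_rigid : minimal_presentation f q ->
  exists2 N, is_tau M N & hom_zero M N.
Proof.
move=> mp; exists (dual transpose).
  by exists transpose; [exact: transposeP | exact: (isom_refl (L := modl A))].
by apply: hom_tau_zero; case: mp.
Qed.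

End Transpose.

(** * Support tau-tilting modules from rigid families *)
Section ModuleSums.
Variables (k : fieldType) (A : falgType k).
Implicit Types M N : module A.

Lemma sum_elements (I : finType) (Y : I -> module A) X
    (inj : forall i, Hom (Y i) X) (prj : forall i, Hom X (Y i)) x :
  \sum_i (inj i : lhom (l := modl A) _ _) ** prj i = lid (X : modl A) ->
  x = \sum_i vsval (inj i) (vsval (prj i) x).
Proof.
move=> e; transitivity (vsval (hid X) x); first by rewrite hidE.
rewrite -[hid X]e linear_sum sum_lfunE; apply: eq_bigr => i _.
exact: hcompE.
Qed.

Lemma num_summands_dsum n (Y : 'I_n -> module A) X :
  dsum (L := modl A) Y X -> (forall i, indec (L := modl A) (Y i)) ->
  (forall i j, isom (L := modl A) (Y i) (Y j) -> i = j) ->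
  num_summands (C := modcat A) X n.
Proof.
move=> YX Yi Yn; exists Y; split=> //.
  by move=> i; split; [exact: Yi | apply/(summandP (L := modl A)); exact: dsum_inj_retract YX].
move=> Z Zi /(summandP (L := modl A)) ZX.
exact: (indec_dsum_isom (L := modl A) Zi ZX YX Yi).
Qed.

Lemma coker_dsum (I : finType) (F : I -> arrow (prjl A)) (M : I -> module A)
    (q : forall i, Hom (atgt (F i)) (M i)) X MM :
  (forall i, coker (q i)) -> dsum (L := arrl (prjl A)) F X ->
  dsum (L := modl A) M MM -> exists Q : Hom (atgt X) MM, coker Q.
Proof.
move=> qc [inj [prj [h1 h2 h3]]] [injM [prjM [g1 g2 g3]]].
have tgt : [/\ forall i, am0 (prj i) ** am0 (inj i) = lid _,
    forall i j, i != j -> am0 (prj j) ** am0 (inj i) = 0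
    & \sum_i am0 (inj i) ** am0 (prj i) = lid _].
  split=> [i|i j ij|].
  - exact: (congr1 (@am0 _ _ _ _) (h1 i)).
  - exact: (etrans (congr1 (@am0 _ _ _ _) (h2 i j ij)) (am0_0 _ _)).
  - by rewrite -[RHS](congr1 (@am0 _ _ _ _) h3) am0_sum.
have [t1 t2 t3] := tgt.
pose Q : Hom (atgt X) MM := \sum_i injM i ** (hcomp (q i) (am0 (prj i)) : lhom (l := modl A) _ _).
have prjQ i : hcomp (prjM i) Q = hcomp (q i) (am0 (prj i)).
  exact: (prj_sum_inj (L := modl A) (fun i => hcomp (q i) (am0 (prj i))) i g1 g2).
exists Q; split.
  apply: surjP => y.
  have hz i : {z | vsval (prjM i) y = vsval (q i) z}.
    by apply: cid; have [z ->] := surj_exists (vsval (prjM i) y) (qc i).1; exists z.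
  exists (\sum_i vsval (am0 (inj i)) (sval (hz i))).
  rewrite [LHS](sum_elements y g3) [RHS](sum_elements _ g3).
  apply: eq_bigr => i _; congr (vsval (injM i) _).
  rewrite -[RHS]hcompE prjQ hcompE (svalP (hz i)); congr (vsval (q i) _).
  rewrite linear_sum (bigD1 i) //= big1 ?addr0 => [|j ji].
    by rewrite -hcompE -[LHS]hidE; exact: (Hom_congr _ (esym (t1 i))).
  rewrite -hcompE; have -> : hcomp (am0 (prj i)) (am0 (inj j)) = 0 by exact: t2.
  exact: Hom_zeroE.
apply/vspaceP => x; apply/idP/idP => [/memv_imgP [y _ ->]|].
  rewrite memv_ker (sum_elements (vsval Q _) g3) big1 // => i _.
  rewrite -[vsval (prjM i) _]hcompE prjQ hcompE -[vsval (am0 (prj i)) _]hcompE.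
  have -> : hcomp (am0 (prj i)) (amap X) = hcomp (amap (F i)) (am1 (prj i)) := amE (prj i).
  by rewrite hcompE -[vsval (q i) _]hcompE (coker0 (qc i)) Hom_zeroE linear0.
rewrite memv_ker => /eqP Qx.
rewrite (sum_elements x t3); apply: memv_suml => i _.
have : vsval (am0 (prj i)) x \in lker (vsval (q i)).
  by rewrite memv_ker -hcompE -prjQ hcompE Qx linear0.
rewrite -(qc i).2 => /memv_imgP [y _ ->].
rewrite -hcompE.
have -> : hcomp (am0 (inj i)) (amap (F i)) = hcomp (amap X) (am1 (inj i)) := amE (inj i).
by rewrite hcompE; apply: memv_img (memvf _).
Qed.

Lemma superfluous_dsum (I : finType) (F : I -> arrow (prjl A)) X :
  dsum (L := arrl (prjl A)) F X ->
  (forall i, superfluous (limg (vsval (amap (F i))))) ->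
  (forall i, superfluous (lker (vsval (amap (F i))))) ->
  superfluous (limg (vsval (amap X))) /\ superfluous (lker (vsval (amap X))).
Proof.
move=> [inj [prj [h1 h2 h3]]] Fl Fk.
have t3 : \sum_i am0 (inj i) ** am0 (prj i) = lid _.
  by rewrite -[RHS](congr1 (@am0 _ _ _ _) h3) am0_sum.
have s3 : \sum_i am1 (inj i) ** am1 (prj i) = lid _.
  by rewrite -[RHS](congr1 (@am1 _ _ _ _) h3) am1_sum.
have img_sub M N (i : Hom M N) (U : {vspace M}) : submod U -> submod (vsval i @: U)%VS.
  move=> Us a _ /memv_imgP [x xU ->]; rewrite -HomE.
  by apply: memv_img; apply: Us.
have prjX i x : vsval (am0 (prj i)) (vsval (amap X) x) = vsval (amap (F i)) (vsval (am1 (prj i)) x).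
  by rewrite -!hcompE; exact: (Hom_congr x (amE (prj i))).
split.
  apply: (@superfluous_sub _ _ _ _ (\sum_i vsval (am0 (inj i)) @: limg (vsval (amap (F i))))%VS).
    apply/subvP => _ /memv_imgP [x _ ->]; rewrite (sum_elements (vsval (amap X) x) t3).
    apply: memv_sumr => i _; apply: memv_img; rewrite prjX.
    exact: memv_img (memvf _).
  apply: superfluous_sum => i; first by apply: img_sub; exact: submod_limg.
  exact: superfluous_image.
apply: (@superfluous_sub _ _ _ _ (\sum_i vsval (am1 (inj i)) @: lker (vsval (amap (F i))))%VS).
  apply/subvP => x; rewrite memv_ker => /eqP Xx.
  rewrite (sum_elements x s3).
  apply: memv_sumr => i _; apply: memv_img.
  by rewrite memv_ker -prjX Xx linear0.
apply: superfluous_sum => i; first by apply: img_sub; exact: submod_lker.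
exact: superfluous_image.
Qed.

End ModuleSums.

Section SupportTauTilting.
Variables (k : closedFieldType) (A : falgType k) (t : nat) (P : 'I_t -> module A).
Hypothesis hP : indec_projectives P.

Lemma num_summands_reg : num_summands (C := modcat A) (reg A) t.
Proof.
exists P; split=> //.
- move=> i; split; first exact: (P_indec hP i).
  apply/(summandP (L := modl A)).
  have [n [F [hF PF]]] := projective_retract_free (@P_proj _ _ _ _ hP i).
  by have [] := retract_exchange (P_indec hP i) PF hF.
- by move=> i j; exact: (P_noniso hP).
move=> Z Zi /(summandP (L := modl A)) Zr; apply: (P_all hP) => //.
exact: (projective_retract Zr (@reg_projective _ A)).
Qed.

Variable T : 'I_t -> arrow (prjl A).
Hypothesis HT : rigid_family T.

(** The members of T with a nonzero cokernel add up to a minimal presentation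
    of M. The other members have zero targets, and their sources add up to the
    projective module P with Hom(P, M) = 0. Together there are t of them, as
    many as indecomposable projectives. *)
Lemma rigid_support_tau_tilting :
  exists (M : module A) (X : arrow (prjl A)) (Q : Hom (atgt X) M),
  [/\ basic (C := modcat A) M, support_tau_tilting M, coker Q, generates T X
    & forall s, exists (N : module A) (q : Hom (atgt (T s)) N) (p : Hom M N),
      coker q /\ hom_surj p].
Proof.
have [T1 T2 T3 T4] := HT.
pose cM s := cid (coker_exists (T s)); pose M s : module A := sval (cM s).
pose q s : Hom (atgt (T s)) (M s) := sval (cid (svalP (cM s))).
have qc s : coker (q s) := svalP (cid (svalP (cM s))).
pose S1 := [set s | ~~ `[< hid (M s) = 0 >]].
have inS1 s : s \in S1 -> hid (M s) <> 0.
  by rewrite finset.in_set => /negP h e; apply: h; apply/asboolP.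
have ninS1 s : s \notin S1 -> hid (M s) = 0.
  by rewrite finset.in_set negbK => /asboolP.
pose T' (i : 'I_#|S1|) := T (enum_val i).
pose M' (i : 'I_#|S1|) := M (enum_val i).
have M'n i : hid (M' i) <> 0 by apply: inS1; exact: enum_valP.
have [X hX] := dsum_exists (L := arrl (prjl A)) T'.
have [MM hMM] := dsum_exists (L := modl A) M'.
have [Q Qc] := coker_dsum (fun i : 'I_#|S1| => qc (enum_val i)) hX hMM.
have M'i i : indec (L := modl A) (M' i).
  exact: (coker_indec (T2 _) (qc _) (M'n i)).
have M'iso i j : isom (L := modl A) (M' i) (M' j) -> i = j.
  move=> e; apply: enum_val_inj; apply: T4.
  exact: (coker_noniso (T2 _) (T2 _) (qc _) (qc _) (M'n i) e).
have XX : orth X X.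
  apply: (orth_dsum_l hX) => i; apply: (orth_dsum_r hX) => j; exact: T1.
have tgt0 s : s \notin S1 -> hid (atgt (T s)) = 0.
  by move=> /ninS1; exact: (coker_zero_tgt (T2 s) (T3 s) (qc s)).
have tgt1 i : hid (atgt (T' i)) <> 0.
  move=> e; apply: (M'n i); apply: (surj_cancel (qc _).1).
  apply: Hom_ext => x.
  have -> : x = 0 by have := Hom_congr x e; rewrite hidE Hom_zeroE.
  by rewrite !linear0.
have [sl sk] : superfluous (limg (vsval (amap X))) /\ superfluous (lker (vsval (amap X))).
  apply: (superfluous_dsum hX) => i.
    exact: (limg_superfluous (T2 _) (T3 _)).
  exact: (lker_superfluous (T2 _) (tgt1 i)).
have mp : minimal_presentation (amap X) Q.
  split=> //; [by split; exact: pmod_proj | exact: Qc.1 | exact: Qc.2 |].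
  by rewrite -Qc.2.
pose T0 (i : 'I_#|~: S1|) := T (enum_val i).
have T0n i : hid (atgt (T0 i)) = 0.
  by apply: tgt0; have := enum_valP i; rewrite finset.in_setC.
have [PM hPM] := dsum_exists (L := prjl A) (fun i => asrc (T0 i)).
exists MM, X, Q; split=> //.
- by exists #|S1|, M'; split=> // i j; exact: M'iso.
- split; first apply: (tau_rigid (@pmod_proj _ _ (asrc X)) (@pmod_proj _ _ (atgt X)) (coker0 Qc) _ mp).
    by move=> x; have [a [b ->]] := XX x; exists a, b.
  exists PM; split; first exact: pmod_proj.
    move=> g; have [inj [prj [h1 h2 h3]]] := hPM.
    have [injM [prjM [g1 g2 g3]]] := hMM.
    have zero i j : hcomp (prjM j) (hcomp g (inj i)) = 0.
      have [w wq] := @pmod_proj _ _ (asrc (T0 i)) _ _ (q (enum_val j))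
        (hcomp (prjM j) (hcomp g (inj i))) (qc _).1.
      have [a [b ab]] := T1 (enum_val i) (enum_val j) w.
      rewrite -wq ab -[_ + _]/(hcomp a (amap (T0 i)) + hcomp (amap (T' j)) b).
      have -> : amap (T0 i) = 0 by exact: (zero_module_hom _ (T0n i)).
      have -> : hcomp a (0 : Hom (asrc (T0 i)) _) = 0 by exact: (lcomp0r (L := modl A)).
      rewrite add0r hcompA (coker0 (qc _)); exact: (lcomp0l (L := modl A)).
    have zero' i : hcomp g (inj i) = 0.
      apply: Hom_ext => x; rewrite (sum_elements (vsval (hcomp g (inj i)) x) g3) Hom_zeroE big1 // => j _.
      by rewrite -[vsval (prjM j) _]hcompE zero Hom_zeroE linear0.
    apply: Hom_ext => x; rewrite (sum_elements x h3) linear_sum Hom_zeroE big1 // => i _.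
    by rewrite -[LHS]hcompE zero' Hom_zeroE.
  exists #|~: S1|, #|S1|, t; split.
  + apply: (num_summands_dsum hPM).
      by move=> i; apply: (zero_tgt_indec (T2 _) (T0n i)).
    move=> i j e; apply: enum_val_inj; apply: T4.
    exact: (zero_tgt_isom (T0n i) (T0n j) e).
  + exact: (num_summands_dsum hMM M'i M'iso).
  + exact: num_summands_reg.
  + by rewrite addnC cardsC card_ord.
- exists #|S1|, (fun i => enum_val i), X, (arrow_id X); split; first exact: hX.
  by apply: (@epi_arrow_retract _ _ _ _ (arrow_id _)); exact: acomp1l.
move=> s; exists (M s), (q s).
case: (boolP (s \in S1)) => sS1.
  have := dsum_inj_retract (enum_rank_in sS1 s) hMM.
  rewrite /M' enum_rankK_in // => -[i [p pi]]; exists p; split=> //.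
  apply: surjP => y; exists (vsval i y).
  by rewrite -hcompE [hcomp p i]pi hidE.
exists 0; split=> //; apply: surjP => y; exists 0.
by rewrite linear0 -[y]hidE (ninS1 _ sS1) Hom_zeroE.
Qed.

End SupportTauTilting.

Section TauTiltingFinite.
Variables (k : closedFieldType) (A : falgType k) (t : nat) (P : 'I_t -> module A).
Hypothesis hP : indec_projectives P.
Hypothesis hA : weakly_symmetric A.

(** The R0 i are presentations of the modules in the given finite list;
    isomorphic modules have the same factor modules. *)
Lemma tau_finite_factors : tau_tilting_finite A -> finitely_many_factors (prjl A) t.
Proof.
move=> [n [N fin]].
have hR i := cid (coker_presentation (N i)).
exists n, (fun i => sval (hR i)) => T HT.
have [M [X [Q [Mb Mt Qc TX MT]]]] := rigid_support_tau_tilting hP HT.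
have [i [u [v [vu uv]]]] := fin M Mb Mt.
exists i; have [r rc] := svalP (hR i).
have us : hom_surj u by apply: invertible_surj; exists v.
have vs : hom_surj v by apply: invertible_surj; exists u.
split.
  have [x xu] := coker_lift u Qc rc.
  exact: (generates_epi (coker_epi Qc rc us xu) TX).
move=> s; have [M' [q [p [qc ps]]]] := MT s.
have [x xu] := coker_lift (hcomp p v) rc qc; exists x.
apply: (coker_epi rc qc _ xu); apply: surjP => y.
have [z ->] := surj_exists y ps; have [z' ->] := surj_exists z vs.
by exists z'; rewrite hcompE.
Qed.

Lemma tau_finite_positive (R : realFieldType) (v : 'I_t -> R) :
  tau_tilting_finite A -> (exists j, v j != 0) ->
  0 < \sum_i \sum_j v i * v j * (cartan_nat P i j)%:R.
Proof.
move=> /tau_finite_factors fin vn.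
have PPi i : indec (L := prjl A) (PP hP i).
  by apply/indec_prjl_modl; exact: (P_indec hP i).
exact: (cartan_positive (@closed_infinite k) (@mult_dsum _ _ _ _ hP hA)
  (@mult_isom _ _ _ _ hP hA) (@mult_P _ _ _ _ hP hA) PPi (@hom_mult _ _ _ _ hP hA)
  (@forms_exist _ _ _ _ hP hA) fin vn).
Qed.

End TauTiltingFinite.

(** * Homotopy summands of two-term complexes *)
Section LinearAlgebra.
Variable k : fieldType.

(** The map a induces an injection from K / B to K' / B'. *)
Lemma quotient_dim_le (V V' : vectType k) (K B : {vspace V}) (K' B' : {vspace V'})
    (a : 'Hom(V, V')) :
  (B <= K)%VS -> (B' <= K')%VS ->
  (forall x, x \in K -> a x \in K') -> (forall x, x \in B -> a x \in B') ->
  (forall x, x \in K -> a x \in B' -> x \in B) ->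
  (\dim K + \dim B' <= \dim K' + \dim B)%N.
Proof.
move=> BK BK' aK aB aI.
pose qu : 'Hom(V', quo_sort B') := linfun (quo_fun B').
have quE y : (qu y == 0) = (y \in B') by rewrite lfunE /= quo_fun_ker.
have e1 := limg_ker_dim (qu \o a) K.
have -> : \dim K = (\dim B + \dim ((qu \o a) @: K))%N.
  rewrite -e1; congr (\dim _ + _)%N; apply/vspaceP => x.
  rewrite memv_cap memv_ker comp_lfunE quE.
  by apply/andP/idP => [[xK /(aI x xK)]|xB] //; split; [exact: (subvP BK) | exact: aB].
have e2 := limg_ker_dim qu K'.
have -> : \dim K' = (\dim B' + \dim (qu @: K'))%N.
  rewrite -e2; congr (\dim _ + _)%N; apply/vspaceP => x.
  by rewrite memv_cap memv_ker quE; apply/andP/idP => [[]|xB] //; split=> //; exact: (subvP BK').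
have : (\dim ((qu \o a) @: K) <= \dim (qu @: K'))%N.
  apply: dimvS; apply/subvP => _ /memv_imgP [x xK ->]; rewrite comp_lfunE.
  by apply: memv_img; exact: aK.
by lia.
Qed.

End LinearAlgebra.

Lemma alternating_telescope (r : nat -> int) m :
  \sum_(l < m) (-1) ^+ l * (r l + r l.+1) = r 0%N - (-1) ^+ m * r m.
Proof.
elim: m => [|m IH]; first by rewrite big_ord0 expr0 mul1r subrr.
by rewrite big_ord_recr /= IH exprS; ring.
Qed.

Lemma sign_distance (l n : nat) : (-1) ^+ `|l%:Z - n%:Z|%N = (-1) ^+ n * (-1) ^+ l :> int.
Proof.
rewrite -exprD; case: (leqP n l) => h.
  have -> : `|l%:Z - n%:Z|%N = (l - n)%N by rewrite distnEl.
  by rewrite -signr_odd oddB // -[RHS]signr_odd oddD addbC.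
have -> : `|l%:Z - n%:Z|%N = (n - l)%N by rewrite distnEr // (ltnW h).
by rewrite -signr_odd oddB ?(ltnW h) // -[RHS]signr_odd oddD.
Qed.

(** Think of a bounded complex with terms of dimensions c and differentials of
    ranks r. It is exact outside the degrees -1 and 0, where it has the
    cohomology of a two-term complex with terms of dimensions d1, d0 and
    differential of rank s. The ranks cancel in the alternating sum. *)
Lemma alternating_euler (c r : int -> nat) (n s d0 d1 : nat) :
  (forall j, j <> -1 -> j <> 0 -> c j = (r (j - 1)%R + r j)%N) ->
  (c (-1)%R + s = r (Negz 1) + r (-1)%R + d1)%N ->
  (c 0%R + s = r (-1)%R + r 0%R + d0)%N ->
  (forall j, (n < `|j|)%N -> c j = 0%N) ->
  (forall j, (r j <= c j)%N) -> (forall j, (r j <= c (j + 1)%R)%N) ->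
  \sum_(l < n.*2.+1) (let i := l%:Z - n%:Z in (-1) ^+ `|i|%N * (c i)%:Z) =
    d0%:Z - d1%:Z.
Proof.
move=> cE c1 c0 cn rc rc1; pose R (l : nat) : int := (r (l%:Z - n%:Z - 1))%:Z.
pose E (m : nat) (x : int) (l : nat) : int := if l == m then x else 0.
(* the two boundary terms of the telescoping sum vanish, since the complex is
   zero in degrees beyond n *)
have Rn0 : R 0%N = 0.
  by rewrite /R; have := rc (0%:Z - n%:Z - 1); rewrite cn ?leqn0 => [/eqP ->|]; lia.
have Rn1 : R n.*2.+1 = 0.
  rewrite /R; have := rc1 (n.*2.+1%:Z - n%:Z - 1).
  by rewrite cn ?leqn0 => [/eqP ->|]; lia.
have termE (l : nat) : (c (l%:Z - n%:Z))%:Z =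
    R l + R l.+1 + E n (d0%:Z - s%:Z) l + E n (d1%:Z - s%:Z) l.+1.
  have -> : R l.+1 = (r (l%:Z - n%:Z))%:Z by rewrite /R; congr (Posz (r _)); lia.
  rewrite /R /E; case: (eqVneq l n) => [->|ln].
    rewrite subrr sub0r [X in _ = _ + X]ifF; last by apply/eqP; lia.
    by rewrite addr0; move: (c 0) (r (-1)) (r 0) c0 => x y z; lia.
  case: (eqVneq l.+1 n) => [<-|ln1].
    have -> : l%:Z - l.+1%:Z = -1 by lia.
    have -> : (-1 - 1 : int) = Negz 1 by [].
    by move: (c (-1)) (r (-1)) (r (Negz 1)) c1 => x y z; lia.
  rewrite cE; [by rewrite PoszD !addr0 | by move: ln1; lia | by move: ln; lia].
under eq_bigr => l _ do rewrite /= sign_distance termE -!mulrA.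
rewrite -mulr_sumr.
under eq_bigr => l _ do rewrite 2!mulrDr.
rewrite !big_split /= alternating_telescope Rn0 Rn1 mulr0 subrr add0r.
have sgn : (-1) ^+ n * (-1) ^+ n = 1 :> int by rewrite -expr2 -exprM mulnC exprM sqrrN expr1n.
have nlt : (n < n.*2.+1)%N by lia.
rewrite (bigD1 (Ordinal nlt)) //= [X in _ + X + _]big1 => [|l ln]; last first.
  by rewrite /E ifF ?mulr0 //; apply/eqP => e; case/eqP: ln; apply: val_inj.
rewrite /E eqxx addr0 mulrDr mulrA sgn mul1r.
case: n {termE R E Rn0 Rn1 sgn} nlt cn => [|n] nlt cn.
  rewrite big1 => [|l _]; last by rewrite !mulr0.
  rewrite mulr0 addr0.
  have q1 : (r (Negz 1) <= c (-1)%R)%N := rc1 (Negz 1).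
  move: (c (-1)) (r (-1)) (r (Negz 1)) c1 (cn (-1) isT) (rc (-1)) q1 => x y z.
  by lia.
have nlt' : (n < n.+1.*2.+1)%N by lia.
rewrite (bigD1 (Ordinal nlt')) //= big1 => [|l ln]; last first.
  by rewrite ifF ?mulr0 //; apply/eqP => -[e]; case/eqP: ln; apply: val_inj.
rewrite eqxx addr0 exprS mulrA -[_ * (-1) ^+ n]mulrA.
have -> : (-1) ^+ n * (-1) ^+ n = 1 :> int by rewrite -expr2 -exprM mulnC exprM sqrrN expr1n.
by rewrite mulr1 mulN1r; lia.
Qed.

Section IdempotentLifting.
Variables (k : fieldType) (L : lincat k) (X : L) (N : lhom X X -> Prop).
Hypotheses (N_add : forall u v, N u -> N v -> N (u + v))
  (N_l : forall u v, N u -> N (v ** u)) (N_r : forall u v, N u -> N (u ** v)).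

(** Modulo the ideal N the powers of x are congruent to x, and so is the
    idempotent x^n y of [fitting_idempotent]. *)
Lemma lift_idempotent (x : lhom X X) : N (x ** x - x) ->
  exists e, e ** e = e /\ N (e - x).
Proof.
move=> Nx; have [n [y [z [n0 ay za]]]] := fitting_idempotent x.
set a := lpow x n in ay za.
have azay : z ** a = a ** y by rewrite -{1}ay !lcompA za.
have ee : (a ** y) ** (a ** y) = a ** y.
  by rewrite -{1}azay -lcompA [a ** (a ** y)]lcompA ay azay.
have N0 : N 0 by rewrite -(lcomp0l X (x ** x - x)); exact: N_l.
have Na : N (a - x).
  rewrite /a; case: n n0 {a ay za azay ee} => // n _; elim: n => [|n IH].
    by rewrite lpow1 subrr.
  have -> : lpow x n.+2 - x = x ** (lpow x n.+1 - x) + (x ** x - x).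
    by rewrite lcompBr addrA subrK.
  by apply: N_add => //; exact: N_l.
have NN u : N u -> N (- u).
  by move=> Nu; rewrite -[u]lcomp1l -lcompNl; exact: N_l.
have Naa : N (a - a ** a).
  have -> : a - a ** a = (a - x) - (x ** x - x) - ((a - x) ** a + x ** (a - x)).
    by rewrite lcompBl lcompBr addrA subrK !opprB !addrA !subrK.
  apply: N_add; first by apply: N_add => //; exact: NN.
  by apply: NN; apply: N_add; [exact: N_r | exact: N_l].
exists (a ** y); split=> //.
have -> : a ** y - x = (a - a ** a) ** y + (a - x).
  by rewrite lcompBl ay addrA subrK.
by apply: N_add => //; exact: N_r.
Qed.

End IdempotentLifting.

Section CohomologyCompare.
Variables (k : fieldType) (L : lincat k) (N : L).

Definition pull X Y (f : lhom X Y) : 'Hom(lhom Y N, lhom X N) := linfun (rcomp f).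

Lemma pullE X Y (f : lhom X Y) u : pull f u = u ** f. Proof. exact: lfunE. Qed.

Lemma mem_pull X Y (f : lhom X Y) w : reflect (exists u, w = u ** f) (w \in limg (pull f)).
Proof.
apply: (iffP memv_imgP) => [[u _ ->]|[u ->]]; first by exists u; rewrite pullE.
by exists u; rewrite ?memvf // pullE.
Qed.

Lemma mem_pull_ker X Y (f : lhom X Y) w : (w \in lker (pull f)) = (w ** f == 0).
Proof. by rewrite memv_ker pullE. Qed.

Lemma pull_dim X Y (f : lhom X Y) :
  (\dim (lker (pull f)) + \dim (limg (pull f)) = \dim {: lhom Y N})%N.
Proof. by rewrite -(limg_ker_dim (pull f) fullv) capfv. Qed.

Variables (X2 X1 X0 Xp T1 T0 D1 D0 : L).
Variables (x2 : lhom X2 X1) (x1 : lhom X1 X0) (x0 : lhom X0 Xp) (d : lhom T1 T0)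
  (f : lhom D1 D0) (i1 : lhom X1 T1) (i0 : lhom X0 T0) (p1 : lhom T1 X1)
  (p0 : lhom T0 X0) (h2 : lhom X1 X2) (h1 : lhom X0 X1) (h0 : lhom Xp X0)
  (a1 : lhom D1 T1) (a0 : lhom D0 T0) (b1 : lhom T1 D1) (b0 : lhom T0 D0)
  (eta : lhom T0 T1).
Hypotheses (xx1 : x1 ** x2 = 0) (xx0 : x0 ** x1 = 0)
  (ix : i0 ** x1 = d ** i1) (pd : p0 ** d = x1 ** p1)
  (pi0 : p0 ** i0 = lid X0 + (x1 ** h1 + h0 ** x0))
  (pi1 : p1 ** i1 = lid X1 + (x2 ** h2 + h1 ** x1))
  (xp0 : x0 ** p0 = 0) (ix2 : i1 ** x2 = 0)
  (ad : a0 ** f = d ** a1) (bd : b0 ** d = f ** b1)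
  (ba1 : b1 ** a1 = lid D1) (ba0 : b0 ** a0 = lid D0)
  (ab1 : a1 ** b1 = i1 ** p1 + eta ** d) (ab0 : a0 ** b0 = i0 ** p0 + d ** eta).

(** The complex X2 -> X1 -> X0 -> Xp is a retract of d : T1 -> T0 up to the
    homotopy h, through i and p, and f is a retract of d through a and b, with
    a b homotopic to i p by eta. So Hom(X, N) and Hom(f, N) have isomorphic
    cohomology. In degree 0, the maps p0 a0 and b0 i0 induce the isomorphisms.
    *)
Lemma compare0 : (\dim (lker (pull x1)) =
  \dim (lker (pull f)) + \dim (limg (pull x0)))%N.
Proof.
have B0 : (limg (pull x0) <= lker (pull x1))%VS.
  apply/subvP => _ /mem_pull [u ->]; rewrite mem_pull_ker.
  by rewrite -lcompA xx0 lcomp0r.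
have z0 : (0 <= lker (pull f))%VS by exact: sub0v.
apply/eqP; rewrite eqn_leq; apply/andP; split.
  have := @quotient_dim_le _ _ _ _ _ _ _ (pull (p0 ** a0)) B0 z0.
  rewrite dimv0 addn0; apply.
  - move=> u; rewrite !mem_pull_ker pullE => /eqP ux.
    by rewrite -!lcompA ad [p0 ** _]lcompA pd !lcompA ux !lcomp0l.
  - move=> _ /mem_pull [u ->]; rewrite memv0 pullE.
    by rewrite !lcompA -[u ** x0 ** p0]lcompA xp0 lcomp0r lcomp0l.
  move=> u; rewrite mem_pull_ker memv0 pullE => /eqP ux /eqP e.
  have e1 : u ** p0 ** i0 = u + u ** h0 ** x0.
    by rewrite -lcompA pi0 !lcompDr !lcompA ux lcomp0l add0r lcomp1r.
  have : u ** (p0 ** a0) ** b0 ** i0 = 0 by rewrite e !lcomp0l.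
  rewrite -!lcompA [a0 ** _]lcompA ab0 lcompDl !lcompDr !lcompA e1.
  rewrite -[u ** p0 ** d]lcompA pd [u ** (x1 ** _)]lcompA ux !lcomp0l addr0.
  rewrite lcompDl lcompDl -[u ** h0 ** x0 ** p0]lcompA xp0 lcomp0r lcomp0l addr0 e1.
  move=> /eqP; rewrite addr_eq0 => /eqP ->; apply/mem_pull.
  by exists (- (u ** h0)); rewrite lcompNl.
have := @quotient_dim_le _ _ _ _ _ _ _ (pull (b0 ** i0)) z0 B0.
rewrite dimv0 addn0; apply.
- move=> v; rewrite !mem_pull_ker pullE => /eqP vf.
  by rewrite -!lcompA ix [b0 ** _]lcompA bd !lcompA vf !lcomp0l.
- by move=> v; rewrite memv0 => /eqP ->; rewrite linear0 mem0v.
move=> v; rewrite mem_pull_ker pullE memv0 => /eqP vf /mem_pull [u e].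
have : v ** (b0 ** i0) ** p0 ** a0 = 0 by rewrite e -[u ** x0 ** p0]lcompA xp0 lcomp0r lcomp0l.
have -> : v ** (b0 ** i0) ** p0 = v ** b0 ** (a0 ** b0 - d ** eta).
  by rewrite ab0 addrK !lcompA.
rewrite lcompBr lcompBl !lcompA -[v ** b0 ** a0]lcompA ba0 lcomp1r.
rewrite -[v ** b0 ** a0]lcompA ba0 lcomp1r.
rewrite -[v ** b0 ** d]lcompA bd [v ** (f ** _)]lcompA vf !lcomp0l subr0.
by move=> ->.
Qed.

(** The comparison of [compare0] one degree further, where the cohomology is a
    cokernel on the side of f; the maps are p1 a1 and b1 i1. *)
Lemma compare1 : (\dim (lker (pull x2)) + \dim (limg (pull f)) =
  \dim {: lhom D1 N} + \dim (limg (pull x1)))%N.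
Proof.
have B0 : (limg (pull x1) <= lker (pull x2))%VS.
  apply/subvP => _ /mem_pull [u ->]; rewrite mem_pull_ker.
  by rewrite -lcompA xx1 lcomp0r.
have B1 : (limg (pull f) <= fullv)%VS by exact: subvf.
apply/eqP; rewrite eqn_leq; apply/andP; split.
  apply: (@quotient_dim_le _ _ _ _ _ _ _ (pull (p1 ** a1)) B0 B1).
  - by move=> u _; exact: memvf.
  - move=> _ /mem_pull [u ->]; apply/mem_pull; exists (u ** p0 ** a0).
    by rewrite pullE -!lcompA ad [p0 ** _]lcompA pd !lcompA.
  move=> u; rewrite mem_pull_ker pullE => /eqP ux /mem_pull [w e].
  have e1 : u ** p1 ** i1 = u + u ** h1 ** x1.
    by rewrite -lcompA pi1 !lcompDr !lcompA ux lcomp0l add0r lcomp1r.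
  have e2 : u ** (p1 ** a1) ** b1 ** i1 = w ** b0 ** i0 ** x1.
    by rewrite e -!lcompA [f ** _]lcompA -bd ix !lcompA.
  have e3 : u ** (p1 ** a1) ** b1 ** i1 =
      u + u ** h1 ** x1 + u ** h1 ** p0 ** i0 ** x1 + u ** p1 ** eta ** i0 ** x1.
    rewrite -!lcompA [a1 ** _]lcompA ab1 lcompDl !lcompDr !lcompA e1.
    rewrite !lcompDl e1 -[u ** h1 ** x1 ** p1]lcompA -pd -!lcompA -ix !lcompA.
    by [].
  apply/mem_pull; exists (w ** b0 ** i0 - u ** h1 - u ** h1 ** p0 ** i0 - u ** p1 ** eta ** i0).
  rewrite !lcompBl -e2 e3; apply/esym.
  have cancel (V : zmodType) (v a b c : V) : v + a + b + c - a - b - c = v.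
    by rewrite [X in X - b - c]addrAC [X in X - c]addrAC addrK [X in X - b]addrAC !addrK.
  exact: cancel.
apply: (@quotient_dim_le _ _ _ _ _ _ _ (pull (b1 ** i1)) B1 B0).
- move=> v _; rewrite mem_pull_ker pullE -!lcompA ix2 !lcomp0r //.
- move=> _ /mem_pull [w ->]; apply/mem_pull; exists (w ** b0 ** i0).
  by rewrite pullE -!lcompA [f ** _]lcompA -bd ix !lcompA.
move=> v _; rewrite pullE => /mem_pull [u e].
have e1 : v ** (b1 ** i1) ** p1 ** a1 = u ** p0 ** a0 ** f.
  by rewrite e -!lcompA ad [x1 ** _]lcompA -pd !lcompA.
have e2 : v ** (b1 ** i1) ** p1 = v ** b1 ** (a1 ** b1 - eta ** d).
  by rewrite ab1 addrK !lcompA.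
have e3 : v ** (b1 ** i1) ** p1 ** a1 = v - v ** b1 ** eta ** a0 ** f.
  rewrite e2 lcompBr lcompBl !lcompA -[v ** b1 ** a1]lcompA ba1 lcomp1r.
  rewrite -[v ** b1 ** a1]lcompA ba1 lcomp1r; congr (_ - _).
  by rewrite -!lcompA ad.
apply/mem_pull; exists (u ** p0 ** a0 + v ** b1 ** eta ** a0).
by rewrite lcompDl -e1 e3 subrK.
Qed.

End CohomologyCompare.

Section Complexes.
Variables (k : fieldType) (A : falgType k).
Implicit Types (X Y : cplx A).

Lemma dim0_src (M N : module A) (f : Hom M N) : \dim {: M} = 0%N -> f = 0.
Proof.
move=> M0; apply: Hom_ext => x; rewrite Hom_zeroE.
have -> : x = 0; last by rewrite linear0.
have e : ({: M} = 0)%VS by apply/eqP; rewrite -dimv_eq0 M0.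
by apply/eqP; rewrite -memv0 -e memvf.
Qed.

Lemma dim0_tgt (M N : module A) (f : Hom M N) : \dim {: N} = 0%N -> f = 0.
Proof.
move=> N0; apply: Hom_ext => x; rewrite Hom_zeroE.
have e : ({: N} = 0)%VS by apply/eqP; rewrite -dimv_eq0 N0.
by apply/eqP; rewrite -memv0 -e memvf.
Qed.

Definition cterm X i : pmod A := Pmod (@term_proj k A X i).

Definition two_term_arrow (T : cplx A) : arrow (prjl A) :=
  @Arrow k (prjl A) (cterm T (-1)) (cterm T 0) (diff T (-1)).

Section Rigid.
Variable T : cplx A.
Hypothesis T2 : two_term T.

Lemma two_steps_zero (i : int) (f : Hom (T i) (T (i + 1 + 1))) : f = 0.
Proof.
case: (eqVneq i (-1)) => [e|/eqP i1].
  by apply: dim0_tgt; apply: T2; lia.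
case: (eqVneq i 0) => [e|/eqP i0].
  by apply: dim0_tgt; apply: T2; lia.
by apply: dim0_src; apply: T2.
Qed.

(** A map from T(-1) to T(0) is a chain map from T to T[1], and a homotopy
    from it to zero is a pair of maps as in [orth]. *)
Lemma two_term_rigid : silting T -> orth (two_term_arrow T) (two_term_arrow T).
Proof.
move=> [sT _] /= w.
pose phi (i : int) : Hom (T i) (T (i + 1)) :=
  match i as i return Hom (T i) (T (i + 1)) with
  | Negz 0 => w
  | _ => 0
  end.
have phiP i : hcomp (phi (i + 1) : Hom (T (i + 1)) (shift T (i + 1))) (diff T i) =
    hcomp (diff (shift T) i) (phi i).
  by rewrite [LHS]two_steps_zero [RHS]two_steps_zero.
have [h hP] := sT 1%N isT (@Chmap _ _ T (shift T) phi phiP).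
have := hP (Negz 1) => e.
exists (h (Negz 0)), (- h (Negz 1)).
have -> : w = phi (Negz 1 + 1) - 0 by rewrite subr0.
rewrite [LHS]e addrC; congr (_ + _).
rewrite [RHS](lcompNr (L := modl A)); exact: (lcompNl (L := modl A)).
Qed.

End Rigid.

End Complexes.

Section Summands.
Variables (k : fieldType) (A : falgType k).
Implicit Types X Y : cplx A.


Section Summand.
Variables (T X : cplx A) (i : chmap X T) (p : chmap T X).
Hypothesis T2 : two_term T.
Hypothesis pi : homotopic (chcomp p i) (chid X).

Let h := sval (cid pi).
Let hE (j : int) : hcomp (p (j + 1)) (i (j + 1)) =
  hid (X (j + 1)) + (hcomp (diff X j) (h j) + hcomp (h (j + 1)) (diff X (j + 1))).
Proof.
have e := svalP (cid pi) j; rewrite -[X in _ = _ + X]e [RHS]addrC.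
exact: (esym (subrK _ _)).
Qed.

Let fT : arrow (prjl A) := two_term_arrow T.

(** The composite i p is an endomorphism of the arrow T(-1) -> T(0),
    idempotent up to homotopy. *)
Fact ip_square : hcomp (hcomp (i 0) (p 0)) (diff T (-1)) =
  hcomp (diff T (-1)) (hcomp (i (-1)) (p (-1))).
Proof. exact: (chmapP (chcomp i p) (-1)). Qed.

Definition ip_arrow : sqhom fT fT := @mk_sq _ (prjl A) fT fT _ _ ip_square.

(** Null-homotopic endomorphisms; they form an ideal. *)
Definition null_arrow (u : sqhom fT fT) : Prop := exists eta : Hom (T 0) (T (-1)),
  am1 u = hcomp eta (diff T (-1)) /\ am0 u = hcomp (diff T (-1)) eta.

Definition eta0 : Hom (T 0) (T (-1)) := hcomp (hcomp (i (-1)) (h (Negz 0))) (p 0).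

Let i_d (j : int) x : vsval (i (j + 1)) (vsval (diff X j) x) = vsval (diff T j) (vsval (i j) x).
Proof. by have := Hom_congr x (chmapP i j); rewrite !hcompE. Qed.

Let p_d (j : int) x : vsval (p (j + 1)) (vsval (diff T j) x) = vsval (diff X j) (vsval (p j) x).
Proof. by have := Hom_congr x (chmapP p j); rewrite !hcompE. Qed.

Let pi_h (j : int) y : vsval (p (j + 1)) (vsval (i (j + 1)) y) =
  y + (vsval (diff X j) (vsval (h j) y) + vsval (h (j + 1)) (vsval (diff X (j + 1)) y)).
Proof. by have := Hom_congr y (hE j); rewrite !(Hom_addE, hcompE, hidE). Qed.

Let dT0 (j : int) x : j <> -1 -> vsval (diff T j) x = 0.
Proof.
move=> j1; case: (eqVneq j 0) => [e|/eqP j0].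
  by rewrite (dim0_tgt (diff T j)) ?Hom_zeroE // T2 //; lia.
by rewrite (dim0_src (diff T j)) ?Hom_zeroE // T2.
Qed.

Let i_h (y : X 0) : vsval (diff X 0) y = 0 ->
  vsval (i 0) (vsval (p 0) (vsval (i 0) y)) =
  vsval (i 0) y + vsval (diff T (-1)) (vsval (i (-1)) (vsval (h (-1)) y)).
Proof.
move=> y0; rewrite [vsval (p 0) _](pi_h (j := -1) y) [vsval (diff X (-1 + 1)) y]y0.
rewrite linear0 addr0 linearD; congr (_ + _); exact: (i_d (j := -1)).
Qed.

Let i_h' (y : X (-1)) :
  vsval (i (-1)) (vsval (p (-1)) (vsval (i (-1)) y)) =
  vsval (i (-1)) y + vsval (i (-1)) (vsval (h (-1)) (vsval (diff X (-1)) y)).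
Proof.
rewrite [vsval (p (-1)) _](pi_h (j := Negz 1) y) !linearD; congr (_ + _).
rewrite [X in X + _](_ : _ = 0) ?add0r //.
by rewrite [LHS](i_d (j := Negz 1)) dT0.
Qed.

Let dp0 (x : T 0) : vsval (diff X 0) (vsval (p 0) x) = 0.
Proof. by rewrite -[LHS](p_d (j := 0)) dT0 ?linear0. Qed.

Lemma ip_idempotent : null_arrow (arrow_comp ip_arrow ip_arrow - ip_arrow).
Proof.
have e1 : am1 (arrow_comp ip_arrow ip_arrow - ip_arrow) =
  hcomp (hcomp (i (-1)) (p (-1))) (hcomp (i (-1)) (p (-1))) - hcomp (i (-1)) (p (-1)).
  by rewrite /am1 linearB.
have e0 : am0 (arrow_comp ip_arrow ip_arrow - ip_arrow) =
  hcomp (hcomp (i 0) (p 0)) (hcomp (i 0) (p 0)) - hcomp (i 0) (p 0).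
  by rewrite /am0 linearB.
exists eta0; rewrite e1 e0; split; apply: Hom_ext => x.
  rewrite Hom_addE Hom_oppE !hcompE i_h' addrC addKr.
  by rewrite -[vsval (diff X (-1)) _](p_d (j := -1)).
rewrite Hom_addE Hom_oppE !hcompE i_h ?dp0 // addrC addKr //.
Qed.

Lemma null_add u v : null_arrow u -> null_arrow v -> null_arrow (u + v).
Proof.
move=> [a [a1 a0]] [b [b1 b0]]; exists (a + b).
have e1 : am1 (u + v) = am1 u + am1 v by rewrite /am1 linearD.
have e0 : am0 (u + v) = am0 u + am0 v by rewrite /am0 linearD.
split.
  apply: etrans e1 _; apply: etrans (congr2 +%R a1 b1) _.
  exact: (esym (lcompDl (L := modl A) _ _ _)).
apply: etrans e0 _; apply: etrans (congr2 +%R a0 b0) _.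
exact: (esym (lcompDr (L := modl A) _ _ _)).
Qed.

Lemma null_l (u v : sqhom fT fT) : null_arrow u -> null_arrow (arrow_comp v u).
Proof.
move=> [a [a1 a0]]; exists (hcomp (am1 v) a); split.
  by rewrite -[LHS]/(hcomp (am1 v) (am1 u)) a1 hcompA.
rewrite -[LHS]/(hcomp (am0 v) (am0 u)) a0 !hcompA.
by congr (hcomp _ a); exact: (amE v).
Qed.

Lemma null_r (u v : sqhom fT fT) : null_arrow u -> null_arrow (arrow_comp u v).
Proof.
move=> [a [a1 a0]]; exists (hcomp a (am0 v)); split.
  rewrite -[LHS]/(hcomp (am1 u) (am1 v)) a1 -!hcompA.
  by congr (hcomp a _); exact: (esym (amE v)).
by rewrite -[LHS]/(hcomp (am0 u) (am0 v)) a0 hcompA.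
Qed.

(** A summand X of T in the homotopy category need not be two-term. But the
    idempotent i p of T up to homotopy is homotopic to a genuine idempotent of
    the arrow, by [lift_idempotent], and this one splits. *)
Lemma summand_arrow : exists (D : arrow (prjl A)) (a : sqhom D fT) (b : sqhom fT D)
    (eta : Hom (T 0) (T (-1))),
  [/\ arrow_comp b a = arrow_id D,
      hcomp (am1 a) (am1 b) = hcomp (i (-1)) (p (-1)) + hcomp eta (diff T (-1))
    & hcomp (am0 a) (am0 b) = hcomp (i 0) (p 0) + hcomp (diff T (-1)) eta].
Proof.
have [e [ee [eta [n1 n0]]]] :=
  @lift_idempotent _ (arrl (prjl A)) fT null_arrow null_add null_l null_r ip_arrow ip_idempotent.
have [D [a [b [ba ab]]]] := lsplit (l := arrl (prjl A)) ee.
exists D, a, b, eta; split=> //.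
  have -> : hcomp (am1 a) (am1 b) = am1 e := congr1 (@am1 _ _ _ _) ab.
  rewrite -n1 /am1 linearB /= addrC; exact: (esym (subrK _ _)).
have -> : hcomp (am0 a) (am0 b) = am0 e := congr1 (@am0 _ _ _ _) ab.
rewrite -n0 /am0 linearB /= addrC; exact: (esym (subrK _ _)).
Qed.

Section EulerCharacteristic.
Variable N : module A.

Let c (j : int) : nat := \dim {: Hom (X j) N}.
Let r (j : int) : nat := \dim (limg (pull (L := modl A) N (diff X j))).

Let pull_diff j : (\dim (lker (pull (L := modl A) N (diff X j))) + r j = c (j + 1))%N.
Proof. exact: (pull_dim (L := modl A)). Qed.

(** In these degrees T vanishes, so that the homotopy h contracts X. *)
Lemma exact_outside j : j <> -1 -> j <> 0 -> c j = (r (j - 1) + r j)%N.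
Proof.
rewrite -[j](subrK 1); move: (j - 1) => l l1 l0; rewrite addrK -pull_diff addnC.
congr (_ + _)%N; congr (\dim _); apply/vspaceP => u.
rewrite (mem_pull_ker (L := modl A)); apply/eqP/(mem_pull (L := modl A)).
  move=> ud; exists (- hcomp u (h (l + 1)) : lhom (l := modl A) _ _).
  apply: etrans _ (esym (lcompNl (L := modl A) _ _)).
  apply: Hom_ext => x; rewrite Hom_oppE !hcompE.
  have iz : vsval (i (l + 1)) x = 0 by rewrite (dim0_tgt (i (l + 1))) ?Hom_zeroE // T2.
  have ud0 y : vsval u (vsval (diff X l) y) = 0.
    by have := Hom_congr y ud; rewrite hcompE Hom_zeroE.
  have e : vsval u 0 = vsval u (x + (vsval (diff X l) (vsval (h l) x) +
      vsval (h (l + 1)) (vsval (diff X (l + 1)) x))).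
    by rewrite -(pi_h (j := l) x) iz !linear0.
  have e2 (y z w : X (l + 1)) : vsval u (y + (z + w)) = vsval u y + (vsval u z + vsval u w).
    by rewrite !linearD.
  move: e; rewrite e2 ud0 add0r linear0 => /esym/eqP.
  by rewrite addr_eq0 => /eqP.
move=> [w ->]; apply: Hom_ext => x; rewrite !hcompE diff0 linear0 Hom_zeroE //.
Qed.

Variables (D : arrow (prjl A)) (a : sqhom D fT) (b : sqhom fT D)
  (eta : Hom (T 0) (T (-1))).
Hypotheses (ba : arrow_comp b a = arrow_id D)
  (ab1 : hcomp (am1 a) (am1 b) = hcomp (i (-1)) (p (-1)) + hcomp eta (diff T (-1)))
  (ab0 : hcomp (am0 a) (am0 b) = hcomp (i 0) (p 0) + hcomp (diff T (-1)) eta).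

Let d1 : nat := \dim {: Hom (asrc D) N}.
Let d0 : nat := \dim {: Hom (atgt D) N}.

Lemma exact_degrees : exists s : nat,
  (c (-1)%R + s = r (Negz 1) + r (-1)%R + d1)%N /\ (c 0%R + s = r (-1)%R + r 0%R + d0)%N.
Proof.
have ba1 : hcomp (am1 b) (am1 a) = hid (asrc D) := congr1 (@am1 _ _ D D) ba.
have ba0 : hcomp (am0 b) (am0 a) = hid (atgt D) := congr1 (@am0 _ _ D D) ba.
have xx1 : hcomp (diff X (-1)) (diff X (Negz 1)) = 0 := diffK X (Negz 1).
have xx0 : hcomp (diff X 0) (diff X (-1)) = 0 := diffK X (-1).
have ix : hcomp (i 0) (diff X (-1)) = hcomp (diff T (-1)) (i (-1)) := chmapP i (-1).
have pd : hcomp (p 0) (diff T (-1)) = hcomp (diff X (-1)) (p (-1)) := chmapP p (-1).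
have xp0 : hcomp (diff X 0) (p 0) = 0.
  by apply: Hom_ext => x; rewrite hcompE dp0 Hom_zeroE.
have ix2 : hcomp (i (-1)) (diff X (Negz 1)) = 0.
  by apply: Hom_ext => x; rewrite hcompE [LHS](i_d (j := Negz 1)) dT0 // Hom_zeroE.
pose K (j : int) : nat := \dim (lker (pull (L := modl A) N (diff X j))).
pose Kf : nat := \dim (lker (pull (L := modl A) N (amap D : Hom _ _))).
pose If : nat := \dim (limg (pull (L := modl A) N (amap D : Hom _ _))).
have c0 : K (-1) = (Kf + r 0%R)%N := @compare0 k (modl A) N _ _ _ _ _ _ _ _ _ _ _ _ _ _ _ _ _ _ _ _ _ _
  xx0 ix pd (hE (-1)) xp0 (amE a) (amE b) ba0 ab0.
have c1 : (K (Negz 1) + If = d1 + r (-1)%R)%N := @compare1 k (modl A) N _ _ _ _ _ _ _ _ _ _ _ _ _ _ _ _ _ _ _ _ _ _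
  xx1 ix pd (hE (Negz 1)) ix2 (amE a) (amE b) ba1 ab1.
have q0 : (K (-1)%R + r (-1)%R = c 0%R)%N := pull_diff (-1).
have q1 : (K (Negz 1) + r (Negz 1) = c (-1)%R)%N := pull_diff (Negz 1).
have qf : (Kf + If = d0)%N := pull_dim (L := modl A) N (amap D : Hom _ _).
exists If; clearbody c r K Kf If d1 d0; move: c0 c1 q0 q1 qf; clear; lia.
Qed.

Lemma euler_summand (n : nat) :
  (forall j : int, (n < `|j|)%N -> \dim {: X j} = 0%N) ->
  \sum_(l < n.*2.+1) (let j := l%:Z - n%:Z in (-1) ^+ `|j|%N * (c j)%:Z) =
    d0%:Z - d1%:Z.
Proof.
move=> Xn; have [s [s1 s0]] := exact_degrees.
apply: (alternating_euler exact_outside s1 s0) => [j jn|j|j].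
- apply/eqP; rewrite dimv_eq0 -subv0; apply/subvP => u _; rewrite memv0.
  by rewrite (dim0_src u (Xn j jn)).
- by apply: dimvS; exact: subvf.
by rewrite -pull_diff leq_addl.
Qed.

End EulerCharacteristic.

(** The Euler characteristic of Hom(X, N) is an invariant of the homotopy
    type, and so it can be computed from D. *)
Lemma summand_euler : exists D : arrow (prjl A),
  retract (L := arrl (prjl A)) D fT /\
  forall (N : module A) (n : nat),
    (forall j : int, (n < `|j|)%N -> \dim {: X j} = 0%N) ->
    \sum_(l < n.*2.+1) (let j := l%:Z - n%:Z in
      (-1) ^+ `|j|%N * (\dim {: Hom (X j) N})%:Z) =
    (\dim {: Hom (atgt D) N})%:Z - (\dim {: Hom (asrc D) N})%:Z.
Proof.
have [D [a [b [eta [ba ab1 ab0]]]]] := summand_arrow.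
exists D; split; first by exists a, b.
by move=> N n; exact: (euler_summand N ba ab1 ab0).
Qed.

End Summand.
End Summands.

(** * The Cartan form on g-cones *)
Section Classes.
Variables (k : closedFieldType) (A : falgType k) (t : nat) (P : 'I_t -> module A).
Hypothesis hP : indec_projectives P.
Hypothesis hA : weakly_symmetric A.

Lemma multiplicities_mult (Q : prjl A) (m : 'I_t -> nat) :
  multiplicities P Q m -> mult hP hA Q =1 m.
Proof. exact: (@mult_family _ _ _ _ hP hA). Qed.

Lemma summand_class (T X : cplx A) (i : chmap X T) (p : chmap T X) (g : 'cV[int]_t) :
  two_term T -> homotopic (chcomp p i) (chid X) -> K0_class P X g ->
  exists D : arrow (prjl A),
    retract (L := arrl (prjl A)) D (two_term_arrow T) /\
    forall j, cls (mult hP hA) D j = g j 0.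
Proof.
move=> T2 pi [n [m [Xn Xm gE]]].
have [D [DT De]] := summand_euler T2 pi; exists D; split=> // j.
rewrite gE -[LHS](De (top_module hP hA j) n Xn); apply: eq_bigr => l _ /=.
by rewrite -(multiplicities_mult (Q := cterm X (l%:Z - n%:Z)) (Xm _) j).
Qed.

(** The summands T_ s of T are replaced by arrows D s with the same classes.
    They are retracts of one rigid arrow, hence orthogonal to each other, and
    [cartan_form_ge0] applies to each pair. *)
Lemma gcone_form_ge0 (R : realType) (T : cplx A) (v : 'cV[R]_t) :
  two_term T -> silting T -> gcone P T v ->
  0 <= \sum_i \sum_j v i 0 * v j 0 * (cartan_nat P i j)%:R.
Proof.
move=> T2 Ts [r [T_ [g [a [_ [inj [prj [pi _ _]]] gE a0 ->]]]]].
have D_ s := cid (summand_class T2 (pi s) (gE s)).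
pose D s := sval (D_ s).
have DT s : retract (L := arrl (prjl A)) (D s) (two_term_arrow T) := proj1 (svalP (D_ s)).
have Dg s j : cls (mult hP hA) (D s) j = g s j 0 := proj2 (svalP (D_ s)) j.
have DD s s' : orth (D s) (D s').
  by apply: (orth_retract_l (DT s)); apply: (orth_retract_r (DT s')); exact: two_term_rigid.
pose w j : R := (\sum_s a s *: map_mx intr (g s)) j 0.
have wE j : w j = \sum_s a s * (cls (mult hP hA) (D s) j)%:~R.
  by rewrite /w summxE; apply: eq_bigr => s _; rewrite !mxE Dg.
rewrite -[X in 0 <= X]/(\sum_i \sum_j w i * w j * (cartan_nat P i j)%:R).
rewrite (cartan_form_cone _ wE); apply: sumr_ge0 => s _; apply: sumr_ge0 => s' _.
rewrite mulr_ge0 ?mulr_ge0 // ler0z.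
exact: (cartan_form_ge0 (@closed_infinite k) (@hom_mult _ _ _ _ hP hA)
  (@forms_exist _ _ _ _ hP hA) (DD s s') (DD s' s) (DD s' s')).
Qed.

End Classes.

(** * Density and the theorem *)
Section Density.
Import numFieldNormedType.Exports.

Lemma quadratic_form_sum (R : realType) t (C : 'M[R]_t) (v : 'cV[R]_t) :
  (v^T *m C *m v) 0 0 = \sum_i \sum_j v i 0 * v j 0 * C i j.
Proof.
rewrite mxE exchange_big; apply: eq_bigr => j _ /=.
rewrite mxE mulr_suml; apply: eq_bigr => i _.
by rewrite !mxE mulrAC.
Qed.

Lemma quadratic_form_continuous (R : realType) t (C : 'I_t -> 'I_t -> R) :
  continuous (fun v : 'cV[R]_t => \sum_i \sum_j v i 0 * v j 0 * C i j : R).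
Proof.
move=> v; have vF : Filter (nbhs v) by exact: nbhs_filter.
apply: cvg_big => [|i _]; first exact: add_continuous.
apply: cvg_big => [|j _]; first exact: add_continuous.
by apply: cvgMl; apply: cvgM; exact: coord_continuous.
Qed.

(** The set where q is negative is open, so it would meet S. *)
Lemma dense_ge0 (R : realType) m n (S : set 'M[R]_(m, n)) (q : 'M[R]_(m, n) -> R) :
  continuous q -> dense S -> (forall v, S v -> 0 <= q v) -> forall v, 0 <= q v.
Proof.
move=> qc Sd Sq v; rewrite leNgt; apply/negP => qv.
have [|w [/= qw Sw]] := Sd (q @^-1` [set x | x < 0])%classic (ex_intro _ v qv).
  by apply: open_comp => [w _|]; [exact: qc | exact: open_lt].
by move: (Sq w Sw); rewrite leNgt qw.
Qed.

End Density.

Theorem proposition1p1 (R : realType) (k : closedFieldType) (p : nat)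
    (hp : p \in [pchar k]%R) (A : falgType k) (t : nat) (P : 'I_t -> module A)
    (hP : indec_projectives P) (hA : weakly_symmetric A) :
  (tau_tilting_finite A -> positive_definite (cartan P R)) /\
  (g_tame P R -> positive_semidefinite (cartan P R)).
Proof.
have formE (v : 'cV[R]_t) : (v^T *m cartan P R *m v) 0 0 =
    \sum_i \sum_j v i 0 * v j 0 * (cartan_nat P i j)%:R.
  rewrite quadratic_form_sum; apply: eq_bigr => i _; apply: eq_bigr => j _.
  by rewrite mxE.
split=> [fin v v0|tame v]; rewrite formE.
  apply: (@tau_finite_positive _ _ _ _ hP hA _ (fun i => v i 0)) => //.
  apply: contrapT => h; case/eqP: v0; apply/matrixP => i j; rewrite ord1 mxE.
  by apply: contrapT => /eqP vi; apply: h; exists i.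
have h := dense_ge0 (@quadratic_form_continuous R t
  (fun i j => (cartan_nat P i j)%:R)) tame.
move: v; apply: h => v [T [T2 Ts _ Tv]].
exact: (@gcone_form_ge0 _ _ _ _ hP hA _ _ _ T2 Ts Tv).
Qed.
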